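(* Let $K$ be a field of characteristic zero, $R=K[x_1,\ldots,x_n]$, $1\le k\le n$, and $R'=K[x_1,\ldots,x_{n-k}]$. (i) Let $A=R/I$ be a graded Artinian $K$-algebra with the $k$-WLP, and let $h$ be its Hilbert function. If $k<n$, then the graded Betti numbers of $A$ satisfy, for all $i,j\ge 0$, $$\beta_{i,i+j}(A)\le \beta_{i,i+j}(\Delta^k h,R')+\binom{n-k}{i-1}c^{(\Delta^{k-1}h)}_{j+1}+\cdots+\binom{n-2}{i-1}c^{(\Delta h)}_{j+1}+\binom{n-1}{i-1}c^{(h)}_{j+1}.$$ If $k=n$, then for all $i\ge 1$ and $j\ge 0$, $$\beta_{i,i+j}(A)\le \binom{0}{i-1}c^{(\Delta^{n-1}h)}_{j+1}+\binom{1}{i-1}c^{(\Delta^{n-2}h)}_{j+1}+\cdots+\binom{n-2}{i-1}c^{(\Delta h)}_{j+1}+\binom{n-1}{i-1}c^{(h)}_{j+1}.$$ (ii) Let $h$ be an O-sequence such that there is a graded Artinian $K$-algebra $R/J$ having the $k$-WLP and $h$ as Hilbert function. Then there is a Borel-fixed ideal $I$ of $R$ such that $R/I$ has the $k$-SLP, the Hilbert function of $R/I$ is $h$, and for $A=R/I$ equality holds in the corresponding inequality of (i) for all $i,j$ in the range given there.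
   Context: $R=K[x_1,\ldots,x_n]$ has the standard grading. The Hilbert function of a graded algebra $A$ is $t\mapsto\dim_KA_t$, identified with a finite sequence $(h_0,\ldots,h_c)$ when $A$ is Artinian ($\dim_K A<\infty$), with trailing zeros omitted and $h_j=0$ for $j<0$ and $j>c$. An O-sequence is a sequence that is the Hilbert function of some standard graded $K$-algebra. SLP/WLP: for a graded Artinian $K$-algebra $A=\bigoplus_iA_i$ and $\ell\in A_1$, $(A,\ell)$ has the SLP (resp. WLP) if the map $\times\ell^s:A_i\to A_{i+s}$ has full rank (is injective or surjective) for every $i\ge0$ and every $s>0$ (resp. for $s=1$). $A$ has the $k$-SLP (resp. $k$-WLP) if there are $g_1,\ldots,g_k\in A_1$ such that $(A,g_1)$ has the SLP (resp. WLP) and $(A/(g_1,\ldots,g_{i-1}),g_i)$ has the SLP (resp. WLP) for all $i=2,\ldots,k$. Difference: $(\Delta h)_i=\max\{h_i-h_{i-1},0\}$; $\Delta^t$ is $\Delta$ applied $t$ times, $\Delta^0h=h$. For a finite sequence $h$ set $c^{(h)}_j=\max\{h_{j-1}-h_j,0\}$, where $h_{-1}=0$ and $h_j=0$ beyond the last entry. Binomial coefficients $\binom{a}{b}$ are $0$ if $b<0$ or $b>a$, and $\binom00=1$. Graded Betti numbers: $\beta_{i,i+j}(R/I)=\dim_K[\operatorname{Tor}_i^R(R/I,K)]_{i+j}$, and similarly over $R'$. For a Hilbert function $h'$ of a graded Artinian quotient of $R'$, there is a unique lex-segment ideal $J'\subset R'$ (a monomial ideal such that, in each degree $d$, its degree-$d$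 monomials are the first ones in lexicographic order with $x_1>x_2>\cdots$) with $R'/J'$ having Hilbert function $h'$; define $\beta_{i,i+j}(h',R')=\beta_{i,i+j}(R'/J')$. Borel-fixed: for $g=(g_{ij})\in GL(n;K)$ let $g$ act on $R$ by $gx_j=\sum_ig_{ij}x_i$; $I$ is Borel-fixed if $g(I)=I$ for every upper triangular $g\in GL(n;K)$. *)

(* Defs.v *)
From mathcomp Require Import all_boot all_order all_algebra.
From mathcomp Require Import mpoly.
From mathcomp Require Import boolp classical_sets.

Set Implicit Arguments.
Unset Strict Implicit.
Unset Printing Implicit Defensive.

Import Order.TTheory GRing.Theory.

Local Open Scope classical_set_scope.
Local Open Scope ring_scope.

Definition ideal_gen (R : comNzRingType) (S : set R) : {pred R} :=
  fun p => `[< exists (r : nat) (c f : 'I_r -> R),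
    (forall l, S (f l)) /\ p = \sum_(l < r) c l * f l >].

(* A / (g_1, ..., g_s) for A = R/I is R/(adjoin I [:: g_1; ...; g_s]). *)
Definition adjoin (R : comNzRingType) (I : {pred R}) (s : seq R) : {pred R} :=
  ideal_gen [set p | p \in I \/ p \in s].

Section GradedQuotients.
Variables (K : fieldType) (n : nat).
Local Notation R := {mpoly K[n]}.
Implicit Types (I J : {pred R}).

(* [idealr_closed] includes 1 \notin I, so that (R/I)_0 = K. *)
Definition homog_ideal I : Prop :=
  idealr_closed I /\ (forall p d, p \in I -> pihomog mdeg d p \in I).

Definition artinian_quot I : Prop :=
  exists (r : nat) (b : 'I_r -> R), forall p : R,
    exists c : 'I_r -> K, p - \sum_(l < r) c l *: b l \in I.

Definition graded_artinian I : Prop := homog_ideal I /\ artinian_quot I.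

(* The classes of b form a K-basis of (R/I)_d. *)
Definition quot_basis I (d r : nat) (b : 'I_r -> R) : Prop :=
  [/\ forall l, b l \is d.-homog,
      forall c : 'I_r -> K,
        \sum_(l < r) c l *: b l \in I -> forall l, c l = 0
    & forall p, p \is d.-homog ->
        exists c : 'I_r -> K, p - \sum_(l < r) c l *: b l \in I].

Definition hilb I (d : nat) : nat :=
  get [set r | exists b : 'I_r -> R, quot_basis I d b].

(* Multiplication by f from (R/I)_i to (R/I)_(i + s) is injective or
   surjective, for f a form of degree s. *)
Definition full_rank I (f : R) (s i : nat) : Prop :=
  (forall p, p \is i.-homog -> f * p \in I -> p \in I) \/
  (forall q, q \is (i + s).-homog ->
     exists2 p, p \is i.-homog & q - f * p \in I).

Definition SLP I (l : R) : Prop :=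
  forall i s : nat, (0 < s)%N -> full_rank I (l ^+ s) s i.

Definition WLP I (l : R) : Prop := forall i : nat, full_rank I l 1 i.

Definition kSLP (k : nat) I : Prop :=
  exists g : k.-tuple R, (forall i, tnth g i \is 1.-homog) /\
    forall i : 'I_k, SLP (adjoin I (take i g)) (tnth g i).

Definition kWLP (k : nat) I : Prop :=
  exists g : k.-tuple R, (forall i, tnth g i \is 1.-homog) /\
    forall i : 'I_k, WLP (adjoin I (take i g)) (tnth g i).

Definition monomial_ideal I : Prop :=
  idealr_closed I /\
  exists M : set 'X_{1..n}, I =i ideal_gen [set 'X_[K, m] | m in M].

(* The order of the library on 'X_{1..n}, restricted to a fixed degree, is the
   lexicographic order with x_1 > ... > x_n: see [ltmcP]. *)
Definition lex_segment I : Prop :=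
  monomial_ideal I /\
  forall m m' : 'X_{1..n}, mdeg m = mdeg m' -> (m <= m')%O ->
    'X_[m] \in I -> 'X_[m'] \in I.

Definition lex_ideal (h : nat -> nat) : {pred R} :=
  get [set J | lex_segment J /\ hilb J =1 h].

Definition lin_subst (g : 'M[K]_n) (p : R) : R :=
  p \mPo [tuple \sum_(i < n) g i j *: 'X_i | j < n].

(* [is_trig_mx] means lower triangular. *)
Definition borel_fixed I : Prop :=
  forall g : 'M[K]_n, g \in unitmx -> is_trig_mx g^T ->
    lin_subst g @` [set` I] = [set` I].

(* A complex of finite graded free modules F_i = \bigoplus_a R(- shift i a),
   whose elements are row vectors; [bd i] is the matrix of F_(i+1) -> F_i.
   As R/I lives in degrees >= 0, shifts in nat are enough to resolve it. *)
Record free_complex := FreeComplex {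
  rk : nat -> nat;
  shift : forall i, 'I_(rk i) -> nat;
  bd : forall i, 'M[R]_(rk i.+1, rk i)
}.

(* F, augmented by the map F_0 -> R/I whose values on the basis are the classes
   of the entries of aug, is a graded free resolution of R/I. *)
Definition resolves (F : free_complex) (aug : 'cV[R]_(rk F 0)) I : Prop :=
  [/\ forall i a b, bd F i a b != 0 ->
        exists2 e : nat, shift a = (shift b + e)%N & bd F i a b \is e.-homog,
      forall a, aug a 0 \is (shift a).-homog,
      forall p, exists u : 'rV[R]_(rk F 0), p - (u *m aug) 0 0 \in I,
      forall u : 'rV[R]_(rk F 0),
        (u *m aug) 0 0 \in I <-> exists v, u = v *m bd F 0
    & forall i (u : 'rV[R]_(rk F i.+1)),
        u *m bd F i = 0 <-> exists v, u = v *m bd F i.+1].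

(* F (x)_R K, with K = R/(x_1, ..., x_n): F_i (x) K has as basis the generators
   of F_i, and the matrices are reduced to their constant terms. *)
Definition bdK (F : free_complex) (i : nat) : 'M[K]_(rk F i.+1, rk F i) :=
  map_mx (mcoeff 0%MM) (bd F i).

(* Its row space is the degree d part of F_i (x) K. *)
Definition deg_part (F : free_complex) (i d : nat) : 'M[K]_(rk F i) :=
  diag_mx (\row_a (shift a == d)%:R).

Definition kerK (F : free_complex) (i : nat) : 'M[K]_(rk F i) :=
  match i with 0%N => 1%:M | i'.+1 => kermx (bdK F i') end.

(* dim_K of the degree d part of H_i(F (x) K). *)
Definition tor_dim (F : free_complex) (i d : nat) : nat :=
  (\rank (deg_part F i d :&: kerK F i)%MS
    - \rank (deg_part F i.+1 d *m bdK F i))%N.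

(* dim_K [Tor_i^R(R/I, K)]_d, computed from any graded free resolution. *)
Definition betti I (i d : nat) : nat :=
  get [set b | exists (F : free_complex) (aug : 'cV[R]_(rk F 0)),
    resolves aug I /\ b = tor_dim F i d].

End GradedQuotients.

Arguments lex_ideal : clear implicits.

Definition O_sequence (K : fieldType) (h : nat -> nat) : Prop :=
  exists (m : nat) (J : {pred {mpoly K[m]}}), homog_ideal J /\ hilb J =1 h.

Definition betti_lex (K : fieldType) (n : nat) (h : nat -> nat) (i d : nat) :=
  betti (lex_ideal K n h) i d.

(* Finite sequences are functions nat -> nat that vanish eventually; truncated
   subtraction gives the maximum with 0. *)
Definition delta (h : nat -> nat) (i : nat) : nat :=
  (h i - (if i is i'.+1 then h i' else 0))%N.

Definition drop_seq (h : nat -> nat) (j : nat) : nat :=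
  ((if j is j'.+1 then h j' else 0) - h j)%N.

(* The binomial coefficient (a choose i - 1), which is 0 for i = 0. *)
Definition bin_pred (a i : nat) : nat := if i is i'.+1 then 'C(a, i') else 0%N.

(* The summand of index p is (n - p choose i - 1) c^(Delta^(p - 1) h)_(j + 1). *)
Definition drop_sum (n k : nat) (h : nat -> nat) (i j : nat) : nat :=
  (\sum_(1 <= p < k.+1)
     bin_pred (n - p) i * drop_seq (iter p.-1 delta h) j.+1)%N.

(* Main.v *)
(* The Betti numbers of A are the dimensions of the Koszul homology of A. Adding the
   variables x_0, ..., x_(n-1) to the Koszul complex one at a time, with coefficients
   in A modulo the remaining ones, bounds them by a sum over m of binomial coefficients
   times dim (0 : x_m)_j, and each of these dimensions is determined by the Hilbert
   functions H_m of A modulo all variables but the first m. The bound increases with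
   H_m for m < n. In suitable coordinates the last k variables are the forms of the
   k-WLP, so that H_(n-p) is the p-th difference of h for p <= k, and the others are
   generic, so that Green's hyperplane restriction theorem bounds H_m for m < n - k by
   the values attained by the lex ideal. For stable monomial ideals the first bound is
   an equality (Eliahou-Kervaire).

   For (ii), start from the lex ideal in n - k variables and add the variables one at a
   time: if O is the finite set of standard monomials so far, with Hilbert function the
   difference of g, then u x^e is standard when fewer than g_(deg u + e) elements of O
   precede u. This keeps strong stability, and since g is unimodal the powers of x have
   full rank. *)
Require Import Defs.
From mathcomp Require Import all_boot all_order all_algebra.
From mathcomp Require Import perm mpoly zify.
From mathcomp Require Import boolp classical_sets.

Set Implicit Arguments.
Unset Strict Implicit.
Unset Printing Implicit Defensive.

Import Order.TTheory GRing.Theory.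

Local Open Scope ring_scope.

(** * Dimensions of subquotients *)

(** [betti] refers to an arbitrary graded free resolution, so the Koszul description needs one to
    compare with. An Artinian A = R/I has a finite homogeneous K-basis, and the commuting operators
    x_s (x) 1 - 1 (x) x_s on R (x) A have a Koszul complex that resolves A by finite free R-modules;
    reduced modulo the variables it is, up to sign, the Koszul complex of A. Chain maps and
    homotopies show that every resolution gives the same numbers. Passing from m to m + 1 variables
    gives an exact sequence of which the bound uses only exactness in the middle: what is lost are
    connecting maps and the differential on (0 : x_m). For stable monomial ideals both vanish, as
    cycles lift by setting x_m = 0 and the earlier variables kill (0 : x_m). All dimensions are
    those of subquotients of fixed, possibly infinite-dimensional spaces, so they form a relation,
    [qdim], whose existence needs an argument. Generic forms are found along lines, where a bad set
    lies in the root set of a nonzero polynomial; because A is Artinian, only finitely many degrees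
    impose conditions. *)

Section SubquotientDimension.
Variable K : fieldType.

Definition subspace (V : lmodType K) (P : V -> Prop) : Prop :=
  P 0 /\ forall c u v, P u -> P v -> P (c *: u + v).

Definition lin (V W : lmodType K) (f : V -> W) : Prop :=
  forall c u v, f (c *: u + v) = c *: f u + f v.

(* The dimension of (P + Q) / Q: there is no assumption that Q is inside P. *)
Definition qdim (V : lmodType K) (P Q : V -> Prop) (r : nat) : Prop :=
  exists b : 'I_r -> V, [/\ forall l, P (b l),
    forall c : 'I_r -> K, Q (\sum_(l < r) c l *: b l) -> forall l, c l = 0
  & forall p, P p -> exists c : 'I_r -> K, Q (p - \sum_(l < r) c l *: b l)].

Section Subspace.
Variables (V : lmodType K) (P : V -> Prop).
Hypothesis hP : subspace P.

Lemma subspace0 : P 0. Proof. by case: hP. Qed.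

Lemma subspaceD u v : P u -> P v -> P (u + v).
Proof. by move=> Pu Pv; rewrite -[u]scale1r; apply: hP.2. Qed.

Lemma subspaceZ c u : P u -> P (c *: u).
Proof. by move=> Pu; rewrite -[_ *: _]addr0; apply: hP.2 => //; exact: subspace0. Qed.

Lemma subspaceN u : P u -> P (- u).
Proof. by move=> Pu; rewrite -scaleN1r; apply: subspaceZ. Qed.

Lemma subspaceB u v : P u -> P v -> P (u - v).
Proof. by move=> Pu Pv; apply: subspaceD => //; apply: subspaceN. Qed.

Lemma subspaceBC u v : P (u - v) -> P (v - u).
Proof. by move=> /subspaceN; rewrite opprB. Qed.

Lemma subspace_sum (I : Type) (s : seq I) (A : pred I) (F : I -> V) :
  (forall i, A i -> P (F i)) -> P (\sum_(i <- s | A i) F i).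
Proof. by move=> h; apply: big_ind => //; [exact: subspace0|exact: subspaceD]. Qed.

Lemma subspace_lincomb (r : nat) (c : 'I_r -> K) (b : 'I_r -> V) :
  (forall l, P (b l)) -> P (\sum_l c l *: b l).
Proof. by move=> h; apply: subspace_sum => i _; apply: subspaceZ. Qed.

Lemma subspace_trans u v w : P (u - v) -> P (v - w) -> P (u - w).
Proof. by move=> h h'; rewrite -(subrK v u) -addrA; apply: subspaceD. Qed.

End Subspace.

Section Lin.
Variables (V W : lmodType K) (f : V -> W).
Hypothesis hf : lin f.

Lemma lin0 : f 0 = 0.
Proof. by have := hf (-1) 0 0; rewrite scaler0 addr0 scaleN1r addNr. Qed.

Lemma linD u v : f (u + v) = f u + f v.
Proof. by have := hf 1 u v; rewrite !scale1r. Qed.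

Lemma linZ c u : f (c *: u) = c *: f u.
Proof. by rewrite -[_ *: u]addr0 hf lin0 addr0. Qed.

Lemma linN u : f (- u) = - f u.
Proof. by rewrite -!scaleN1r linZ. Qed.

Lemma linB u v : f (u - v) = f u - f v.
Proof. by rewrite linD linN. Qed.

Lemma lin_sum (I : Type) (s : seq I) (A : pred I) (F : I -> V) :
  f (\sum_(i <- s | A i) F i) = \sum_(i <- s | A i) f (F i).
Proof. exact: (big_morph f linD lin0). Qed.

Lemma lin_lincomb (r : nat) (c : 'I_r -> K) (b : 'I_r -> V) :
  f (\sum_l c l *: b l) = \sum_l c l *: f (b l).
Proof. by rewrite lin_sum; apply: eq_bigr => i _; rewrite linZ. Qed.

Lemma subspace_preim (Q : W -> Prop) : subspace Q -> subspace (fun v => Q (f v)).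
Proof.
by move=> hQ; split=> [|c u v Qu Qv]; [rewrite lin0; apply: hQ.1|rewrite hf; apply: hQ.2].
Qed.

End Lin.

Lemma subspaceI (V : lmodType K) (P Q : V -> Prop) :
  subspace P -> subspace Q -> subspace (fun v => P v /\ Q v).
Proof.
move=> hP hQ; split=> [|c u v [? ?] [? ?]]; first by split; [exact: hP.1|exact: hQ.1].
by split; [exact: hP.2|exact: hQ.2].
Qed.

Section Dimension.
Variable V : lmodType K.
Implicit Types P Q : V -> Prop.

Lemma lincomb_exchange (r s : nat) (Q : V -> Prop) (b : 'I_r -> V) (e : 'I_s -> V)
    (M : 'I_r -> 'I_s -> K) (c : 'I_r -> K) :
  subspace Q -> (forall l, Q (b l - \sum_k M l k *: e k)) ->
  Q (\sum_l c l *: b l - \sum_k (\sum_l c l * M l k) *: e k).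
Proof.
move=> hQ hb.
have -> : \sum_l c l *: b l - \sum_k (\sum_l c l * M l k) *: e k =
   \sum_l c l *: (b l - \sum_k M l k *: e k).
  under [RHS]eq_bigr do rewrite scalerBr scaler_sumr.
  rewrite sumrB; congr (_ - _); rewrite exchange_big /=; apply: eq_bigr => k _.
  by rewrite scaler_suml; apply: eq_bigr => l _; rewrite scalerA.
by apply: subspace_lincomb.
Qed.

(** Steinitz modulo [Q]: a vector in the left kernel of the coefficient matrix would be a relation
    among the [b l], so this matrix has full row rank. *)
Lemma indep_le_span Q (r s : nat) (b : 'I_r -> V) (e : 'I_s -> V) :
  subspace Q ->
  (forall c : 'I_r -> K, Q (\sum_(l < r) c l *: b l) -> forall l, c l = 0) ->
  (forall l, exists c : 'I_s -> K, Q (b l - \sum_k c k *: e k)) ->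
  (r <= s)%N.
Proof.
move=> hQ hi /choice [M hM].
pose A := \matrix_(l, k) M l k.
suff /row_freeP[B AB] : row_free A by rewrite -(mxrank1 K r) -AB (leq_trans (mxrankM_maxl _ _)) ?rank_leq_col.
rewrite -kermx_eq0; apply/rowV0P => c /sub_kermxP cA0.
have /hi c0 : Q (\sum_l c 0 l *: b l).
  have := lincomb_exchange (c 0) hQ hM; rewrite [X in _ - X]big1 ?subr0 // => k _.
  have /rowP/(_ k) := cA0; rewrite !mxE => h.
  by rewrite (eq_bigr (fun l => c 0 l * A l k)) ?h ?scale0r // => l _; rewrite mxE.
by apply/rowP => l; rewrite c0 mxE.
Qed.

Lemma qdim_le_span P Q r s (e : 'I_s -> V) : subspace Q -> qdim P Q r ->
  (forall p, P p -> exists c : 'I_s -> K, Q (p - \sum_k c k *: e k)) -> (r <= s)%N.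
Proof.
by move=> hQ [b [Pb bi _]] he; apply: (indep_le_span hQ bi) => l; apply: he.
Qed.

Lemma qdim_unique P Q r r' : subspace Q -> qdim P Q r -> qdim P Q r' -> r = r'.
Proof.
move=> hQ h h'; apply/eqP; rewrite eqn_leq.
have [[b [_ _ bs]] [b' [_ _ bs']]] := (h, h').
by rewrite (qdim_le_span hQ h bs') (qdim_le_span hQ h' bs).
Qed.

(** A bound on independent families yields one of maximal size, and maximality makes it spanning.
    This is how dimensions are shown to exist inside an infinite-dimensional space. *)
Lemma qdim_of_bound P Q s : subspace Q ->
  (forall r (b : 'I_r -> V), (forall l, P (b l)) ->
    (forall c : 'I_r -> K, Q (\sum_(l < r) c l *: b l) -> forall l, c l = 0) ->
    (r <= s)%N) ->
  exists2 r, (r <= s)%N & qdim P Q r.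
Proof.
move=> hQ bound.
pose indep r := `[< exists b : 'I_r -> V, (forall l, P (b l)) /\
  forall c : 'I_r -> K, Q (\sum_(l < r) c l *: b l) -> forall l, c l = 0 >].
have exr : exists r, indep r.
  by exists 0; apply/asboolP; exists (fun=> 0); split=> [[]|c _ []].
have bnd r : indep r -> (r <= s)%N by move=> /asboolP[b [Pb bi]]; apply: (bound r b).
case: (ex_maxnP exr bnd) => r ri rmax; exists r; first exact: bnd.
have /asboolP[b [Pb bi]] := ri.
exists b; split=> // p Pp; apply: contrapT => np.
have /rmax : indep r.+1; last by rewrite ltnn.
apply/asboolP; exists (fun l => if unlift ord0 l is Some k then b k else p); split.
  by move=> l; case: unliftP => [k _|_].
move=> c; rewrite big_ord_recl unlift_none.
under eq_bigr do rewrite liftK.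
have [c0|c0] := eqVneq (c ord0) 0.
  rewrite c0 scale0r add0r => /bi h l.
  by case: (unliftP ord0 l) => [k ->|->].
(* The relation on the enlarged family has a nonzero coefficient at [p], so it can be solved for
   [p]. *)
move=> h; case: np; exists (fun k => - (c ord0)^-1 * c (lift ord0 k)).
have := subspaceZ hQ (c ord0)^-1 h.
rewrite scalerDr scalerA mulVf // scale1r scaler_sumr -sumrN.
congr (Q (_ + _)); apply: eq_bigr => k _.
by rewrite mulNr scaleNr opprK scalerA.
Qed.

Lemma qdim_of_span P Q s (e : 'I_s -> V) : subspace Q ->
  (forall p, P p -> exists c : 'I_s -> K, Q (p - \sum_k c k *: e k)) ->
  exists2 r, (r <= s)%N & qdim P Q r.
Proof.
move=> hQ he; apply: qdim_of_bound => // r b Pb bi.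
by apply: (indep_le_span hQ bi) => l; apply: he.
Qed.

Lemma eq_qdim P Q P' Q' r : (forall v, P v <-> P' v) ->
  (forall v, P v -> Q v <-> Q' v) -> subspace P -> qdim P Q r -> qdim P' Q' r.
Proof.
move=> eP eQ hP [b [Pb bi bs]]; exists b; split.
- by move=> l; apply/eP.
- by move=> c h; apply: bi; apply/eQ => //; apply: subspace_lincomb.
- move=> p /eP Pp; have [c h] := bs p Pp; exists c; apply/eQ => //.
  by apply: subspaceB => //; apply: subspace_lincomb.
Qed.

Lemma qdim_sub P Q P' Q' r : subspace P -> subspace Q' ->
  (forall v, P' v -> P v) -> (forall v, P v -> Q v -> Q' v) ->
  qdim P Q r -> exists2 r', (r' <= r)%N & qdim P' Q' r'.
Proof.
move=> hP hQ' sP sQ [b [Pb _ bs]].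
apply: (qdim_of_span (e := b)) => // p /sP Pp; have [c h] := bs p Pp; exists c.
by apply: sQ => //; apply: subspaceB => //; apply: subspace_lincomb.
Qed.

End Dimension.

Section Maps.
Variables (V W : lmodType K) (f : V -> W) (P Q : V -> Prop) (P' Q' : W -> Prop).
Hypotheses (hf : lin f) (hP : subspace P) (hQ : subspace Q).
Hypotheses (hP' : subspace P') (hQ' : subspace Q').
Hypothesis fP : forall p, P p -> P' (f p).

Lemma qdim_inj r' : (forall p, P p -> Q' (f p) -> Q p) ->
  qdim P' Q' r' -> exists2 r, (r <= r')%N & qdim P Q r.
Proof.
move=> fi [b' [_ _ bs']]; apply: qdim_of_bound => // r b Pb bi.
apply: (@indep_le_span _ Q' _ _ (f \o b) b') => //.
  move=> c; rewrite -lin_lincomb // => h; apply: bi.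
  by apply: fi => //; apply: subspace_lincomb.
by move=> l; apply/bs'/fP.
Qed.

Lemma qdim_surj r : (forall p, P p -> Q p -> Q' (f p)) ->
  (forall p', P' p' -> exists2 p, P p & Q' (p' - f p)) ->
  qdim P Q r -> exists2 r', (r' <= r)%N & qdim P' Q' r'.
Proof.
move=> fQ fs [b [Pb bi bs]].
apply: (@qdim_of_span _ P' Q' r (f \o b)) => // p' /fs [p Pp h].
have [c h'] := bs p Pp; exists c.
apply: (subspace_trans hQ' h); rewrite -lin_lincomb // -linB //; apply: fQ => //.
by apply: subspaceB => //; apply: subspace_lincomb.
Qed.

Lemma qdim_iso r : (forall p, P p -> Q p <-> Q' (f p)) ->
  (forall p', P' p' -> exists2 p, P p & Q' (p' - f p)) ->
  qdim P Q r <-> qdim P' Q' r.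
Proof.
move=> fQ fs; split.
  move=> [b [Pb bi bs]]; exists (f \o b); split; first by move=> l; apply: fP.
    move=> c; rewrite -lin_lincomb // => /fQ h; apply: bi; apply: h.
    exact: subspace_lincomb.
  move=> p' /fs [p Pp h]; have [c h'] := bs p Pp; exists c.
  apply: (subspace_trans hQ' h); rewrite -lin_lincomb // -linB //; apply/fQ => //.
  by apply: subspaceB => //; apply: subspace_lincomb.
move=> [b' [Pb' bi' bs']].
have /choice[b hb] : forall l, exists v, P v /\ Q' (b' l - f v).
  by move=> l; have [v ? ?] := fs _ (Pb' l); exists v.
have Pb l : P (b l) by have [] := hb l.
have bb (c : 'I_r -> K) : Q' (\sum_l c l *: b' l - f (\sum_l c l *: b l)).
  rewrite lin_lincomb // -sumrB; apply: subspace_sum => // l _.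
  by rewrite -scalerBr; apply: subspaceZ => //; have [] := hb l.
have Pc (c : 'I_r -> K) : P (\sum_l c l *: b l) by apply: subspace_lincomb.
exists b; split=> // [c /(fQ _ (Pc c)) h|p Pp].
  by apply: bi'; rewrite -[\sum_l _](subrK (f (\sum_l c l *: b l))); apply: subspaceD.
have [c h] := bs' _ (fP Pp); exists c; apply/fQ; first by apply: subspaceB.
by rewrite linB //; apply: (subspace_trans hQ' h).
Qed.

(** The kernel is that of the map between subquotients, hence [Q' (f p)] in place of f p = 0. A
    basis of its part followed by lifts of a basis of the image is a basis of the whole. *)
Lemma qdim_rank_nullity r : (forall p, P p -> Q p -> Q' (f p)) ->
  (forall p', P' p' -> exists2 p, P p & Q' (p' - f p)) ->
  qdim P Q r ->
  exists a b, [/\ qdim (fun p => P p /\ Q' (f p)) Q a, qdim P' Q' b & r = (a + b)%N].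
Proof.
move=> fQ fs qr.
have hP0 : subspace (fun p => P p /\ Q' (f p)) by apply/subspaceI/subspace_preim.
have [|//|a _ qa] := @qdim_sub _ P Q (fun p => P p /\ Q' (f p)) Q r hP hQ _ _ qr.
  by move=> v [].
have [b _ qb] := qdim_surj fQ fs qr.
exists a, b; split=> //.
suff : qdim P Q (a + b) by apply: (qdim_unique hQ qr).
have [u [Pu ui us]] := qa; have [w [Pw wi ws]] := qb.
have /choice[v hv] : forall l, exists v, P v /\ Q' (w l - f v).
  by move=> l; have [v ? ?] := fs _ (Pw l); exists v.
have ww (c : 'I_b -> K) : Q' (\sum_l c l *: w l - f (\sum_l c l *: v l)).
  rewrite lin_lincomb // -sumrB; apply: subspace_sum => // l _.
  by rewrite -scalerBr; apply: subspaceZ => //; have [] := hv l.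
have uu (c : 'I_a -> K) : Q' (f (\sum_l c l *: u l)).
  rewrite lin_lincomb //; apply: subspace_sum => // l _.
  by apply: subspaceZ => //; have [] := Pu l.
have Pv l : P (v l) by have [] := hv l.
have Pu1 l : P (u l) by have [] := Pu l.
exists (fun l => match fintype.split l with inl i => u i | inr i => v i end).
have E (c : 'I_(a + b) -> K) : \sum_l c l *: match fintype.split l with inl i => u i | inr i => v i end
   = \sum_l c (lshift b l) *: u l + \sum_l c (rshift a l) *: v l.
  rewrite big_split_ord; congr (_ + _); apply: eq_bigr => i _.
    by rewrite (unsplitK (inl i)).
  by rewrite (unsplitK (inr i)).
split.
- by move=> l; case: fintype.split.
- move=> c; rewrite E => h.
  have c2 : forall l, c (rshift a l) = 0.
    apply: wi; have h2 : Q' (f (\sum_l c (rshift a l) *: v l)).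
      rewrite -[X in f X](addKr (\sum_l c (lshift b l) *: u l)) addrC linB //.
      apply: subspaceB => //; apply: fQ => //.
      by apply: subspaceD => //; apply: subspace_lincomb.
    rewrite -[X in Q' X](subrK (f (\sum_l c (rshift a l) *: v l))).
    exact: subspaceD.
  have c1 : forall l, c (lshift b l) = 0.
    apply: ui; move: h; rewrite [X in _ + X]big1 ?addr0 // => l _.
    by rewrite c2 scale0r.
  by move=> l; rewrite -(splitK l); case: fintype.split => i; [exact: c1|exact: c2].
- move=> p Pp; have [c2 h2] := ws _ (fP Pp).
  have Pp2 : P (p - \sum_l c2 l *: v l).
    by apply: subspaceB => //; apply: subspace_lincomb.
  have [c1 h1] : exists c : 'I_a -> K, Q (p - \sum_l c2 l *: v l - \sum_l c l *: u l).
    apply: us; split=> //; rewrite linB //; apply: (subspace_trans hQ' h2 (ww c2)).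
  exists (fun l => match fintype.split l with inl i => c1 i | inr i => c2 i end).
  rewrite E opprD [- _ - _]addrC addrA.
  congr (Q (_ - _ - _)): h1; apply: eq_bigr => i _.
    by rewrite (unsplitK (inr i)).
  by rewrite (unsplitK (inl i)).
Qed.

End Maps.

Lemma qdim_fin (V : lmodType K) (P Q : V -> Prop) (J : finType) (b : J -> V) :
  (forall j, P (b j)) ->
  (forall c : J -> K, Q (\sum_j c j *: b j) -> forall j, c j = 0) ->
  (forall p, P p -> exists c : J -> K, Q (p - \sum_j c j *: b j)) ->
  qdim P Q #|J|.
Proof.
move=> Pb bi bs.
have E (c : J -> K) : \sum_(l < #|J|) c (enum_val l) *: b (enum_val l) = \sum_j c j *: b j.
  by rewrite -(big_enum_val (fun j => c j *: b j)).
exists (fun l => b (enum_val l)); split=> // [c h l|p /bs[c hc]]; last first.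
  by exists (fun l => c (enum_val l)); rewrite E.
rewrite -(enum_valK l); apply: (bi (fun j => c (enum_rank j))).
rewrite -E; move: h; set x := \sum_l _; set y := \sum_l _; suff -> : x = y by [].
by apply: eq_bigr => k _; rewrite enum_valK.
Qed.

Lemma qdim_cochain (V : lmodType K) (P Q : V -> Prop) (T : finType) (A : {set T}) r :
  subspace P -> subspace Q -> qdim P Q r ->
  qdim (fun f : {ffun T -> V} => (forall t, P (f t)) /\ (forall t, t \notin A -> f t = 0))
       (fun f => forall t, Q (f t)) (#|A| * r).
Proof.
move=> hP hQ [b [Pb bi bs]].
have -> : (#|A| * r)%N = #|{: 'I_#|A| * 'I_r}| by rewrite card_prod !card_ord.
pose e (j : 'I_#|A| * 'I_r) : {ffun T -> V} :=
  [ffun t => if t == enum_val j.1 then b j.2 else 0].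
have E (c : 'I_#|A| * 'I_r -> K) k : (\sum_j c j *: e j) (enum_val k) = \sum_l c (k, l) *: b l.
  rewrite sum_ffunE; transitivity (\sum_k' \sum_l (c (k', l) *: e (k', l)) (enum_val k)).
    by rewrite pair_bigA; apply: eq_bigr => -[].
  rewrite (bigD1 k) //= [X in _ + X]big1 ?addr0 => [|k' ne].
    by apply: eq_bigr => l _; rewrite !ffunE eqxx.
  rewrite big1 // => l _; rewrite !ffunE /= (inj_eq enum_val_inj) eq_sym (negbTE ne).
  by rewrite scaler0.
apply: (qdim_fin (b := e)) => [j|c h [k l]|p [Pp pA]].
- split=> t; rewrite ffunE; first by case: ifP => // _; exact: hP.1.
  by case: eqP => // -> /negP[]; exact: enum_valP.
- by apply: (bi (fun l => c (k, l))); rewrite -E.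
- have /choice[c hc] : forall k : 'I_#|A|, exists c : 'I_r -> K,
      Q (p (enum_val k) - \sum_l c l *: b l) by move=> k; apply: bs.
  exists (fun j => c j.1 j.2) => t; rewrite !ffunE.
  case: (boolP (t \in A)) => tA.
    have -> : t = enum_val (enum_rank_in tA t) by rewrite enum_rankK_in.
    by rewrite E; exact: hc.
  rewrite pA // sum_ffunE big1 ?subr0; first exact: hQ.1.
  move=> [k l] _; rewrite !ffunE; case: eqP => [e1|]; last by rewrite scaler0.
  by rewrite e1 enum_valP in tA.
Qed.

Section Extension.
Variables (V V1 V2 : lmodType K) (f : V -> V1) (g : V2 -> V).
Variables (P Q : V -> Prop) (P1 Q1 : V1 -> Prop) (P2 Q2 : V2 -> Prop) (r1 r2 : nat).
Hypotheses (hf : lin f) (hg : lin g) (hP : subspace P) (hQ : subspace Q).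
Hypotheses (hQ1 : subspace Q1) (hP2 : subspace P2) (hQ2 : subspace Q2).
Hypotheses (q1 : qdim P1 Q1 r1) (q2 : qdim P2 Q2 r2).
Hypothesis fP : forall p, P p -> P1 (f p).
Hypothesis gQ : forall p, P2 p -> Q2 p -> Q (g p).
Hypothesis ker : forall p, P p -> Q1 (f p) -> exists2 p2, P2 p2 & Q (p - g p2).

(** For P2/Q2 -> P/Q -> P1/Q1, exactness in the middle is enough for the inequality: the dimension
    modulo the kernel of [f] is at most r1, and [ker] covers the kernel by the image of [g]. *)
Lemma qdim_extension_le : exists2 r, (r <= r1 + r2)%N & qdim P Q r.
Proof.
have hQf : subspace (fun v => Q1 (f v)) by exact: subspace_preim.
have [|a le [u [Pu ui us]]] := qdim_inj (Q := fun v => Q1 (f v)) hf hP hQf hQ1 fP _ q1.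
  by [].
have [w [Pw _ ws]] := q2.
pose e (l : 'I_(a + r2)) := match fintype.split l with inl i => u i | inr i => g (w i) end.
have [|r le2 qr] := @qdim_of_span _ P Q (a + r2) e hQ.
- move=> p Pp; have [c hc] := us p Pp.
  have [||p2 Pp2 h2] := ker (p := p - \sum_l c l *: u l) => //.
    by apply: subspaceB => //; apply: subspace_lincomb.
  have [c2 hc2] := ws _ Pp2.
  exists (fun l => match fintype.split l with inl i => c i | inr i => c2 i end).
  have -> : \sum_k match fintype.split k with inl i => c i | inr i => c2 i end *: e k =
     \sum_l c l *: u l + g (\sum_l c2 l *: w l).
    rewrite big_split_ord lin_lincomb //; congr (_ + _); apply: eq_bigr => i _.
      by rewrite /e (unsplitK (inl i)).
    by rewrite /e (unsplitK (inr i)).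
  rewrite opprD addrA; apply: (subspace_trans hQ h2); rewrite -linB //.
  by apply: gQ => //; apply: subspaceB => //; apply: subspace_lincomb.
- by exists r => //; apply: leq_trans le2 _; rewrite leq_add2r.
Qed.

Hypothesis fQ : forall p, P p -> Q p -> Q1 (f p).
Hypothesis fs : forall p1, P1 p1 -> exists2 p, P p & Q1 (p1 - f p).
Hypothesis gP : forall p, P2 p -> P (g p) /\ Q1 (f (g p)).
Hypothesis gi : forall p, P2 p -> Q (g p) -> Q2 p.

(** With [f] onto and [g] injective on the subquotients and a zero composite, the sequence is short
    exact. *)
Lemma qdim_extension : qdim P Q (r1 + r2).
Proof.
have [r _ qr] := qdim_extension_le.
have [a [b [qa qb e]]] := qdim_rank_nullity hf hP hQ hQ1 fP fQ fs qr.
have <- : b = r1 by apply: (qdim_unique hQ1 qb q1).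
suff <- : a = r2 by rewrite addnC -e.
apply: (qdim_unique hQ qa); apply: (proj1 (qdim_iso hg hP2 hQ gP _ _ _) q2).
- by move=> p Pp; split; [exact: gQ|exact: gi].
- by move=> p [Pp Qp]; exact: ker.
Qed.

End Extension.

Lemma qdim_rows (m r s : nat) (A : 'M[K]_(r, m)) (B : 'M[K]_(s, m)) :
  (B <= A)%MS ->
  qdim (fun u : 'rV[K]_m => (u <= A)%MS : Prop) (fun u => (u <= B)%MS : Prop)
    (\rank A - \rank B).
Proof.
move=> sBA; pose C := (A :\: B)%MS.
have rC : \rank C = (\rank A - \rank B)%N.
  by have := mxrank_cap_compl A B; rewrite (capmx_idPr sBA) => <-; rewrite addKn.
rewrite -rC; exists (fun l => row l (row_base C)); split.
- by move=> l; apply: submx_trans (diffmxSl A B); have := row_sub l (row_base C); rewrite (eq_row_base C).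
- move=> c h.
  have E : \sum_l c l *: row l (row_base C) = (\row_l c l) *m row_base C.
    by rewrite mulmx_sum_row; apply: eq_bigr => l _; rewrite mxE.
  rewrite E in h; have h2 : ((\row_l c l) *m row_base C <= C)%MS.
    by have := submxMl (\row_l c l) (row_base C); rewrite (eq_row_base C).
  have : ((\row_l c l) *m row_base C <= C :&: B)%MS by rewrite sub_capmx h2.
  rewrite capmx_diff submx0 -(mul0mx _ (row_base C)) => /eqP.
  move/(row_free_inj (row_base_free C)) => /rowP h3 l.
  by have := h3 l; rewrite !mxE.
- move=> p /[dup] pA; rewrite -(addsmx_diff_cap_eq A B) => /sub_addsmxP[[u v] /= E].
  have : (u *m C <= C)%MS by apply: submxMl.
  rewrite -(eq_row_base C) => /submxP[w hw]; exists (w 0).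
  have -> : \sum_l w 0 l *: row l (row_base C) = w *m row_base C.
    by rewrite mulmx_sum_row.
  by rewrite -hw E /C addrC addKr; apply: submx_trans (submxMl _ _) (capmxSr _ _).
Qed.

End SubquotientDimension.

(** * Graded ideals and Hilbert functions *)

Section GradedIdeals.
Variables (K : fieldType) (n : nat).
Local Notation R := {mpoly K[n]}.
Implicit Types (W : R -> Prop) (p q l : R).

Definition hform (d : nat) : R -> Prop := fun p => p \is d.-homog.

Lemma form_subspace d : subspace (hform d).
Proof. by split=> [|c u v hu hv]; [exact: rpred0|rewrite /hform rpredD ?rpredZ]. Qed.

(** A homogeneous ideal that may contain 1, so that the class is stable under adding forms.
    Membership is a proposition because the ideals built below are given by existential
    statements. *)
Definition gideal W : Prop :=
  [/\ W 0, forall p q, W p -> W q -> W (p + q), forall p q, W q -> W (p * q)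
    & forall d p, W p -> W (pihomog mdeg d p)].

Section Closure.
Variable W : R -> Prop.
Hypothesis hW : gideal W.

Lemma gidealM p q : W q -> W (p * q). Proof. by case: hW => _ _ h _; apply: h. Qed.

Lemma gideal_subspace : subspace W.
Proof.
case: hW => W0 WD WM _; split=> // c u v Wu Wv; apply: WD => //.
by rewrite -mul_mpolyC; apply: WM.
Qed.

Lemma gideal_pihomog d p : W p -> W (pihomog mdeg d p).
Proof. by case: hW => _ _ _; apply. Qed.

Lemma gideal0 : W 0. Proof. by case: hW. Qed.

End Closure.

Lemma homog_ideal_gideal (I : {pred R}) : homog_ideal I -> gideal (fun p => p \in I).
Proof.
move=> [[I0 _ Il] Ih]; split=> // [p q Ip Iq|p q Iq|d p]; last exact: Ih.
  by have := Il 1 _ _ Ip Iq; rewrite mul1r.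
by have := Il p _ _ Iq I0; rewrite addr0.
Qed.

Definition HF W (d : nat) : nat := get [set r | qdim (hform d) W r].

Lemma hilbE (I : {pred R}) : hilb I = HF (fun p => p \in I). Proof. by []. Qed.

Lemma mpoly_homogE d p : p \is d.-homog ->
  p = \sum_(m : 'X_{1..n < d.+1}) p@_m *: 'X_[m].
Proof.
move=> hp; apply: mpolywE; rewrite msizeE; apply/bigmax_leqP_seq => m mp _.
by rewrite (dhomog_mf hp mp).
Qed.

Lemma form_span d : exists s (e : 'I_s -> R), (forall k, hform d (e k)) /\
  forall p, hform d p -> exists c : 'I_s -> K, p = \sum_k c k *: e k.
Proof.
pose A := [pred m : 'X_{1..n < d.+1} | mdeg m == d]; pose T := {m | m \in A}.
exists #|{: T}|, (fun k => 'X_[val (enum_val k : T)]); split=> [k|p hp].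
  by rewrite /hform dhomogX; exact: (valP (enum_val k : T)).
exists (fun k => p@_(val (enum_val k : T))).
rewrite -(big_enum_val (fun m : T => p@_(val m) *: 'X_[val m])) /=.
rewrite {1}(mpoly_homogE hp).
rewrite (bigID (fun m : 'X_{1..n < d.+1} => mdeg m == d)) /= [X in _ + X]big1 ?addr0.
  rewrite [RHS](eq_bigl xpredT) //.
  exact: (big_sub A (fun m : 'X_{1..n < d.+1} => p@_m *: 'X_[m])).
by move=> m hm; rewrite (dhomog_nemf_coeff hp hm) scale0r.
Qed.

Lemma qdim_form_exists d (P Q : R -> Prop) : subspace P -> subspace Q ->
  (forall p, P p -> hform d p) -> exists r, qdim P Q r.
Proof.
move=> hP hQ sP; have [s [e [_ es]]] := form_span d.
have [//||r _ qr] := @qdim_of_span _ _ P Q s e; last by exists r.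
move=> p /sP /es [c ->]; exists c; rewrite subrr; exact: hQ.1.
Qed.

Lemma HFP W d : subspace W -> qdim (hform d) W (HF W d).
Proof.
move=> hW; rewrite /HF; case: xgetP => [r -> //|h].
have [r qr] := qdim_form_exists (form_subspace d) hW (fun p => id).
by case: (h r).
Qed.

Lemma HF_unique W d r : subspace W -> qdim (hform d) W r -> HF W d = r.
Proof. by move=> hW; apply: (qdim_unique hW); apply: HFP. Qed.

Lemma eq_HF W W' d : subspace W -> subspace W' ->
  (forall p, hform d p -> W p <-> W' p) -> HF W d = HF W' d.
Proof.
move=> hW hW' e; apply/esym/HF_unique => //.
by apply: (eq_qdim _ e (form_subspace d)) => //; apply: HFP.
Qed.

Lemma HF_le W W' d : subspace W -> subspace W' ->
  (forall p, hform d p -> W p -> W' p) -> (HF W' d <= HF W d)%N.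
Proof.
move=> hW hW' s; have hf := form_subspace d.
have [//|//|r le /(HF_unique hW') ->//] := @qdim_sub _ _ _ _ (hform d) _ _ hf hW' _ _ (HFP d hW).
Qed.

Lemma HF_eq0 W d : subspace W -> (forall p, hform d p -> W p) -> HF W d = 0%N.
Proof.
move=> hW s; apply: HF_unique => //; exists (fun=> 0); split=> [[]//|c _ []//|p hp].
by exists (fun=> 0); rewrite big_ord0 subr0; apply: s.
Qed.

Lemma HF_eq0P W d : subspace W -> HF W d = 0%N -> forall p, hform d p -> W p.
Proof.
move=> hW h p hp; have := HFP d hW; rewrite h => -[b [_ _ /(_ p hp) [c]]].
by rewrite big_ord0 subr0.
Qed.

Lemma HF0 W : gideal W -> ~ W 1 -> HF W 0 = 1%N.
Proof.
move=> hW W1; apply: HF_unique; first exact: gideal_subspace.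
exists (fun=> 1); split=> [l|c|p hp].
- exact: dhomog1.
- rewrite big_ord1 => h l; rewrite ord1; apply/eqP; apply: contrapT => /negP c0.
  apply: W1; have := subspaceZ (gideal_subspace hW) (c ord0)^-1 h.
  by rewrite scalerA mulVf // scale1r.
- exists (fun=> p@_0%MM); rewrite big_ord1.
  suff -> : p = p@_0%MM *: 1 by rewrite mcoeffZ mcoeff1 eqxx mulr1 subrr; apply: gideal0.
  apply/mpolyP => m; rewrite mcoeffZ mcoeff1.
  case: eqP => [->|m0]; first by rewrite mulr1.
  rewrite mulr0 (dhomog_nemf_coeff hp) //.
  by rewrite mdeg_eq0; apply/eqP.
Qed.

Lemma mcoeff_pihomog d p (m : 'X_{1..n}) :
  (pihomog mdeg d p)@_m = if mdeg m == d then p@_m else 0.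
Proof.
rewrite pihomogE raddf_sum /= big_mkcond /=.
case: (boolP (m \in msupp p)) => mp; last first.
  rewrite (memN_msupp_eq0 mp) if_same big_seq big1 // => m' mp'; case: ifP => // _.
  rewrite mcoeffZ mcoeffX; case: eqP => [e|_]; last by rewrite mulr0.
  by rewrite -e mp' in mp.
rewrite (bigD1_seq m) ?msupp_uniq //= mcoeffZ mcoeffX eqxx mulr1 big1 ?addr0 //.
move=> m' ne; case: ifP => // _.
by rewrite mcoeffZ mcoeffX (negbTE ne) mulr0.
Qed.

Definition plus W l : R -> Prop := fun p => exists q, W (p - l * q).

Lemma plus_sub W l p : W p -> plus W l p.
Proof. by exists 0; rewrite mulr0 subr0. Qed.

Lemma plus_mul W l q : W 0 -> plus W l (l * q).
Proof. by exists q; rewrite subrr. Qed.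

Lemma plus_subspace W l : subspace W -> subspace (plus W l).
Proof.
move=> hW; split=> [|c u v [q hq] [r hr]]; first by exists 0; rewrite mulr0 subr0; apply: hW.1.
exists (c *: q + r); rewrite mulrDr -scalerAr opprD addrACA -scalerBr.
exact: hW.2.
Qed.

Lemma pihomogM e d l q : l \is e.-homog ->
  pihomog mdeg d (l * q) = if (e <= d)%N then l * pihomog mdeg (d - e) q else 0.
Proof.
move=> hl; have hq := pihomog_partitionE (leqnn (mmeasure mdeg q)).
set k := mmeasure _ _ in hq.
have E b : pihomog mdeg b (l * q) =
    \sum_(c < k) (if b == (e + c)%N then l * pihomog mdeg c q else 0).
  rewrite {1}hq mulr_sumr raddf_sum /=; apply: eq_bigr => c _.
  have hc := dhomogM hl (pihomogP mdeg c q).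
  by case: eqP => [->|ne]; [apply: pihomog_dE|apply: pihomog_ne0 hc; apply/eqP => /esym].
rewrite E; case: leqP => [le|lt]; last first.
  rewrite big1 // => c _; case: eqP => // h; by rewrite h ltnNge leq_addr in lt.
transitivity (l * \sum_(c < k | (d - e == c)%N) pihomog mdeg c q); last first.
  congr (_ * _); rewrite {2}hq raddf_sum /= [RHS](bigID (fun c : 'I_k => (d - e == c)%N)) /=.
  rewrite [X in _ = _ + X]big1 ?addr0; last first.
    by move=> c hc; apply: (pihomog_ne0 (d := c)); [rewrite eq_sym|exact: pihomogP].
  by apply: eq_bigr => c /eqP ->; rewrite pihomog_id.
rewrite mulr_sumr [RHS]big_mkcond; apply: eq_bigr => c _.
by rewrite -{1}(subnKC le) eqn_add2l.
Qed.

Lemma plus_gideal W e l : gideal W -> l \is e.-homog -> gideal (plus W l).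
Proof.
move=> hW hl; have hs := plus_subspace l (gideal_subspace hW); split.
- exact: hs.1.
- by move=> p q; apply: subspaceD.
- move=> p q [r hr]; exists (p * r); rewrite mulrCA -mulrBr; exact: gidealM.
- move=> d p [q hq]; have := gideal_pihomog hW d hq.
  rewrite raddfB /= (pihomogM _ _ hl); case: ifP => _ h.
    by exists (pihomog mdeg (d - e) q).
  by apply: plus_sub; rewrite subr0 in h.
Qed.

Lemma form_plus W d e l p : gideal W -> l \is e.-homog -> p \is (e + d).-homog ->
  plus W l p -> exists2 q, q \is d.-homog & W (p - l * q).
Proof.
move=> hW hl hp [q hq]; exists (pihomog mdeg d q); first exact: pihomogP.
have := gideal_pihomog hW (e + d) hq.
by rewrite raddfB /= (pihomogM _ _ hl) leq_addr addKn pihomog_dE.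
Qed.

Definition colon W l : R -> Prop := fun q => W (l * q).

(* [V] need not be an ideal here, as in Green's theorem. *)
Lemma HF_mul_form (V Vl : R -> Prop) d e l : subspace V -> l \is e.-homog ->
  (forall p, Vl p <-> exists2 q, hform d q & V (p - l * q)) ->
  HF V (e + d) = (HF (colon V l) d + HF Vl (e + d))%N.
Proof.
move=> hV hl eVl.
have hf : lin (fun q : R => l * q) by move=> c u v; rewrite mulrDr scalerAr.
have hVl : subspace Vl.
  split=> [|c u v /eVl[q hq Vq] /eVl[r hr Vr]]; apply/eVl.
    by exists 0; [exact: (subspace0 (form_subspace d))|rewrite mulr0 subr0; apply: hV.1].
  exists (c *: q + r); first exact: (form_subspace d).2.
  by rewrite mulrDr -scalerAr opprD addrACA -scalerBr; exact: hV.2.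
pose P' p := hform (e + d) p /\ Vl p.
have hP' : subspace P' by apply: subspaceI => //; apply: form_subspace.
have fP p : hform d p -> P' (l * p).
  move=> hp; split; first exact: dhomogM.
  by apply/eVl; exists p => //; rewrite subrr; apply: hV.1.
have hid : lin (fun q : R => q) by [].
have [|||a [b [qa qb ->]]] := qdim_rank_nullity (P' := hform (e + d)) hid (form_subspace (e + d)) hV hVl _ _ _ (HFP (e + d) hV).
- by [].
- move=> p hp Vp; apply/eVl; exists 0; last by rewrite mulr0 subr0.
  exact: (subspace0 (form_subspace d)).
- by move=> p' hp'; exists p' => //; rewrite subrr; apply: hVl.1.
rewrite (HF_unique hVl qb); congr (_ + _)%N; apply/esym/HF_unique.
  exact: (subspace_preim hf).
apply: (proj2 (qdim_iso hf (form_subspace d) hV fP a _ _) qa) => //.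
by move=> p' [_ /eVl[q hq Vq]]; exists q.
Qed.

(** Count dimensions in 0 -> (0 : l)_d -> A_d -> A_(d+1) -> (A/lA)_(d+1) -> 0 for A = R/W. The
    additive form avoids truncated subtraction. *)
Lemma qdim_colon W l d : gideal W -> l \is 1.-homog ->
  exists2 nu, qdim (fun q => hform d q /\ W (l * q)) W nu &
    (HF W d + HF (plus W l) d.+1 = HF W d.+1 + nu)%N.
Proof.
move=> hW hl; have hs := gideal_subspace hW.
have hf : lin (fun q : R => l * q) by move=> c u v; rewrite mulrDr scalerAr.
have hV := plus_subspace l hs.
pose P' p := hform d.+1 p /\ plus W l p.
have hP' : subspace P' by apply: subspaceI => //; apply: form_subspace.
have fP p : hform d p -> P' (l * p).
  by move=> hp; split; [rewrite -add1n; exact: dhomogM|apply: plus_mul; exact: hs.1].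
have [||a [b [qa qb ab]]] := qdim_rank_nullity hf (form_subspace d) hs hs fP _ _ (HFP d hs).
- by move=> p _ /(gidealM hW); apply.
- by move=> p' [hp' /(form_plus hW hl hp')[q hq Vq]]; exists q.
exists a => //.
have hid : lin (fun q : R => q) by [].
have [|||a' [b' [qa' qb' ab']]] := qdim_rank_nullity (P' := hform d.+1) hid (form_subspace d.+1) hs hV _ _ _ (HFP d.+1 hs).
- by [].
- by move=> p _; exact: plus_sub.
- by move=> p' hp'; exists p' => //; rewrite subrr; apply: hV.1.
rewrite ab' ab (HF_unique hV qb') (qdim_unique hs qa' qb).
by rewrite -addnA addnC.
Qed.

Lemma HF_plus_le W l d : gideal W -> l \is 1.-homog -> (HF (plus W l) d <= HF W d)%N.
Proof.
move=> hW hl; have hs := gideal_subspace hW; apply: HF_le => //.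
  exact: plus_subspace.
by move=> p _; apply: plus_sub.
Qed.

Lemma HF_plus0 W l : gideal W -> l \is 1.-homog -> HF (plus W l) 0 = HF W 0.
Proof.
move=> hW hl; have hs := gideal_subspace hW.
apply: eq_HF => //; first exact: plus_subspace.
move=> p hp; split=> [[q hq]|]; last exact: plus_sub.
have := gideal_pihomog hW 0 hq.
by rewrite raddfB /= (pihomogM _ _ hl) /= subr0 pihomog_dE.
Qed.

Definition full W l i : Prop :=
  (forall p, hform i p -> W (l * p) -> W p) \/
  (forall q, hform i.+1 q -> exists2 p, hform i p & W (q - l * p)).

(** In the exact sequence of [qdim_colon], injectivity makes [nu] zero, while surjectivity makes the
    quotient zero in degree d + 1 and forces HF W to decrease weakly there; the truncated difference
    is right in both cases. *)
Lemma HF_plus_full W l : gideal W -> l \is 1.-homog ->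
  (forall i, full W l i) -> HF (plus W l) =1 delta (HF W).
Proof.
move=> hW hl hfull [|d]; first by rewrite HF_plus0 // /delta subn0.
have hs := gideal_subspace hW; have [nu qnu] := qdim_colon d hW hl.
rewrite /delta; case: (hfull d) => [inj|surj].
  suff -> : nu = 0%N by rewrite addn0 => <-; rewrite addKn.
  apply: (qdim_unique hs qnu); exists (fun=> 0); split=> [[]//|c _ []//|p [hp hp2]].
  by exists (fun=> 0); rewrite big_ord0 subr0; apply: inj.
rewrite (HF_eq0 (W := plus W l)); last 2 first.
- exact: plus_subspace.
- by move=> q /surj[p _ h]; exists p.
by rewrite addn0 => ->; apply/esym/eqP; rewrite subn_eq0 leq_addr.
Qed.

End GradedIdeals.

(** * Numerics of lex segments *)

(** The number of monomials of degree d in N variables. With the truncated predecessor the value is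
    right for N = 0 too: C(0, 0) = 1 in degree 0 and C(d - 1, d) = 0 in degree d > 0. *)
Definition nmon (d N : nat) : nat := 'C((N + d).-1, d).

(* The monomials of degree d in N variables in increasing lexicographic order;
   an entry is true when the last variable does not divide the monomial. *)
Fixpoint lex_word (d : nat) : nat -> seq bool :=
  match d with
  | 0 => fun _ => [:: true]
  | d'.+1 => fix word N :=
      match N with
      | 0 => [::]
      | N'.+1 => word N' ++ (if N' is 0 then [:: false] else lex_word d' N'.+1)
      end
  end.

(* The number of monomials without the last variable among the first c; since
   c <= nmon d c, using c variables loses nothing. *)
Definition gr (d c : nat) : nat := count id (take c (lex_word d c)).
(** Counts those of the first c monomials that the last variable divides. Division by it sends them
    to degree d - 1, so [lo d.+1 (h d.+1) <= h d] is Macaulay's growth condition read from the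
    higher degree. *)
Definition lo (d c : nat) : nat := (c - gr d c)%N.

Lemma nmon0 N : nmon 0 N = 1%N. Proof. exact: bin0. Qed.

Lemma nmonS d N : nmon d.+1 N.+1 = (nmon d.+1 N + nmon d N.+1)%N.
Proof. by rewrite /nmon !addnS addSn /= binS. Qed.

Lemma nmonS0 d : nmon d.+1 0 = 0%N.
Proof. by rewrite /nmon add0n bin_small. Qed.

Lemma nmon1 d : nmon d 1 = 1%N.
Proof. by rewrite /nmon add1n /= binn. Qed.

Lemma nmon_deg1 N : nmon 1 N = N.
Proof. by rewrite /nmon addn1 bin1. Qed.

Lemma nmon_leS d N : (nmon d N <= nmon d N.+1)%N.
Proof. by case: d => [|d]; rewrite ?nmon0 // nmonS leq_addr. Qed.

Lemma leq_nmon d N : (N <= nmon d.+1 N)%N.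
Proof.
elim: N => [|N ih] //; rewrite nmonS; apply: (leq_trans (n := nmon d.+1 N + 1)).
  by rewrite addn1.
by rewrite leq_add2l /nmon addSn /= bin_gt0 leq_addl.
Qed.

(** The monomials without the first variable are the smallest and precede its multiples. With a
    single variable the first is also the last, hence the separate case in the definition. *)
Lemma lex_wordSS d N :
  lex_word d.+1 N.+2 = lex_word d.+1 N.+1 ++ lex_word d N.+2.
Proof. by []. Qed.

Lemma lex_wordS1 d : lex_word d.+1 1 = [:: false].
Proof. by []. Qed.

Lemma size_lex_word d N : size (lex_word d N) = nmon d N.
Proof.
elim: d N => [|d ihd] N; first by rewrite nmon0.
elim: N => [|[|N] ihN]; rewrite ?nmonS0 //.
  by rewrite lex_wordS1 nmon1.
by rewrite lex_wordSS size_cat ihN ihd -nmonS.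
Qed.

Lemma count_lex_word d N : count id (lex_word d N.+1) = nmon d N.
Proof.
elim: d N => [|d ihd] N; first by rewrite nmon0.
elim: N => [|N ihN]; first by rewrite nmonS0.
by rewrite lex_wordSS count_cat ihN ihd -nmonS.
Qed.

(** New variables are put in front, so enlarging N can only append larger monomials. *)
Lemma take_lex_wordS d N c : (c <= nmon d N)%N ->
  take c (lex_word d N.+1) = take c (lex_word d N).
Proof.
case: d => [|d] //; case: N => [|N].
  by rewrite nmonS0 leqn0 => /eqP ->; rewrite !take0.
by rewrite lex_wordSS take_cat size_lex_word; case: ltngtP => // -> _;
  rewrite subnn take0 cats0 take_oversize ?size_lex_word.
Qed.

Lemma take_lex_word d N N' c : (c <= nmon d N)%N -> (N <= N')%N ->
  take c (lex_word d N') = take c (lex_word d N).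
Proof.
move=> h /subnKC <-; elim: (N' - N)%N => [|k ih]; first by rewrite addn0.
rewrite addnS take_lex_wordS ?ih //; apply: leq_trans h _.
by elim: k {ih} => [|k ih]; rewrite ?addn0 // addnS (leq_trans ih) ?nmon_leS.
Qed.

Lemma grE d N c : (c <= nmon d N)%N -> gr d c = count id (take c (lex_word d N)).
Proof.
case: d => [|d] // h; rewrite /gr; have h' := leq_nmon d c.
by case: (leqP c N) => le; [rewrite -(take_lex_word h' le)|rewrite (take_lex_word h (ltnW le))].
Qed.

Lemma gr_le d c : (gr d c <= c)%N.
Proof. by rewrite /gr (leq_trans (count_size _ _)) // size_take_min geq_minl. Qed.

Lemma gr_add d c k : exists2 j, (j <= k)%N & gr d (c + k) = (gr d c + j)%N.
Proof.
case: d => [|d].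
  by rewrite /gr /=; case: c => [|c]; [exists (0 < k)%N|exists 0%N]; case: k.
have h := leq_nmon d (c + k).
rewrite (grE h) (grE (leq_trans (leq_addr k c) h)) takeD count_cat.
eexists; last by [].
by rewrite (leq_trans (count_size _ _)) // size_take_min geq_minl.
Qed.

Lemma gr_mono d c c' : (c <= c')%N -> (gr d c <= gr d c')%N.
Proof. by move=> /subnKC <-; have [j _ ->] := gr_add d c (c' - c); rewrite leq_addr. Qed.

Lemma lo_mono d c c' : (c <= c')%N -> (lo d c <= lo d c')%N.
Proof.
move=> /subnKC <-; have [j le] := gr_add d c (c' - c); rewrite /lo => ->.
by have := gr_le d c; lia.
Qed.

Lemma gr_lo d c : (gr d c + lo d c)%N = c.
Proof. by rewrite /lo subnKC // gr_le. Qed.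

Lemma gr_nmon d N : gr d (nmon d N.+1) = nmon d N.
Proof. by rewrite (grE (leqnn _)) take_oversize ?size_lex_word // count_lex_word. Qed.

Lemma lo_nmon d N : lo d.+1 (nmon d.+1 N.+1) = nmon d N.+1.
Proof. by rewrite /lo gr_nmon nmonS addKn. Qed.

(** The first block consists of all monomials without the first variable; the other c are multiples
    of it and are counted one degree lower. *)
Lemma grS d N c : (c <= nmon d N.+2)%N ->
  gr d.+1 (nmon d.+1 N.+1 + c) = (nmon d.+1 N + gr d c)%N.
Proof.
move=> h; rewrite (@grE _ N.+2); last by rewrite (nmonS d N.+1) leq_add2l.
rewrite lex_wordSS take_cat size_lex_word ltnNge leq_addr addKn {1}/negb.
by rewrite count_cat count_lex_word (grE h).
Qed.

Lemma loS d N c : (c <= nmon d N.+2)%N ->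
  lo d.+1 (nmon d.+1 N.+1 + c) = (nmon d N.+1 + lo d c)%N.
Proof.
by move=> h; rewrite /lo grS //; have := nmonS d N; have := gr_le d c; lia.
Qed.

Lemma gr1 c : gr 1 c = c.-1.
Proof.
case: c => [|c] //=; rewrite -[c.+1](nmon_deg1 c.+1) gr_nmon nmon_deg1 //.
Qed.

Lemma grS1 d : gr d.+1 1 = 0%N.
Proof. by rewrite (@grE _ 1) ?nmon1 // lex_wordS1. Qed.

Lemma lo_gt0 d c : (0 < c)%N -> (0 < lo d.+1 c)%N.
Proof. by move=> /(lo_mono d.+1); rewrite {1}/lo grS1. Qed.

(** N + 2 is the least number of variables with at least c monomials of degree d + 1. This is one
    step of the Macaulay expansion of c and drives the induction on the degree. *)
Lemma nmon_decomp d c : (1 < c)%N ->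
  exists N c', [/\ (0 < c')%N, (c' <= nmon d N.+2)%N & c = (nmon d.+1 N.+1 + c')%N].
Proof.
move=> hc; have ex : exists N, (c <= nmon d.+1 N)%N by exists c; apply: leq_nmon.
case: (ex_minnP ex) => -[|[|N]]; rewrite ?nmonS0 ?nmon1; try lia.
move=> h /(_ N.+1); have := nmonS d N.+1.
move=> e hm; exists N, (c - nmon d.+1 N.+1)%N.
by case: (leqP c (nmon d.+1 N.+1)) => h'; [move/hm: h'; rewrite ltnn|split; lia].
Qed.

(** The arithmetic core of Green's theorem. After [nmon_decomp] both sides shed the same block and,
    in the main case, the claim drops by one degree; when [gr d.+1 c'] fills its block, the next
    monomial opens a new one and the comparison is direct. *)
Lemma gr_lo_lt d c : (0 < c)%N -> (gr d (lo d.+1 c).-1 < lo d.+1 (gr d.+1 c).+1)%N.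
Proof.
elim: d c => [|d ih] c c0.
  have l1 x : (0 < x)%N -> lo 1 x = 1%N by rewrite /lo gr1; lia.
  by rewrite !l1.
case: (ltnP 1 c) => [hc|]; last first.
  by move=> h; have -> : c = 1%N by lia; rewrite /lo grS1 subn0 /= grS1.
have [N [c' [c'0 hc' ->]]] := nmon_decomp d.+1 hc.
have lc := lo_gt0 d c'0; have lc' := lo_mono d.+1 hc'; rewrite lo_nmon in lc'.
have gc := gr_mono d.+1 hc'; rewrite gr_nmon in gc.
have h1 : gr d.+1 (nmon d.+1 N.+1 + (lo d.+1 c').-1) = (nmon d.+1 N + gr d (lo d.+1 c').-1)%N.
  by apply: grS; lia.
rewrite grS // loS //.
have -> : (nmon d.+1 N.+1 + lo d.+1 c').-1 = (nmon d.+1 N.+1 + (lo d.+1 c').-1)%N by lia.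
rewrite h1; have {}ih := ih c' c'0.
case: (ltnP (gr d.+1 c') (nmon d.+1 N.+1)) => hg; last first.
  have -> : gr d.+1 c' = nmon d.+1 N.+1 by lia.
  rewrite -nmonS -[(nmon d.+2 N.+1).+1]addn1 loS; last exact: leq_trans (leq_nmon _ _).
  have h2 := gr_mono d (leq_trans (leq_pred _) lc'); rewrite gr_nmon in h2.
  have := nmonS d N; have : lo d.+1 1 = 1%N by rewrite /lo grS1 subn0.
  by lia.
case: N h1 lc' gc hc' hg {hc} => [|N] h1 lc' gc hc' hg.
  rewrite !nmonS0 add0n; rewrite nmon1 in hg.
  by move: ih; have -> : gr d.+1 c' = 0%N by lia; rewrite /lo !grS1; lia.
have -> : (nmon d.+2 N.+1 + gr d.+1 c').+1 = (nmon d.+2 N.+1 + (gr d.+1 c').+1)%N by lia.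
by rewrite loS //; lia.
Qed.

(** If b exceeded gr (a + b), then a would be less than lo (a + b), and [gr_lo_lt] with monotonicity
    would give gr d a < lo d.+1 b = b - gr d.+1 b, against the hypothesis. *)
Lemma green_numeric d a b :
  (b <= gr d a + gr d.+1 b)%N -> (b <= gr d.+1 (a + b))%N.
Proof.
move=> h; rewrite leqNgt; apply/negP => hb.
have c0 : (0 < a + b)%N by lia.
have := gr_lo_lt d c0; rewrite ltnNge => /negP; apply.
have := gr_lo d.+1 (a + b); have := gr_lo d.+1 b => e1 e2.
apply: (leq_trans (lo_mono d.+1 hb)); apply: (leq_trans (n := gr d a)); first by lia.
by apply: gr_mono; lia.
Qed.

(** * Green's hyperplane restriction theorem *)

Section Green.
Variables (K : fieldType) (n : nat).
Local Notation R := {mpoly K[n]}.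

Definition lf (a : 'rV[K]_n) : R := \sum_i a 0 i *: 'X_i.

Lemma X_form i : ('X_i : R) \is 1.-homog.
Proof. by rewrite dhomogX /= mdeg1. Qed.

Lemma lf_form a : lf a \is 1.-homog.
Proof. by apply: rpred_sum => i _; apply: rpredZ; exact: X_form. Qed.

Lemma lf_is_linear : linear lf.
Proof.
move=> c u v; rewrite /lf scaler_sumr -big_split; apply: eq_bigr => i _ /=.
by rewrite !mxE scalerDl scalerA.
Qed.

Lemma lf_delta i : lf (delta_mx 0 i) = 'X_i.
Proof.
rewrite /lf (bigD1 i) //= mxE !eqxx scale1r big1 ?addr0 // => j ne.
by rewrite mxE eqxx (negbTE ne) scale0r.
Qed.

Lemma mcoeff_lf a i : (lf a)@_U_(i) = a 0 i.
Proof.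
rewrite /lf raddf_sum /= (bigD1 i) //= big1 ?addr0 => [|j ne].
  by rewrite mcoeffZ mcoeffX eqxx mulr1.
by rewrite mcoeffZ mcoeffX eq_mnm1 (negbTE ne) mulr0.
Qed.

Lemma lf_coeff p : p \is 1.-homog -> p = lf (\row_i p@_U_(i)).
Proof.
move=> hp; apply/mpolyP => m; case: (mdeg m =P 1%N) => [|/eqP ne].
  move=> /eqP/mdeg1P[i /eqP ->]; by rewrite mcoeff_lf mxE.
by rewrite (dhomog_nemf_coeff hp ne) (dhomog_nemf_coeff (lf_form _) ne).
Qed.

Hypothesis hK : [pchar K] =i pred0.

Lemma natr_neq0 k : (k.+1%:R : K) != 0.
Proof. by rewrite ((pcharf0P K).1 hK). Qed.

(** In characteristic zero the natural numbers are distinct in K, and more of them are tried than a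
    nonzero polynomial has roots. *)
Lemma poly_nonroot (q : {poly K}) : q != 0 -> exists t, q.[t] != 0.
Proof.
move=> q0; apply: contrapT => h.
pose rs := [seq (i%:R : K) | i <- iota 0 (size q)].
have /max_poly_roots : q != 0 by [].
move=> /(_ rs); rewrite size_map size_iota ltnn => H.
suff : false by []; apply: H.
  apply/allP => x _; apply/negPn/negP => hx; apply: h; exists x; exact: hx.
rewrite map_inj_uniq ?iota_uniq // => i j; wlog le : i j / (i <= j)%N.
  by move=> H; case/orP: (leq_total i j) => le e; [exact: H|apply/esym/H].
move=> /eqP; rewrite eq_sym -subr_eq0 -natrB // => e; apply/eqP; rewrite eqn_leq le /=.
by move: e; rewrite -subn_eq0; case: (j - i)%N => // k; rewrite (negbTE (natr_neq0 k)).
Qed.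

(* A one-parameter substitute for Zariski open sets. *)
Definition line_open (U : 'rV[K]_n -> Prop) : Prop := forall a0 a1, U a0 ->
  exists2 q : {poly K}, q != 0 & forall t, q.[t] != 0 -> U (a0 + t *: (a1 - a0)).

Lemma line_openI U1 U2 : line_open U1 -> line_open U2 ->
  line_open (fun a => U1 a /\ U2 a).
Proof.
move=> h1 h2 a0 a1 [u1 u2]; have [q1 q10 H1] := h1 _ a1 u1; have [q2 q20 H2] := h2 _ a1 u2.
exists (q1 * q2); first by rewrite mulf_neq0.
by move=> t; rewrite hornerM mulf_eq0 negb_or => /andP[/H1 ? /H2 ?].
Qed.

Lemma line_open_meet U1 U2 : line_open U1 -> line_open U2 ->
  (exists a, U1 a) -> (exists a, U2 a) -> exists a, U1 a /\ U2 a.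
Proof.
move=> h1 h2 [a1 u1] [a2 u2]; have [q1 q10 H1] := h1 _ a2 u1; have [q2 q20 H2] := h2 _ a1 u2.
(* [q1] is based at [a1] and [q2] at [a2] on the same line; substituting 1 - X gives them a common
   parameter. *)
have q2' : q2 \Po (1 - 'X) != 0.
  apply: contraNneq q20 => e; have : (q2 \Po (1 - 'X)) \Po (1 - 'X) = 0 by rewrite e comp_poly0.
  by rewrite -comp_polyA comp_polyB comp_polyC comp_polyX opprB addrCA subrr addr0 comp_polyXr => ->.
have [t] := poly_nonroot (mulf_neq0 q10 q2').
rewrite hornerM mulf_eq0 negb_or horner_comp !hornerE => /andP[/H1 r1 /H2 r2].
exists (a1 + t *: (a2 - a1)); split=> //.
suff -> : a1 + t *: (a2 - a1) = a2 + (1 - t) *: (a1 - a2) by [].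
rewrite scalerBl scale1r addrA addrCA subrr addr0; congr (_ + _).
by rewrite -scalerN opprB.
Qed.

(** Openness and nonemptiness of the finite intersection are proved together because the induction
    step needs both. *)
Lemma line_open_meets (T : eqType) (s : seq T) (U : T -> 'rV[K]_n -> Prop) :
  (forall x, line_open (U x)) -> (forall x, exists a, U x a) ->
  line_open (fun a => forall x, x \in s -> U x a) /\ exists a, forall x, x \in s -> U x a.
Proof.
move=> ho he; elim: s => [|x s [ih1 ih2]].
  split=> [a0 a1 _|]; last by exists 0.
  by exists 1 => //; exact: oner_neq0.
have E a : (forall y, y \in x :: s -> U y a) <-> U x a /\ (forall y, y \in s -> U y a).
  split=> [h|[hx h] y]; last by rewrite in_cons => /predU1P[->|/h].
  by split=> [|y hy]; apply: h; rewrite in_cons ?eqxx // hy orbT.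
split.
  move=> a0 a1 /E h; have [q q0 H] := line_openI (ho x) ih1 a1 h.
  by exists q => // t /H /E.
by have [a /E h] := line_open_meet (ho x) ih1 (he x) ih2; exists a.
Qed.

(** P and Q compress M a0 to an identity matrix whose size is its rank. Along the line the
    determinant of P M Q is a polynomial in t with value 1 at t = 0, and where it does not vanish
    the rank has not dropped. *)
Lemma line_open_rank (s r c : nat) (M : 'rV[K]_n -> 'M[K]_(s, r)) : linear M ->
  line_open (fun a => (c <= \rank (M a))%N).
Proof.
move=> hM a0 a1; set N0 := M a0; set rho := \rank N0 => hc.
pose P : 'M_(rho, s) := pid_mx rho *m invmx (col_ebase N0).
pose Q : 'M_(r, rho) := invmx (row_ebase N0) *m pid_mx rho.
have PQ : P *m N0 *m Q = 1%:M.
  rewrite /P /Q -[X in _ *m X *m _]mulmx_ebase -/rho !mulmxA.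
  rewrite -[_ *m invmx _ *m col_ebase _]mulmxA mulVmx ?col_ebase_unit // mulmx1.
  rewrite -[_ *m row_ebase _ *m invmx _]mulmxA mulmxV ?row_ebase_unit // mulmx1.
  rewrite mul_pid_mx mul_pid_mx !minnA.
  rewrite (_ : minn _ _ = rho); first by rewrite pid_mx_1.
  have := rank_leq_row N0; have := rank_leq_col N0; rewrite -/rho; lia.
pose B : 'M[{poly K}]_rho := map_mx polyC (P *m N0 *m Q) +
  'X *: map_mx polyC (P *m (M a1 - N0) *m Q).
have hB t : (\det B).[t] = \det (P *m M (a0 + t *: (a1 - a0)) *m Q).
  rewrite -[LHS]/(horner_eval t (\det B)) -det_map_mx; congr (\det _).
  have -> : M (a0 + t *: (a1 - a0)) = N0 + t *: (M a1 - N0).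
    rewrite addrC hM addrC; congr (_ + t *: _).
    by have := hM (-1) a0 a1; rewrite !scaleN1r ![- _ + _]addrC.
  rewrite mulmxDr mulmxDl -scalemxAr -scalemxAl /B.
  move: (P *m N0 *m Q) (P *m (M a1 - N0) *m Q) => C0 C1; apply/matrixP => i j.
  by rewrite !mxE /= /horner_eval !hornerE.
exists (\det B) => [|t].
  by apply/eqP => e; have := hB 0; rewrite e scale0r addr0 PQ det1 horner0 => /eqP; rewrite eq_sym oner_eq0.
rewrite hB -unitfE -[_ \is a GRing.unit]/(_ \in unitmx) => /mxrank_unit h.
apply: (leq_trans hc); rewrite -h; apply: leq_trans (mxrankM_maxl _ _) _.
exact: mxrankM_maxr.
Qed.

Lemma line_open_notin (m : nat) (M : 'M[K]_(m, n)) : line_open (fun a => ~~ (a <= M)%MS).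
Proof.
move=> a0 a1; rewrite submxE => h.
have hl : linear (fun a : 'rV[K]_n => a *m cokermx M) by move=> c u v; rewrite mulmxDl scalemxAl.
have h1 : (1 <= \rank (a0 *m cokermx M))%N by rewrite lt0n mxrank_eq0.
have [q q0 H] := line_open_rank hl a1 h1; exists q => // t /H.
by rewrite lt0n mxrank_eq0 submxE.
Qed.

(** Variant of [plus] for a subspace that need not be an ideal: only multiples of [l] by forms of
    degree d are added, which is what counts in degree d + 1. *)
Definition addf (V : R -> Prop) (d : nat) (l : R) : R -> Prop :=
  fun p => exists2 q, hform d q & V (p - l * q).

Lemma addf_subspace V d l : subspace V -> subspace (addf V d l).
Proof.
move=> hV; split=> [|c u v [q hq Vq] [r hr Vr]].
  by exists 0; [exact: (subspace0 (form_subspace K n d))|rewrite mulr0 subr0; apply: hV.1].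
exists (c *: q + r); first exact: (form_subspace K n d).2.
by rewrite mulrDr -scalerAr opprD addrACA -scalerBr; exact: hV.2.
Qed.

Lemma addf_sub V d l p : V p -> addf V d l p.
Proof. by exists 0; rewrite ?mulr0 ?subr0 //; exact: (subspace0 (form_subspace K n d)). Qed.

Lemma HF_addf (V : R -> Prop) d l : subspace V -> l \is 1.-homog ->
  HF V d.+1 = (HF (colon V l) d + HF (addf V d l) d.+1)%N.
Proof. by move=> hV hl; apply: (HF_mul_form hV hl). Qed.

Lemma colon_subspace (V : R -> Prop) l : subspace V -> subspace (colon V l).
Proof. by apply: subspace_preim => c u v; rewrite mulrDr scalerAr. Qed.

(** With respect to a spanning family of R_d and a basis of R_(d+1)/V, multiplication by [lf a] is a
    matrix [M a] linear in [a]. The codimension is r minus its rank, so small codimension means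
    large rank. *)
Lemma line_open_codim V d c : subspace V ->
  line_open (fun a => (HF (addf V d (lf a)) d.+1 <= c)%N).
Proof.
move=> hV; set r := HF V d.+1.
have [b [Fb bi bs]] := HFP d.+1 hV; rewrite -/r in b Fb bi bs.
have [s [e [Fe es]]] := form_span K n d.
have Fxe i k : hform d.+1 ('X_i * e k).
  by rewrite -add1n; apply: dhomogM; [exact: X_form|exact: Fe].
have /choice[A0 hA0] : forall ik : 'I_n * 'I_s, exists c : 'I_r -> K,
    V ('X_(ik.1) * e ik.2 - \sum_l c l *: b l).
  by move=> [i k]; apply: bs.
pose A i : 'M[K]_(s, r) := \matrix_(k, l) A0 (i, k) l.
pose M (a : 'rV[K]_n) := \sum_i a 0 i *: A i.
have linM : linear M.
  move=> x u v; rewrite /M scaler_sumr -big_split; apply: eq_bigr => i _ /=.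
  by rewrite !mxE scalerDl scalerA.
pose f (y : 'rV[K]_r) := \sum_l y 0 l *: b l.
have linf : lin f.
  move=> x u v; rewrite /f scaler_sumr -big_split; apply: eq_bigr => i _ /=.
  by rewrite !mxE scalerDl scalerA.
have hM a k : V (lf a * e k - f (row k (M a))).
  have -> : lf a * e k - f (row k (M a)) =
     \sum_i a 0 i *: ('X_i * e k - \sum_l A0 (i, k) l *: b l).
    rewrite mulr_suml; under [RHS]eq_bigr do rewrite scalerBr.
    rewrite sumrB; congr (_ - _); first by apply: eq_bigr => i _; rewrite scalerAl.
    rewrite /f; under eq_bigr do rewrite mxE summxE scaler_suml.
    rewrite exchange_big; apply: eq_bigr => i _ /=; rewrite scaler_sumr.
    by apply: eq_bigr => l _; rewrite !mxE scalerA.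
  by apply: subspace_sum => // i _; apply: subspaceZ => //; apply: (hA0 (i, k)).
have hMy a (y : 'rV[K]_s) : V (lf a * (\sum_k y 0 k *: e k) - f (y *m M a)).
  rewrite mulmx_sum_row (lin_sum linf) mulr_sumr -sumrB; apply: subspace_sum => // k _.
  by rewrite (linZ linf) -scalerAr -scalerBr; apply: subspaceZ.
have key a : HF (addf V d (lf a)) d.+1 = (r - \rank (M a))%N.
  have hs := addf_subspace d (lf a) hV.
  apply: HF_unique => //.
  have := qdim_rows (submx1 (M a)); rewrite mxrank1; apply: (proj1 (qdim_iso linf _ hs _ _ _ _)).
  - by split=> [|x u v hu hv]; [exact: sub0mx|rewrite addmx_sub ?scalemx_sub].
  - by move=> y _; apply: (subspace_lincomb (form_subspace K n d.+1)).
  - move=> y _; split.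
      move=> /submxP[z ->]; exists (\sum_k z 0 k *: e k).
        exact: (subspace_lincomb (form_subspace K n d)).
      by apply: subspaceBC.
    move=> [q /es[z ->] hq]; apply/submxP; exists (\row_k z k).
    apply/eqP; rewrite -subr_eq0; apply/eqP/rowP => l; rewrite [RHS]mxE.
    apply: (bi (fun l => (y - (\row_k z k) *m M a) 0 l)).
    rewrite -/(f _) (linB linf); apply: (subspace_trans hV hq).
    have := hMy a (\row_k z k).
    by congr (V (_ * _ - _)); apply: eq_bigr => k _; rewrite mxE.
  - move=> p Fp; have [y hy] := bs p Fp; exists (\row_l y l); first exact: submx1.
    apply: addf_sub; move: hy; congr (V (_ - _)).
    by apply: eq_bigr => l _; rewrite mxE.
move=> a0 a1; rewrite key leq_subLR addnC -leq_subLR => h.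
have [q q0 H] := line_open_rank linM a1 h; exists q => // t /H.
by rewrite key leq_subLR addnC -leq_subLR.
Qed.

Lemma mnm_subK (m : 'X_{1..n}) i : (0 < m i)%N -> m = (U_(i) + (m - U_(i)))%MM.
Proof.
move=> h; rewrite addmC submK //; apply/mnm_lepP => j; rewrite mnm1E.
by case: eqP => [<-|].
Qed.

Lemma mdegS_exists (m : 'X_{1..n}) d : mdeg m = d.+1 -> exists i, (0 < m i)%N.
Proof.
move=> hm; apply/existsP; apply: contraTT isT => /existsPn h0; move: hm.
by rewrite mdegE big1 // => i _; apply/eqP; rewrite -leqn0 leqNgt h0.
Qed.

Lemma subspace_formS (V : R -> Prop) d : subspace V -> (forall i q, hform d q -> V ('X_i * q)) ->
  forall p, hform d.+1 p -> V p.
Proof.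
move=> hV hx p hp; rewrite (mpoly_homogE hp); apply: subspace_sum => // m _.
have [->|] := eqVneq p@_m 0; first by rewrite scale0r; exact: hV.1.
rewrite -mcoeff_msupp => /(dhomog_mf hp) hm; apply: subspaceZ => //.
have [i hi] := mdegS_exists hm; have mE := mnm_subK hi.
rewrite mE mpolyXD; apply: hx; rewrite /hform dhomogX.
by move: hm; rewrite /= mE mdegD mdeg1 add1n addmC addmK => -[->].
Qed.

Lemma min_codim (V : R -> Prop) d : exists a, forall a',
  (HF (addf V d (lf a)) d.+1 <= HF (addf V d (lf a')) d.+1)%N.
Proof.
have ex : exists k, `[< exists a, HF (addf V d (lf a)) d.+1 = k >].
  by exists (HF (addf V d (lf 0)) d.+1); apply/asboolP; exists 0.
case: (ex_minnP ex) => c /asboolP[a <-] hmin; exists a => a'.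
by apply: hmin; apply/asboolP; exists a'.
Qed.

(** Otherwise no linear form lowers the codimension, so each variable multiplies all forms of degree
    d into V; these products span degree d + 1, and V would have codimension 0. *)
Lemma min_codim_lt (V : R -> Prop) d a : subspace V -> (0 < HF V d.+1)%N ->
  (forall a', (HF (addf V d (lf a)) d.+1 <= HF (addf V d (lf a')) d.+1)%N) ->
  (HF (addf V d (lf a)) d.+1 < HF V d.+1)%N.
Proof.
move=> hV c0 hmin; rewrite ltnNge; apply/negP => h; move: c0.
rewrite (HF_eq0 hV) //; apply: subspace_formS => // i q; rewrite -lf_delta.
apply: (HF_eq0P (colon_subspace (lf (delta_mx 0 i)) hV)).
by have := HF_addf d hV (lf_form (delta_mx 0 i)); have := hmin (delta_mx 0 i); lia.
Qed.

(** Stated for subspaces because the induction passes to V plus the multiples of a form in one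
    degree, which is no ideal. The outer induction, on the degree, handles (V : a); the inner one,
    on the codimension, handles V + (a). *)
Theorem green d (V : R -> Prop) : subspace V ->
  exists a, (HF (addf V d (lf a)) d.+1 <= gr d.+1 (HF V d.+1))%N.
Proof.
elim: d V => [|d ihd] V.
  move=> hV; have [a ha] := min_codim V 0; exists a; rewrite gr1.
  have [c0|c0] := posnP (HF V 1); first by have := HF_addf 0 hV (lf_form a); lia.
  by have := min_codim_lt hV c0 ha; lia.
have [c] := ubnP (HF V d.+2); elim: c V => // c ihc V hc hV.
(* Compare a minimizing form a with a generic second one, by induction on V + (a)
   and on the quotient by a. *)
have [a hmin] := min_codim V d.+1.
have eV := HF_addf d.+1 hV (lf_form a).
exists a; have [c0|c0] := posnP (HF V d.+2); first by lia.
have hlt := min_codim_lt hV c0 hmin.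
have hVl := colon_subspace (lf a) hV.
have hV1 := addf_subspace d.+1 (lf a) hV.
have [||a' [h1 h2]] := line_open_meet
  (line_open_codim (d := d) (c := gr d.+1 (HF (colon V (lf a)) d.+1)) hVl)
  (line_open_codim (d := d.+1) (c := gr d.+2 (HF (addf V d.+1 (lf a)) d.+2)) hV1).
- exact: ihd.
- by apply: ihc => //; lia.
(* Minimality makes the codimension of V + (a') at least that of V + (a). Splitting the former along
   [a] bounds it by gr of the codimension of (V : a) plus gr of that of V + (a). *)
rewrite eV; apply: green_numeric; apply: leq_trans (hmin a') _.
have hV' := addf_subspace d.+1 (lf a') hV.
rewrite (HF_addf d.+1 hV' (lf_form a)); apply: leq_add.
  apply: leq_trans h1; apply: HF_le; first exact: addf_subspace.
    exact: colon_subspace.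
  move=> p hp [q hq hpq]; exists (lf a * q).
    by rewrite -add1n; apply: dhomogM => //; apply: lf_form.
  by move: hpq; rewrite /colon mulrBr mulrCA.
apply: leq_trans h2; apply: HF_le; [exact: addf_subspace..|].
move=> p hp [q hq [r hr hpq]]; exists r => //; exists q => //.
by move: hpq; rewrite addrAC.
Qed.

Lemma HF_plus_addf (W : R -> Prop) d l : gideal W -> l \is 1.-homog ->
  HF (plus W l) d.+1 = HF (addf W d l) d.+1.
Proof.
move=> hW hl; have hs := gideal_subspace hW.
apply: eq_HF; [exact: plus_subspace|exact: addf_subspace|] => p hp; split.
  by move=> h; rewrite -add1n in hp; exact: (form_plus hW hl hp h).
by move=> [q _ h]; exists q.
Qed.

(** One form serves all degrees: the quotient is zero from degree D on, so only finitely many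
    line-open conditions have to be met, and one more keeps the form outside the row space of
    [M]. *)
Lemma generic_form (W : R -> Prop) D m (M : 'M[K]_(m, n)) : gideal W ->
  (\rank M < n)%N -> (forall d, (D <= d)%N -> HF W d = 0%N) ->
  exists2 a, ~~ (a <= M)%MS &
    forall d, (HF (plus W (lf a)) d.+1 <= gr d.+1 (HF W d.+1))%N.
Proof.
move=> hW rM h0; have hs := gideal_subspace hW.
have [||ho [a0 ha0]] := @line_open_meets _ (iota 0 D)
   (fun d a => (HF (addf W d (lf a)) d.+1 <= gr d.+1 (HF W d.+1))%N).
- by move=> d; apply: line_open_codim.
- by move=> d; apply: green.
have [||a [Ma ha]] := line_open_meet (line_open_notin (M := M)) ho.
- have : ~~ (1%:M <= M)%MS by rewrite sub1mx -col_leq_rank -ltnNge.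
  by move/row_subPn => [i hi]; exists (row i 1%:M).
- by exists a0.
exists a => // d; case: (ltnP d D) => hd.
  by rewrite HF_plus_addf ?lf_form //; apply: ha; rewrite mem_iota.
have := HF_plus_le d.+1 hW (lf_form a).
by rewrite (h0 d.+1) ?leqn0 => [/eqP ->|] //; exact: leqW.
Qed.

(** The multiples of a Green form account for at most HF W d dimensions in degree d + 1, and what
    remains is at most [gr]; the difference is [lo]. *)
Lemma macaulay (W : R -> Prop) d : gideal W -> (lo d.+1 (HF W d.+1) <= HF W d)%N.
Proof.
move=> hW; have hs := gideal_subspace hW; have [a ha] := green d hs.
have e := HF_addf d hs (lf_form a).
have : (HF (colon W (lf a)) d <= HF W d)%N.
  apply: HF_le => //; first exact: colon_subspace.
  by move=> p _; exact: (gidealM hW).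
by have := gr_lo d.+1 (HF W d.+1); lia.
Qed.

End Green.

(** * Koszul differentials *)

Section Koszul.
Variables (K : fieldType) (n : nat) (M : lmodType K).
Implicit Types (S T : {set 'I_n}) (s t r : 'I_n).

Definition sgn s T : K := (-1) ^+ #|[set t in T | (t < s)%N]|.

Lemma sgn_sq s T : sgn s T * sgn s T = 1.
Proof. by rewrite -expr2 sqrr_sign. Qed.

Lemma sgnU s r T : s \notin T -> sgn r (s |: T) = (-1) ^+ (s < r)%N * sgn r T.
Proof.
move=> sT; rewrite /sgn -exprD; congr (_ ^+ _).
have [lt|le] := ltnP s r.
  have -> : [set t in s |: T | (t < r)%N] = s |: [set t in T | (t < r)%N].
    by apply/setP => t; rewrite !inE; case: eqP => [->|] //=; rewrite lt.
  by rewrite cardsU1 !inE (negbTE sT).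
rewrite add0n; apply: eq_card => t; rewrite !inE; case: eqP => [->|] //=.
by rewrite ltnNge le andbF.
Qed.

Lemma sgn_swap s r T : s \notin T -> r \notin T -> s != r ->
  sgn s T * sgn r (s |: T) = - (sgn r T * sgn s (r |: T)).
Proof.
move=> sT rT sr; rewrite (sgnU _ sT) (sgnU _ rT) !mulrA [sgn s T * _]mulrC -!mulrA.
rewrite [sgn s T * _]mulrC [sgn r T * _]mulrC -!mulrA [sgn s T * sgn r T]mulrC.
rewrite -mulNr; congr (_ * _).
by case: (ltngtP s r) sr => [_|_|/val_inj ->] //; rewrite ?eqxx // expr0 expr1 ?opprK.
Qed.

Definition cochain := {ffun {set 'I_n} -> M}.

Lemma cochain_lin c (u v : cochain) T : (c *: u + v) T = c *: u T + v T.
Proof. by rewrite !ffunE. Qed.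

Lemma cochainB (u v : cochain) T : (u - v) T = u T - v T.
Proof. by rewrite !ffunE. Qed.

Lemma cochainN (u : cochain) T : (- u) T = - u T.
Proof. by rewrite !ffunE. Qed.

Lemma cochainD (u v : cochain) T : (u + v) T = u T + v T.
Proof. by rewrite !ffunE. Qed.

(** [f T] is the coefficient at e_T. Indexing by all sets puts every homological degree into one
    space, and [supp_card i] selects degree i. *)
Definition koszul (a : 'I_n -> M -> M) (f : cochain) : cochain :=
  [ffun T : {set 'I_n} => \sum_(s | s \notin T) sgn s T *: a s (f (s |: T))].

Definition cokoszul (b : 'I_n -> M -> M) (f : cochain) : cochain :=
  [ffun T : {set 'I_n} => \sum_(s in T) sgn s (T :\ s) *: b s (f (T :\ s))].

Definition supp_card (i : nat) (f : cochain) : Prop := forall T, f T != 0 -> #|T| = i.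

Lemma supp_card_eq0 i f T : supp_card i f -> #|T| != i -> f T = 0.
Proof. by move=> h; apply: contraNeq => /h ->. Qed.

Section Ops.
Variables (a b : 'I_n -> M -> M).
Hypotheses (ha : forall s, lin (a s)) (hb : forall s, lin (b s)).

Lemma koszul_lin : lin (koszul a : cochain -> cochain).
Proof.
move=> c u v; apply/ffunP => T; rewrite !ffunE scaler_sumr -big_split /=.
apply: eq_bigr => s _; rewrite !ffunE ha scalerDr !scalerA; congr (_ *: _ + _).
exact: mulrC.
Qed.

Lemma koszul_supp i f : supp_card i.+1 f -> supp_card i (koszul a f).
Proof.
move=> hf T; apply: contraNeq => hT; rewrite ffunE big1 // => s sT.
rewrite (supp_card_eq0 hf) ?(lin0 (ha s)) ?scaler0 //.
by rewrite cardsU1 sT add1n eqSS.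
Qed.

Lemma koszul_supp0 f : supp_card 0 f -> koszul a f = 0.
Proof.
move=> hf; apply/ffunP => T; rewrite !ffunE big1 // => s sT.
by rewrite (supp_card_eq0 hf) ?(lin0 (ha s)) ?scaler0 // cardsU1 sT.
Qed.

Lemma cokoszul_supp i f : supp_card i f -> supp_card i.+1 (cokoszul b f).
Proof.
move=> hf T; apply: contraNeq => hT; rewrite ffunE big1 // => s sT.
rewrite (supp_card_eq0 hf) ?(lin0 (hb s)) ?scaler0 //.
by apply: contraNneq hT => <-; rewrite (cardsD1 s) sT.
Qed.

Hypothesis hK : [pchar K] =i pred0.

Lemma eq_opp0 (u : M) : u = - u -> u = 0.
Proof.
move=> h; have : (2%:R : K) *: u = 0.
  by rewrite scaler_nat mulr2n {2}h subrr.
by move/eqP; rewrite scaler_eq0 ((pcharf0P K).1 hK) /= => /eqP.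
Qed.

(** Exchanging the two indices changes the sign ([sgn_swap]), so the double sum is its own negative,
    and characteristic zero allows division by 2. *)
Lemma koszul_sq f : (forall s t u, a s (a t u) = a t (a s u)) ->
  koszul a (koszul a f) = 0.
Proof.
move=> hc; apply/ffunP => T; rewrite [RHS]ffunE.
pose G s r := (sgn s T * sgn r (s |: T)) *: a s (a r (f (r |: (s |: T)))).
have E : koszul a (koszul a f) T =
   \sum_(s | s \notin T) \sum_(r | (r \notin T) && (r != s)) G s r.
  rewrite ffunE; apply: eq_bigr => s sT; rewrite ffunE (lin_sum (ha s)) scaler_sumr.
  apply: eq_big => [r|r _]; first by rewrite !inE negb_or andbC.
  by rewrite (linZ (ha s)) scalerA.
rewrite E; apply: eq_opp0.
rewrite -sumrN {1}(exchange_big_dep (fun r => r \notin T)) /=; last first.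
  by move=> s r _ /andP[].
apply: eq_bigr => r rT; rewrite -sumrN; apply: eq_big => [s|s].
  by rewrite rT /= eq_sym.
move=> /andP[sT /andP[_ rs]]; rewrite /G -scaleNr -sgn_swap // 1?eq_sym // hc.
by rewrite finset.setUCA.
Qed.

(** The cross terms with two different indices cancel in pairs because of their signs; only the
    diagonal terms survive. *)
Lemma koszul_homotopy f T :
  (forall s r u, s != r -> a s (b r u) = b r (a s u)) ->
  (koszul a (cokoszul b f) + cokoszul b (koszul a f)) T =
  \sum_(s | s \notin T) a s (b s (f T)) + \sum_(s in T) b s (a s (f T)).
Proof.
move=> hc; rewrite !ffunE.
have E1 : \sum_(s | s \notin T) sgn s T *: a s (cokoszul b f (s |: T)) =
   \sum_(s | s \notin T) a s (b s (f T)) +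
   \sum_(s | s \notin T) \sum_(r in T)
      (sgn s T * sgn r ((s |: T) :\ r)) *: a s (b r (f ((s |: T) :\ r))).
  rewrite -big_split; apply: eq_bigr => s sT; rewrite ffunE (lin_sum (ha s)) scaler_sumr.
  rewrite (bigD1 s) ?setU11 //= finset.setU1K // (linZ (ha s)) scalerA sgn_sq scale1r.
  congr (_ + _); apply: eq_big => [r|r /andP[_ rs]].
    rewrite !inE; case: eqP => [->|] /=; last by rewrite andbT.
    by rewrite (negbTE sT).
  by rewrite (linZ (ha s)) scalerA.
have E2 : \sum_(r in T) sgn r (T :\ r) *: b r (koszul a f (T :\ r)) =
   \sum_(r in T) b r (a r (f T)) +
   \sum_(r in T) \sum_(s | s \notin T)
      (sgn r (T :\ r) * sgn s (T :\ r)) *: b r (a s (f (s |: (T :\ r)))).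
  rewrite -big_split; apply: eq_bigr => r rT; rewrite ffunE (lin_sum (hb r)) scaler_sumr.
  rewrite (bigD1 r) ?setD11 //= finset.setD1K // (linZ (hb r)) scalerA sgn_sq scale1r.
  congr (_ + _); apply: eq_big => [s|s /andP[_ sr]].
    by rewrite !inE negb_and negbK; case: eqP => [->|] /=; rewrite ?rT ?andbT.
  by rewrite (linZ (hb r)) scalerA.
rewrite E1 E2 addrACA [X in _ + X](_ : _ = 0) ?addr0 //.
rewrite [X in _ + X]exchange_big -big_split big1 //= => s sT.
rewrite -big_split big1 //= => r rT.
have sr : s != r by apply: contraNneq sT => ->.
have -> : (s |: T) :\ r = s |: (T :\ r).
  by apply/setP => x; rewrite !inE; case: eqP => [->|] //=; rewrite eq_sym (negbTE sr).
rewrite hc // -scalerDl; set U := T :\ r.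
have sU : s \notin U by rewrite !inE (negbTE sT) andbF.
have rU : r \notin U by rewrite !inE eqxx.
have -> : T = r |: U by rewrite finset.setD1K.
rewrite (sgnU _ sU) (sgnU _ rU).
suff -> : (-1) ^+ (r < s)%N * sgn s U * ((-1) ^+ (s < r)%N * sgn r U) = - (sgn r U * sgn s U).
  by rewrite addNr scale0r.
rewrite mulrACA -signr_addb [sgn s U * _]mulrC.
by case: (ltngtP s r) sr => [_|_|/val_inj ->] //=; rewrite ?eqxx // mulN1r.
Qed.

End Ops.
End Koszul.

(** * Independence of the resolution *)

Section Resolutions.
Variables (K : fieldType) (n : nat) (I : {pred {mpoly K[n]}}).
Local Notation R := {mpoly K[n]}.
Hypothesis hI : homog_ideal I.

(* The part of degree d of a generator of degree s times p is this multiple. *)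
Definition hpart (d s : nat) (p : R) : R :=
  if (s <= d)%N then pihomog mdeg (d - s) p else 0.

Lemma hpart_lin d s : lin (hpart d s).
Proof.
move=> c u v; rewrite /hpart; case: ifP => _; last by rewrite scaler0 addr0.
by rewrite linearP.
Qed.

Lemma hpartM d s e p q : q \is e.-homog ->
  hpart d s (p * q) = hpart d (s + e) p * q.
Proof.
move=> hq; rewrite /hpart mulrC (pihomogM _ _ hq) subnDA.
case: (leqP s d) => le; last by rewrite ifN ?mul0r // -ltnNge ltn_addr.
by rewrite leq_subRL // addnC; case: ifP => _; rewrite ?mul0r // mulrC.
Qed.

Lemma hpart_idem d s p : hpart d s (hpart d s p) = hpart d s p.
Proof. by rewrite /hpart; case: (s <= d)%N => //; rewrite pihomog_id. Qed.

Lemma hpart_homog d s p : hpart d s p = p <-> p = 0 \/ (s <= d)%N /\ p \is (d - s).-homog.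
Proof.
rewrite /hpart; case: ifP => le; split.
- by move=> <-; right; split=> //; exact: pihomogP.
- by case=> [->|[_ h]]; [exact: pihomog0|exact: pihomog_dE].
- by left.
- by case=> [->|[]].
Qed.

Lemma hpart_mulr s t e p q : q \is e.-homog -> hpart s t p = p ->
  hpart (s + e) t (q * p) = q * p.
Proof.
move=> hq /hpart_homog[->|[le hp]]; apply/hpart_homog; first by left; rewrite mulr0.
right; split; first by rewrite (leq_trans le) ?leq_addr.
by rewrite -addnBAC // addnC; exact: dhomogM.
Qed.

Definition cycle_of (F : free_complex K n) (aug : 'cV[R]_(rk F 0)) (i : nat) :
    'rV[R]_(rk F i) -> Prop :=
  match i with
  | 0 => fun u => (u *m aug) 0 0 \in I
  | i'.+1 => fun u => u *m bd F i' = 0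
  end.

Section OneResolution.
Variables (F : free_complex K n) (aug : 'cV[R]_(rk F 0)).
Hypothesis hF : resolves aug I.

Lemma cycle_ofP i u : cycle_of aug u <-> exists v, u = v *m bd F i.
Proof. by case: hF => _ _ _ h0 h1; case: i u => [|i] u; [exact: h0|exact: h1]. Qed.

Lemma cycle_of_bd i (v : 'rV_(rk F i.+1)) : cycle_of aug (v *m bd F i).
Proof. by apply/cycle_ofP; exists v. Qed.

Lemma bd_bd i : bd F i.+1 *m bd F i = 0.
Proof.
apply/row_matrixP => a; rewrite row0 row_mul rowE -mulmxA.
by have := @cycle_of_bd i.+1 (delta_mx 0 a); rewrite /= mulmxA.
Qed.

Lemma bd_homog i a b : bd F i a b != 0 ->
  exists2 e, shift a = (shift b + e)%N & bd F i a b \is e.-homog.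
Proof. by case: hF => h _ _ _ _; apply: h. Qed.

Definition hrow i (d : nat) (u : 'rV[R]_(rk F i)) : 'rV[R]_(rk F i) :=
  \row_b hpart d (shift b) (u 0 b).

Lemma hrow_bd i d (v : 'rV_(rk F i.+1)) : hrow d (v *m bd F i) = hrow d v *m bd F i.
Proof.
apply/rowP => b; rewrite !mxE (lin_sum (hpart_lin d (shift b))).
apply: eq_bigr => a _; rewrite !mxE.
have [->|/bd_homog[e -> he]] := eqVneq (bd F i a b) 0; last exact: hpartM.
by rewrite !mulr0 (lin0 (hpart_lin _ _)).
Qed.

Lemma hrow_lift i d (u : 'rV_(rk F i)) : hrow d u = u -> cycle_of aug u ->
  exists2 v, hrow d v = v & u = v *m bd F i.
Proof.
move=> hu /cycle_ofP[v uv]; exists (hrow d v).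
  by apply/rowP => b; rewrite !mxE hpart_idem.
by rewrite -hrow_bd -uv.
Qed.

Lemma bdK_bdK i : bdK F i.+1 *m bdK F i = 0.
Proof. by rewrite -map_mxM bd_bd map_mx0. Qed.

(** A homogeneous entry with nonzero constant term has degree 0, so it joins generators of equal
    degree. *)
Lemma deg_part_bdK i d : deg_part F i.+1 d *m bdK F i = bdK F i *m deg_part F i d.
Proof.
apply/matrixP => a b; rewrite mul_diag_mx mul_mx_diag !mxE mulrC.
have [->|nz] := eqVneq (bd F i a b)@_0%MM 0; first by rewrite !mul0r.
have /bd_homog[e eq he] : bd F i a b != 0 by apply: contraNneq nz => ->; rewrite mcoeff0.
suff e0 : e = 0%N by rewrite eq e0 addn0.
apply/eqP; apply: contraNT nz => ne.
by rewrite (dhomog_nemf_coeff he) //= mdeg0 eq_sym.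
Qed.

Lemma deg_part_idem i d : deg_part F i d *m deg_part F i d = deg_part F i d.
Proof.
apply/matrixP => a b; rewrite mul_diag_mx !mxE.
by case: (a == b); rewrite ?mulr0n ?mulr0 // mulr1n; case: eqP; rewrite ?mulr1 ?mulr0.
Qed.

Lemma sub_deg_part i d (u : 'rV[K]_(rk F i)) :
  (u <= deg_part F i d)%MS <-> u *m deg_part F i d = u.
Proof.
split=> [/submxP[v ->]|<-]; last exact: submxMl.
by rewrite -mulmxA deg_part_idem.
Qed.

Lemma tor_dimP i d :
  qdim (fun u : 'rV[K]_(rk F i) => u *m deg_part F i d = u /\ (u <= kerK F i)%MS)
       (fun u => exists v, u = v *m bdK F i) (tor_dim F i d).
Proof.
have sub : (deg_part F i.+1 d *m bdK F i <= deg_part F i d :&: kerK F i)%MS.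
  rewrite sub_capmx {1}deg_part_bdK submxMl /=.
  case: i => [|i]; first exact: submx1.
  by apply/sub_kermxP; rewrite -mulmxA bdK_bdK mulmx0.
apply: eq_qdim (qdim_rows sub) => [u|u|].
- by rewrite sub_capmx; split=> [/andP[/sub_deg_part ? ?]|[/sub_deg_part -> ->]].
- rewrite sub_capmx => /andP[/sub_deg_part hu _]; split=> [/submxP[v ->]|[v uv]].
    by exists (v *m deg_part F i.+1 d); rewrite mulmxA.
  by rewrite -hu uv -mulmxA -deg_part_bdK mulmxA -mulmxA submxMl.
- by split=> [|c u v hu hv]; [exact: sub0mx|rewrite addmx_sub ?scalemx_sub].
Qed.

(** The second half of a homotopy X = 1 + h d + d h', recorded only as a factorization through the
    differential: this is enough to kill it on cycles of F (x) K. *)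
Definition through_bd (i : nat) : 'M[R]_(rk F i) -> Prop :=
  match i with
  | 0 => fun B => B = 0
  | i'.+1 => fun B => exists h', B = bd F i' *m h'
  end.

Lemma homotopy (X : forall i, 'M[R]_(rk F i)) :
  (forall u : 'rV_(rk F 0), (u *m X 0%N *m aug) 0 0 - (u *m aug) 0 0 \in I) ->
  (forall i, X i.+1 *m bd F i = bd F i *m X i) ->
  forall i, exists (h : 'M_(rk F i, rk F i.+1)) (B : 'M_(rk F i)), through_bd B /\ X i = 1%:M + h *m bd F i + B.
Proof.
move=> h0 hX.
have lift i (Y : 'M_(rk F i)) : (forall a, cycle_of aug (row a Y)) ->
    exists h, Y = h *m bd F i.
  move=> hY; have /choice[v hv] : forall a, exists v, row a Y = v *m bd F i.
    by move=> a; apply/cycle_ofP.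
  exists (\matrix_(a, b) v a 0 b); apply/row_matrixP => a; rewrite hv row_mul.
  by congr (_ *m _); apply/rowP => b; rewrite !mxE.
elim=> [|i [h [B [hB hh]]]].
  have [a|h hh] := lift 0%N (X 0%N - 1%:M).
    have E (A C : 'M[R]_1) : (A - C) 0 0 = A 0 0 - C 0 0 by rewrite !mxE.
    by rewrite /= rowE mulmxBr mulmx1 mulmxBl E; exact: h0.
  by exists h, 0; rewrite -hh addr0 addrC subrK.
have [a|k hk] := lift i.+1 (X i.+1 - 1%:M - bd F i *m h); last first.
  exists k, (bd F i *m h); split; first by exists h.
  by rewrite -hk -addrA subrK addrC subrK.
rewrite /= -row_mul !mulmxBl hX mul1mx hh !mulmxDr mulmx1 !mulmxA.
have -> : bd F i *m B = 0.
  by case: (i) B hB {hh} => [|j] B /=; [move=> ->; rewrite mulmx0|move=> [h' ->]; rewrite mulmxA bd_bd mul0mx].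
by rewrite addr0 -addrA -opprD subrr row0.
Qed.

End OneResolution.

Section TwoResolutions.
Variables (F G : free_complex K n) (augF : 'cV[R]_(rk F 0)) (augG : 'cV[R]_(rk G 0)).
Hypotheses (hF : resolves augF I) (hG : resolves augG I).

(** The comparison theorem with homogeneous maps: each row of the previous composite is a cycle of G
    and is lifted through its differential. *)
Lemma chain_map : exists X : forall i, 'M[R]_(rk F i, rk G i),
  [/\ forall u : 'rV_(rk F 0), (u *m X 0%N *m augG) 0 0 - (u *m augF) 0 0 \in I,
      forall i, X i.+1 *m bd G i = bd F i *m X i
    & forall i a, hrow (F := G) (shift a) (row a (X i)) = row a (X i)].
Proof.
have hI0 := homog_ideal_gideal hI; have hs := gideal_subspace hI0.
(* Sending cycles to cycles is the invariant that makes the next lift possible; it travels with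
   homogeneity through the recursion on dependent pairs. *)
pose good i (X : 'M[R]_(rk F i, rk G i)) :=
  (forall u, cycle_of augF u -> cycle_of augG (u *m X)) /\
  (forall a, hrow (F := G) (shift a) (row a X) = row a X).
have [X0 h0 g0] : exists2 X0 : 'M[R]_(rk F 0, rk G 0),
    forall u : 'rV_(rk F 0), (u *m X0 *m augG) 0 0 - (u *m augF) 0 0 \in I & good 0%N X0.
  case: (hF) (hG) => _ aF _ _ _ [_ aG sG _ _].
  have /choice[v hv] : forall a, exists v : 'rV_(rk G 0),
      hrow (shift a) v = v /\ (v *m augG) 0 0 - augF a 0 \in I.
    move=> a; have [v hv] := sG (augF a 0); exists (hrow (shift a) v); split.
      by apply/rowP => b; rewrite !mxE hpart_idem.
    apply: (subspaceBC hs); have := gideal_pihomog hI0 (shift a) hv.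
    rewrite raddfB /= pihomog_dE // -/(pihomog mdeg (shift a)) => h.
    suff <- : pihomog mdeg (shift a) ((v *m augG) 0 0) = (hrow (shift a) v *m augG) 0 0 by [].
    have E p : pihomog mdeg (shift a) p = hpart (shift a) 0 p by rewrite /hpart leq0n subn0.
    rewrite E !mxE (lin_sum (hpart_lin _ _)); apply: eq_bigr => b _.
    by rewrite mxE (hpartM _ _ _ (aG b)).
  pose X0 : 'M[R]_(rk F 0, rk G 0) := \matrix_(a, b) v a 0 b.
  have rX a : row a X0 = v a by apply/rowP => b; rewrite !mxE.
  have hX0 (u : 'rV_(rk F 0)) : (u *m X0 *m augG) 0 0 - (u *m augF) 0 0 \in I.
    rewrite -mulmxA !mxE -sumrB; apply: (subspace_sum hs) => a _.
    rewrite -mulrBr; apply: (gidealM hI0); have [_] := hv a.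
    by rewrite -rX -row_mul mxE.
  exists X0 => //; split=> [u hu|a]; last by rewrite rX; have [] := hv a.
  by have := subspaceD hs (hX0 u) hu; rewrite subrK.
have step i (X : {X : 'M[R]_(rk F i, rk G i) | good i X}) :
    {Y : {Y : 'M[R]_(rk F i.+1, rk G i.+1) | good i.+1 Y} |
       sval Y *m bd G i = bd F i *m sval X}.
  case: X => X [gX dX] /=; apply: cid.
  have /choice[v hv] : forall a, exists v : 'rV_(rk G i.+1),
      hrow (shift a) v = v /\ row a (bd F i *m X) = v *m bd G i.
    move=> a; have [||v hv1 hv2] := @hrow_lift _ _ hG i (shift a) (row a (bd F i *m X)).
    - apply/rowP => b; rewrite !mxE (lin_sum (hpart_lin _ _)).
      apply: eq_bigr => c _; have [->|/(bd_homog hF)[e eq he]] := eqVneq (bd F i a c) 0.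
        by rewrite mul0r (lin0 (hpart_lin _ _)).
      by have /rowP/(_ b) := dX c; rewrite !mxE eq => E; exact: hpart_mulr.
    - rewrite row_mul; apply: gX; rewrite rowE; exact: cycle_of_bd.
    by exists v.
  pose Y : 'M[R]_(rk F i.+1, rk G i.+1) := \matrix_(a, b) v a 0 b.
  have rY a : row a Y = v a by apply/rowP => b; rewrite !mxE.
  have YE : Y *m bd G i = bd F i *m X.
    by apply/row_matrixP => a; have [_ ->] := hv a; rewrite row_mul rY.
  suff gY : good i.+1 Y by exists (exist _ Y gY).
  split=> [u hu|a]; last by rewrite rY; have [] := hv a.
  by rewrite /= -mulmxA YE mulmxA (hu : u *m bd F i = 0) mul0mx.
pose X := nat_rect (fun i => {X : 'M[R]_(rk F i, rk G i) | good i X})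
  (exist _ X0 g0) (fun i Xi => sval (step i Xi)).
exists (fun i => sval (X i)); split=> //.
  by move=> i; apply: (svalP (step i (X i))).
by move=> i a; case: (svalP (X i)) => _; apply.
Qed.

End TwoResolutions.

(** The round trip F -> G -> F is homotopic to the identity, so F -> G is injective on Tor.
    Exchanging the roles of F and G gives equality. *)
Lemma tor_dim_le (F G : free_complex K n) augF augG i d :
  resolves (F := F) augF I -> resolves (F := G) augG I ->
  (tor_dim F i d <= tor_dim G i d)%N.
Proof.
move=> hF hG; have [X [X0 XS Xh]] := chain_map hF hG; have [Y [Y0 YS _]] := chain_map hG hF.
have hs := gideal_subspace (homog_ideal_gideal hI).
have [||h [B [hB hh]]] := @homotopy F augF hF (fun i => X i *m Y i) _ _ i.
- move=> u; rewrite mulmxA; apply: (subspace_trans hs (Y0 _)); exact: X0.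
- by move=> j; rewrite -mulmxA YS mulmxA XS mulmxA.
pose c : R -> K := mcoeff 0%MM.
have cM p q (r : nat) (A1 : 'M[R]_(p, q)) (A2 : 'M_(q, r)) :
    map_mx c (A1 *m A2) = map_mx c A1 *m map_mx c A2.
  exact: map_mxM.
have XdegK : map_mx c (X i) *m deg_part G i d = deg_part F i d *m map_mx c (X i).
  apply/matrixP => a b; rewrite mul_diag_mx mul_mx_diag !mxE mulrC.
  have [->|nz] := eqVneq (c (X i a b)) 0; first by rewrite !mulr0.
  have /rowP/(_ b) := Xh i a; rewrite !mxE => /hpart_homog[e|[le he]].
    by rewrite /c e mcoeff0 eqxx in nz.
  suff -> : shift b = shift a by [].
  apply/eqP; rewrite eqn_leq le /= -subn_eq0; apply: contraNT nz => ne.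
  by rewrite /c (dhomog_nemf_coeff he) //= mdeg0 eq_sym.
have kerX u : (u <= kerK F i)%MS -> (u *m map_mx c (X i) <= kerK G i)%MS.
  case: (i) u => [|j] u /=; first by rewrite !submx1.
  move=> /sub_kermxP hu; apply/sub_kermxP.
  by rewrite /bdK -mulmxA -cM XS cM mulmxA [X in X *m _]hu mul0mx.
have linX : lin (fun u : 'rV[K]_(rk F i) => u *m map_mx c (X i)).
  by move=> x u v; rewrite mulmxDl scalemxAl.
have subP (H : free_complex K n) :
    subspace (fun u : 'rV[K]_(rk H i) => u *m deg_part H i d = u /\ (u <= kerK H i)%MS).
  split=> [|x u v [hu ku] [hv kv]]; first by rewrite mul0mx sub0mx.
  by rewrite mulmxDl -scalemxAl hu hv addmx_sub ?scalemx_sub.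
have subQ (H : free_complex K n) :
    subspace (fun u : 'rV[K]_(rk H i) => exists v, u = v *m bdK H i).
  split=> [|x u v [u' ->] [v' ->]]; first by exists 0; rewrite mul0mx.
  by exists (x *: u' + v'); rewrite mulmxDl scalemxAl.
have [|||r le qr] := qdim_inj (P := fun u => u *m deg_part F i d = u /\ (u <= kerK F i)%MS)
  (Q := fun u => exists v, u = v *m bdK F i) linX (subP F) _ (subQ G) _ _ (tor_dimP hG i d).
- exact: subQ.
- by move=> u [hu ku]; split; [rewrite -mulmxA XdegK mulmxA hu|exact: kerX].
- move=> u [hu ku] [v hv].
  (* On a cycle of F (x) K the part of the homotopy that factors through the differential vanishes,
     so u differs from its round trip by a boundary. *)
  have hE : u = u *m map_mx c (X i) *m map_mx c (Y i) - u *m map_mx c h *m bdK F i.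
    have := congr1 (map_mx c) hh; rewrite !map_mxD !cM map_mx1 => /(congr1 (mulmx u)).
    rewrite !mulmxDr mulmx1 !mulmxA => ->.
    have -> : u *m map_mx c B = 0.
      case: (i) u ku B hB {hu hh hv v} => [|j] u ku B /=; first by move=> ->; rewrite map_mx0 mulmx0.
      move=> [h' ->]; rewrite cM mulmxA; move/sub_kermxP: ku; rewrite /bdK => ->.
      by rewrite mul0mx.
    by rewrite addr0 addrK.
  exists (v *m map_mx c (Y i.+1) - u *m map_mx c h).
  rewrite {1}hE hv mulmxBl; congr (_ - _); rewrite -!mulmxA; congr (_ *m _).
  by rewrite /bdK -!cM YS.
by rewrite (qdim_unique (subQ F) (tor_dimP hF i d) qr).
Qed.

Lemma bettiE (F : free_complex K n) aug i d : resolves (F := F) aug I ->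
  betti I i d = tor_dim F i d.
Proof.
move=> hF; rewrite /betti; case: xgetP => [b -> [G [augG [hG ->]]]|h].
  by apply/eqP; rewrite eqn_leq (tor_dim_le i d hF hG) (tor_dim_le i d hG hF).
by case: (h (tor_dim F i d)); exists F, aug.
Qed.

End Resolutions.

(** * A free resolution of an Artinian quotient *)

Section ArtinianBasis.
Variables (K : fieldType) (n : nat) (I : {pred {mpoly K[n]}}).
Local Notation R := {mpoly K[n]}.
Hypothesis hI : graded_artinian I.

Let gI : gideal (fun p => p \in I) := homog_ideal_gideal hI.1.
Let sI : subspace (fun p => p \in I) := gideal_subspace gI.

Lemma mpoly_forms (P : R -> Prop) : subspace P ->
  (forall d p, hform d p -> P p) -> forall p, P p.
Proof.
move=> hP h p; rewrite (pihomog_partitionE (leqnn (mmeasure mdeg p))).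
by apply: subspace_sum => // d _; apply: (h d); exact: pihomogP.
Qed.

Lemma artinian_basis : exists N (b : 'I_N -> R) (dg : 'I_N -> nat),
  [/\ forall l, hform (dg l) (b l),
      forall c : 'I_N -> K, \sum_l c l *: b l \in I -> forall l, c l = 0,
      forall p, exists c : 'I_N -> K, p - \sum_l c l *: b l \in I
    & forall e p, hform e p -> exists2 c : 'I_N -> K,
        (forall l, c l != 0 -> dg l = e) & p - \sum_l c l *: b l \in I].
Proof.
have [r [a ha]] := hI.2.
(* Homogeneous elements do not form a subspace, but [qdim_of_span] asks this only of [Q]; it
   extracts a basis of R/I made of forms. *)
have [|N _ [b [/choice[dg hb] bi bs]]] :=
  @qdim_of_span _ _ (fun p => exists d, hform d p) (fun p => p \in I) r a sI.
  by move=> p _; apply: ha.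
exists N, b, dg; split=> // [|e p hp].
  apply: mpoly_forms => [|d p hp]; last by apply: bs; exists d.
  split=> [|c u v [x hx] [y hy]].
    exists (fun=> 0); rewrite big1 ?subr0; first exact: gideal0 gI.
    by move=> l _; rewrite scale0r.
  exists (fun l => c * x l + y l).
  have -> : c *: u + v - \sum_l (c * x l + y l) *: b l =
     c *: (u - \sum_l x l *: b l) + (v - \sum_l y l *: b l).
    rewrite scalerBr addrACA -opprD; congr (_ - _).
    rewrite scaler_sumr -big_split; apply: eq_bigr => l _ /=.
    by rewrite scalerDl scalerA.
  exact: sI.2.
have [c hc] := bs p (ex_intro _ e hp).
(* Keeping the basis elements of degree e amounts to taking the component of degree e of the
   combination. *)
exists (fun l => if dg l == e then c l else 0).
  by move=> l; case: (dg l =P e) => // _; rewrite eqxx.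
have -> : \sum_l (if dg l == e then c l else 0) *: b l = pihomog mdeg e (\sum_l c l *: b l).
  rewrite raddf_sum /=; apply: eq_bigr => l _; rewrite linearZ /=.
  case: eqP => [<-|/eqP ne]; first by rewrite pihomog_dE //; exact: hb.
  by rewrite (pihomog_ne0 ne (hb l)) scale0r scaler0.
by have := gideal_pihomog gI e hc; rewrite raddfB /= pihomog_dE.
Qed.

End ArtinianBasis.

Section Euler.
Variables (K : fieldType) (n : nat).
Local Notation R := {mpoly K[n]}.

Lemma mderiv_form s d (p : R) : hform d p -> hform d.-1 (mderiv s p).
Proof.
move=> hp; apply/dhomogP => m; rewrite mcoeff_msupp mcoeff_mderiv => h.
have : p@_(m + U_(s)) != 0 by apply: contraNneq h => ->; rewrite mul0rn.
by rewrite -mcoeff_msupp => /(dhomog_mf hp) /=; rewrite mdegD mdeg1 addn1 => <-.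
Qed.

Lemma mderiv_form0 s (p : R) : hform 0 p -> mderiv s p = 0.
Proof.
move=> hp; apply/mpolyP => m; rewrite mcoeff_mderiv mcoeff0 (dhomog_nemf_coeff hp) ?mul0rn //=.
by rewrite mdegD mdeg1 addn1.
Qed.

Lemma euler d (p : R) : hform d p -> \sum_s 'X_s * mderiv s p = d%:R *: p.
Proof.
move=> hp; have hX (m : 'X_{1..n}) : \sum_s 'X_s * mderiv s ('X_[m] : R) = (mdeg m)%:R *: 'X_[m].
  rewrite mdegE natr_sum scaler_suml; apply: eq_bigr => s _.
  rewrite mderivX -scalerAr; have [->|m0] := eqVneq (m s) 0%N; first by rewrite !scale0r.
  rewrite -mpolyXD addmC submK //; apply/mnm_lepP => j; rewrite mnm1E.
  by case: eqP => [<-|//]; rewrite lt0n.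
rewrite [in LHS](mpolyE p) [in RHS](mpolyE p) scaler_sumr.
under eq_bigr do rewrite raddf_sum mulr_sumr.
rewrite exchange_big /= big_seq [RHS]big_seq; apply: eq_bigr => m mp.
under eq_bigr do rewrite linearZ -scalerAr.
by rewrite -scaler_sumr hX (dhomog_mf hp mp) /= !scalerA mulrC.
Qed.

End Euler.

(** * Exactness of the Koszul complex of x_s (x) 1 - 1 (x) x_s *)

Section KoszulExact.
Variables (K : fieldType) (n N : nat) (Mat : 'I_n -> 'M[K]_N).
Local Notation R := {mpoly K[n]}.
Hypothesis hK : [pchar K] =i pred0.
Hypothesis Mat_comm : forall s t, Mat s *m Mat t = Mat t *m Mat s.

Definition vec := {ffun 'I_N -> R}.
Definition mulX (s : 'I_n) (v : vec) : vec := [ffun l => 'X_s * v l].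
Definition derX (s : 'I_n) (v : vec) : vec := [ffun l => mderiv s (v l)].
Definition actM (s : 'I_n) (v : vec) : vec := [ffun l => \sum_k Mat s k l *: v k].
(* x_s (x) 1 - 1 (x) x_s on R (x)_K A, when Mat s is multiplication by x_s on A;
   its Koszul complex resolves A over R. *)
Definition opX (s : 'I_n) (v : vec) : vec := mulX s v - actM s v.

Lemma mulX_lin s : lin (mulX s : vec -> vec).
Proof. by move=> c u v; apply/ffunP => l; rewrite !ffunE mulrDr scalerAr. Qed.

Lemma derX_lin s : lin (derX s : vec -> vec).
Proof. by move=> c u v; apply/ffunP => l; rewrite !ffunE linearP. Qed.

Lemma actM_lin s : lin (actM s : vec -> vec).
Proof.
move=> c u v; apply/ffunP => l; rewrite !ffunE scaler_sumr -big_split /=.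
by apply: eq_bigr => k _; rewrite !ffunE scalerDr !scalerA mulrC.
Qed.

Lemma opX_lin s : lin (opX s : vec -> vec).
Proof. by move=> c u v; rewrite /opX mulX_lin actM_lin scalerBr opprD addrACA. Qed.

Lemma mulX_comm s t v : mulX s (mulX t v) = mulX t (mulX s v).
Proof. by apply/ffunP => l; rewrite !ffunE mulrCA. Qed.

Lemma mulX_actM s t v : mulX s (actM t v) = actM t (mulX s v).
Proof.
apply/ffunP => l; rewrite !ffunE mulr_sumr; apply: eq_bigr => k _.
by rewrite !ffunE scalerAr.
Qed.

Lemma actM_comm s t v : actM s (actM t v) = actM t (actM s v).
Proof.
have E s' t' l : actM s' (actM t' v) l = \sum_k (Mat t' *m Mat s') k l *: v k.
  rewrite ffunE; under eq_bigr do rewrite ffunE scaler_sumr.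
  rewrite exchange_big; apply: eq_bigr => k _ /=; rewrite mxE scaler_suml.
  by apply: eq_bigr => j _; rewrite scalerA mulrC.
by apply/ffunP => l; rewrite !E Mat_comm.
Qed.

Lemma opX_comm s t v : opX s (opX t v) = opX t (opX s v).
Proof.
rewrite {1 3}/opX !(linB (mulX_lin _)) !(linB (actM_lin _)) /=.
rewrite mulX_comm (actM_comm s t) !mulX_actM !opprB !addrA.
by rewrite addrAC [in RHS]addrAC; congr (_ + _); rewrite addrAC.
Qed.

(** Filters R (x) A by the polynomial degree in R. [mulX] raises this degree by one and [actM] does
    not raise it, so [mulX] is the leading part of [opX]. *)
Definition deg_lt (k : nat) (v : vec) : Prop :=
  forall l e, (k <= e)%N -> pihomog mdeg e (v l) = 0.

Lemma deg_lt_subspace k : subspace (deg_lt k).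
Proof.
split=> [l e _|c u v hu hv l e le]; first by rewrite ffunE pihomog0.
by rewrite !ffunE linearP /= hu // hv // scaler0 addr0.
Qed.

Lemma deg_lt0 v : deg_lt 0 v -> v = 0.
Proof.
move=> h; apply/ffunP => l; rewrite [RHS]ffunE.
rewrite (pihomog_partitionE (leqnn (mmeasure mdeg (v l)))) big1 // => d _.
exact: h.
Qed.

Lemma deg_lt_exists v : exists k, deg_lt k v.
Proof.
exists (\max_l mmeasure mdeg (v l))%N => l e le.
have hle : (mmeasure mdeg (v l) <= e)%N by apply: leq_trans le; apply: leq_bigmax.
rewrite pihomogE big_seq_cond big1 // => m /andP[/mmeasure_mnm_lt lt /eqP me].
by move: (leq_trans (lt mdeg) hle); rewrite me ltnn.
Qed.

Lemma deg_lt_actM k s v : deg_lt k v -> deg_lt k (actM s v).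
Proof.
move=> hv l e le; rewrite ffunE raddf_sum big1 // => j _ /=.
by rewrite linearZ /= hv // scaler0.
Qed.

Definition top (k : nat) (v : vec) : vec := [ffun l => pihomog mdeg k (v l)].

Lemma top_lin k : lin (top k : vec -> vec).
Proof. by move=> c u v; apply/ffunP => l; rewrite !ffunE linearP. Qed.

Lemma top_mulX k s v : top k.+1 (mulX s v) = mulX s (top k v).
Proof.
apply/ffunP => l; rewrite !ffunE (pihomogM k.+1 _ (e := 1)) ?subSS ?subn0 //.
by rewrite dhomogX /= mdeg1.
Qed.

Lemma top_eq0 k v : deg_lt k v -> top k v = 0.
Proof. by move=> h; apply/ffunP => l; rewrite !ffunE h. Qed.

Lemma deg_lt_sub_top k v : deg_lt k.+1 v -> deg_lt k (v - top k v).
Proof.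
move=> hv l e; rewrite leq_eqVlt => /predU1P[<-|lt].
  by rewrite !ffunE raddfB /= pihomog_id subrr.
by rewrite !ffunE raddfB /= hv // (pihomog_ne0 _ (pihomogP _ k _)) ?subr0 // neq_ltn lt.
Qed.

Lemma deg_lt_derX_top k s v : deg_lt k (derX s (top k v)).
Proof.
move=> l e le; rewrite !ffunE; have h := pihomogP mdeg k (v l).
case: k h le => [|k] h le; first by rewrite mderiv_form0 // pihomog0.
by apply: (pihomog_ne0 (d := k)); [rewrite neq_ltn le|exact: (mderiv_form s h)].
Qed.

Local Notation cochains := (cochain n vec).

Lemma koszul_opX (f : cochains) : koszul opX f = koszul mulX f - koszul actM f.
Proof.
apply/ffunP => T; rewrite !ffunE -sumrB; apply: eq_bigr => s _.
by rewrite -scalerBr.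
Qed.

(* On the top polynomial degree, opX is multiplication by x_s, for which the
   derivations give a contracting homotopy by Euler's formula in characteristic 0. *)
Lemma koszul_reduce_degree k i (f : cochains) : (0 < k + i)%N ->
  koszul opX f = 0 -> supp_card i f -> (forall T, deg_lt k.+1 (f T)) ->
  exists2 g, supp_card i.+1 g & forall T, deg_lt k ((f - koszul opX g) T).
Proof.
move=> ki hf fi fk.
pose t (f : cochains) : cochains := [ffun T => top k (f T)].
have tf0 : koszul mulX (t f) = 0.
  apply/ffunP => T; rewrite [RHS]ffunE.
  have : top k.+1 (koszul opX f T) = 0 by rewrite hf ffunE (lin0 (top_lin _)).
  rewrite koszul_opX !ffunE (linB (top_lin _)) !(lin_sum (top_lin _)).
  rewrite [X in _ - X]big1 ?subr0 => [|s _]; last first.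
    by rewrite (linZ (top_lin _)) top_eq0 ?scaler0 //; exact: deg_lt_actM.
  move=> h; rewrite -[RHS]h; apply: eq_bigr => s _.
  by rewrite (linZ (top_lin _)) top_mulX ffunE.
have ti : supp_card i (t f).
  by move=> T; rewrite ffunE => h; apply: fi; apply: contraNneq h => ->; rewrite (lin0 (top_lin _)).
(* k + i is the eigenvalue of the homotopy operator: Euler's formula contributes the degree k, and
   the product rule contributes 1 for each of the i elements of T. *)
pose g := (((k + i)%:R : K)^-1) *: (cokoszul derX (t f) : cochains).
have gi : supp_card i.+1 g.
  move=> T; rewrite ffunE => h; apply: (cokoszul_supp derX_lin ti).
  by apply: contraNneq h => ->; rewrite scaler0.
have E : koszul mulX g = t f.
  rewrite (linZ (koszul_lin mulX_lin)).
  have H : koszul mulX (cokoszul derX (t f)) = ((k + i)%:R : K) *: t f.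
    apply/ffunP => T.
    have := koszul_homotopy mulX_lin derX_lin (t f) T.
    rewrite tf0 (_ : cokoszul derX 0 = 0) ?addr0; last first.
      apply/ffunP => S; rewrite !ffunE big1 // => s _.
      by rewrite ffunE (lin0 (derX_lin s)) scaler0.
    move=> -> => [|s r u sr]; last first.
      apply/ffunP => l; rewrite !ffunE mderivM mderivX mnm1E (negbTE sr).
      by rewrite scale0r mul0r add0r.
    rewrite [RHS]ffunE; have [f0|f0] := eqVneq (t f T) 0.
      rewrite f0 scaler0 !big1 ?addr0 // => s _.
        by rewrite (lin0 (mulX_lin s)) (lin0 (derX_lin s)).
      by rewrite (lin0 (derX_lin s)) (lin0 (mulX_lin s)).
    rewrite -(ti T f0) natrD scalerDl.
    have D s v : derX s (mulX s v) = mulX s (derX s v) + v.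
      apply/ffunP => l; rewrite !ffunE mderivM mderivX mnm1E eqxx scale1r.
      rewrite (_ : (U_(s) - U_(s))%MM = 0%MM) ?mpolyX0 ?mul1r 1?addrC //.
      by apply/mnmP => j; rewrite mnmBE subnn mnm0E.
    under [X in _ + X]eq_bigr do rewrite D.
    rewrite big_split /= addrA; congr (_ + _); last first.
      by rewrite sumr_const scaler_nat.
    rewrite addrC; transitivity (\sum_s mulX s (derX s (t f T))).
      by rewrite [RHS](bigID (mem T)).
    rewrite ffunE; apply/ffunP => l.
    rewrite sum_ffunE !ffunE -(euler (pihomogP mdeg k (f T l))).
    by apply: eq_bigr => s _; rewrite !ffunE.
  rewrite H scalerA mulVf ?scale1r // (pcharf0P K).1 //.
  by rewrite -lt0n.
exists g => // T.
have -> : (f - koszul opX g) T = (f T - top k (f T)) + koszul actM g T.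
  by rewrite koszul_opX E !ffunE opprB addrA addrAC.
apply: (subspaceD (deg_lt_subspace k)); first exact: deg_lt_sub_top.
rewrite ffunE; apply: (subspace_sum (deg_lt_subspace k)) => s _.
apply: (subspaceZ (deg_lt_subspace k)); apply: deg_lt_actM.
rewrite !ffunE; apply: (subspaceZ (deg_lt_subspace k)).
apply: (subspace_sum (deg_lt_subspace k)) => r _.
apply: (subspaceZ (deg_lt_subspace k)); rewrite ffunE; exact: deg_lt_derX_top.
Qed.

Lemma koszul_opX_sq f : koszul opX (koszul opX f) = 0.
Proof. by apply: koszul_sq => //; [exact: opX_lin|exact: opX_comm]. Qed.

(** The degree can be lowered as long as the eigenvalue is nonzero: to nothing for i > 0, but for i
    = 0 only to the constants. *)
Lemma koszul_reduce k0 i (f : cochains) : (0 < k0 + i)%N ->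
  koszul opX f = 0 -> supp_card i f ->
  exists2 g, supp_card i.+1 g & forall T, deg_lt k0 ((f - koszul opX g) T).
Proof.
move=> ki hf fi.
have [k hk] : exists k, forall T, deg_lt k (f T).
  have /choice[k hk] : forall T, exists k, deg_lt k (f T) by move=> T; exact: deg_lt_exists.
  exists (\max_T k T)%N => T l e le; apply: (hk T); apply: leq_trans le.
  exact: leq_bigmax.
elim: k f hf fi hk => [|k ih] f hf fi hk.
  exists 0 => [T|T l e _]; first by rewrite ffunE eqxx.
  by rewrite (lin0 (koszul_lin opX_lin)) subr0 hk.
case: (leqP k0 k) => le; last first.
  exists 0 => [T|T l e h]; first by rewrite ffunE eqxx.
  by rewrite (lin0 (koszul_lin opX_lin)) subr0 hk // (leq_trans le).
have [|g gi hg] := koszul_reduce_degree _ hf fi hk; first by rewrite (leq_trans ki) // leq_add2r.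
have [||g' gi' hg'] := ih (f - koszul opX g) _ _ hg.
- by rewrite (linB (koszul_lin opX_lin)) hf koszul_opX_sq subr0.
- move=> T; apply: contraNeq => hT.
  by rewrite cochainB (supp_card_eq0 fi hT) (supp_card_eq0 (koszul_supp opX_lin gi) hT) subr0.
exists (g + g') => [T|T].
  apply: contraNeq => hT; rewrite ffunE.
  by rewrite (supp_card_eq0 gi hT) (supp_card_eq0 gi' hT) addr0.
by rewrite (linD (koszul_lin opX_lin)) opprD addrA.
Qed.

Lemma koszul_exact i (f : cochains) : koszul opX f = 0 -> supp_card i.+1 f ->
  exists2 g, supp_card i.+2 g & f = koszul opX g.
Proof.
move=> hf fi; have [//|g gi hg] := koszul_reduce (k0 := 0) _ hf fi.
exists g => //; apply/eqP; rewrite -subr_eq0; apply/eqP/ffunP => T.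
rewrite [RHS]ffunE; exact: deg_lt0 (hg T).
Qed.

(** At the bottom of the complex every element is a constant modulo boundaries, and the constants
    are a copy of A; this gives exactness at the augmentation. *)
Lemma koszul_augment (f : cochains) : supp_card 0 f ->
  exists2 g, supp_card 1 g & exists c : 'I_N -> K,
    forall l, (f - koszul opX g) finset.set0 l = (c l)%:MP.
Proof.
move=> fi; have [||g gi hg] := koszul_reduce (k0 := 1) _ _ fi => //.
  by rewrite (koszul_supp0 opX_lin).
exists g => //; exists (fun l => ((f - koszul opX g) finset.set0 l)@_0%MM) => l.
have h := hg finset.set0 l; rewrite /= in h; move: ((f - koszul opX g) finset.set0 l) h => p h.
apply/mpolyP => m; rewrite mcoeffC; case: eqP => [<-|m0]; first by rewrite mulr1.
have : pihomog mdeg (mdeg m) p = 0.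
  by apply: h; rewrite lt0n mdeg_eq0; apply/eqP => e; apply: m0.
by move/(congr1 (mcoeff m)); rewrite mcoeff_pihomog eqxx mcoeff0 mulr0.
Qed.

End KoszulExact.

(** * Betti numbers as dimensions of Koszul homology *)

Section BettiKoszul.
Variables (K : fieldType) (n : nat).
Local Notation R := {mpoly K[n]}.

Definition mulR (s : 'I_n) (p : R) : R := 'X_s * p.

Lemma mulR_lin s : lin (mulR s).
Proof. by move=> c u v; rewrite /mulR mulrDr scalerAr. Qed.

Definition chains := cochain n R.

Definition kcycle (W : R -> Prop) (i j : nat) (f : chains) : Prop :=
  [/\ supp_card i f, forall T, hform j (f T) & forall T, W (koszul mulR f T)].

(** [g] carries no condition on set sizes or degrees: taking components gives a homogeneous choice,
    as in [proj_hom_D]. *)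
Definition kboundary (W : R -> Prop) (f : chains) : Prop :=
  exists g : chains, forall T, W ((f - koszul mulR g) T).

Hypothesis hK : [pchar K] =i pred0.
Variable I : {pred R}.
Hypothesis hI : graded_artinian I.

Let gI : gideal (fun p => p \in I) := homog_ideal_gideal hI.1.
Let sI : subspace (fun p => p \in I) := gideal_subspace gI.

Lemma kcycle_subspace W i j : subspace W -> subspace (kcycle W i j).
Proof.
move=> sW; split=> [|c u v [u1 u2 u3] [v1 v2 v3]].
  split=> [T|T|T]; first by rewrite ffunE eqxx.
    by rewrite ffunE; exact: (form_subspace K n j).1.
  by rewrite (lin0 (koszul_lin mulR_lin)) ffunE; exact: sW.1.
split=> [T|T|T].
- apply: contraNeq => h; rewrite !ffunE.
  by rewrite (supp_card_eq0 u1 h) (supp_card_eq0 v1 h) scaler0 addr0.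
- by rewrite cochain_lin; apply: (form_subspace K n j).2.
- by rewrite (koszul_lin mulR_lin) cochain_lin; exact: sW.2.
Qed.

Lemma kboundary_subspace W : subspace W -> subspace (kboundary W).
Proof.
move=> sW; split=> [|c u v [g hg] [g' hg']].
  by exists 0 => T; rewrite (lin0 (koszul_lin mulR_lin)) subr0 ffunE; exact: sW.1.
exists (c *: g + g') => T.
rewrite (koszul_lin mulR_lin) opprD addrACA -scalerBr cochain_lin.
exact: sW.2.
Qed.

Section ExplicitResolution.
Variables (N : nat) (b : 'I_N -> R) (dg : 'I_N -> nat) (Mat : 'I_n -> 'M[K]_N).
Hypotheses (hb : forall l, hform (dg l) (b l))
  (bi : forall c : 'I_N -> K, \sum_l c l *: b l \in I -> forall l, c l = 0)
  (bs : forall p, exists c : 'I_N -> K, p - \sum_l c l *: b l \in I)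
  (bh : forall e p, hform e p -> exists2 c : 'I_N -> K,
        (forall l, c l != 0 -> dg l = e) & p - \sum_l c l *: b l \in I)
  (hMat : forall s l, 'X_s * b l - \sum_k Mat s l k *: b k \in I)
  (dMat : forall s l k, Mat s l k != 0 -> dg k = (dg l).+1).

Local Notation vec := (vec K n N).
Local Notation cochains := (cochain n vec).
Local Notation opX := (opX Mat).

(** Both products are the matrix of multiplication by x_s x_t on A in the basis [b]. *)
Lemma Mat_comm s t : Mat s *m Mat t = Mat t *m Mat s.
Proof.
have E s' t' l : 'X_t' * ('X_s' * b l) - \sum_k (Mat s' *m Mat t') l k *: b k \in I.
  apply: (subspace_trans sI (v := \sum_j Mat s' l j *: ('X_t' * b j))).
    have := gidealM gI 'X_t' (hMat s' l); rewrite mulrBr mulr_sumr.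
    by under eq_bigr do rewrite -scalerAr.
  have -> : \sum_k (Mat s' *m Mat t') l k *: b k =
     \sum_j Mat s' l j *: (\sum_k Mat t' j k *: b k).
    under [RHS]eq_bigr do rewrite scaler_sumr.
    rewrite exchange_big; apply: eq_bigr => k _ /=; rewrite mxE scaler_suml.
    by apply: eq_bigr => j _; rewrite scalerA.
  rewrite -sumrB; apply: (subspace_sum sI) => j _.
  by rewrite -scalerBr; apply: (subspaceZ sI).
apply/matrixP => l k; apply/eqP; rewrite -subr_eq0; apply/eqP.
apply: (bi (c := fun k => (Mat s *m Mat t) l k - (Mat t *m Mat s) l k)).
under eq_bigr do rewrite scalerBl.
rewrite sumrB; have := subspaceB sI (E t s l) (E s t l).
by rewrite mulrCA opprB addrC addrA subrK addrC.
Qed.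

Definition ev (v : vec) : R := \sum_l v l * b l.

Lemma ev_lin : lin ev.
Proof.
move=> c u v; rewrite /ev scaler_sumr -big_split; apply: eq_bigr => l _ /=.
by rewrite !ffunE mulrDl scalerAl.
Qed.

Lemma ev_mulX s v : ev (mulX s v) = mulR s (ev v).
Proof. by rewrite /mulR mulr_sumr; apply: eq_bigr => l _; rewrite ffunE mulrA. Qed.

Lemma ev_opX s v : ev (opX s v) \in I.
Proof.
have -> : ev (opX s v) = \sum_k v k * ('X_s * b k - \sum_l Mat s k l *: b l).
  rewrite (linB ev_lin) ev_mulX /mulR mulr_sumr.
  under [RHS]eq_bigr do rewrite mulrBr mulrCA mulr_sumr.
  rewrite sumrB; congr (_ - _); rewrite exchange_big /=; apply: eq_bigr => l _.
  by rewrite ffunE mulr_suml; apply: eq_bigr => k _; rewrite -scalerAl -scalerAr.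
by apply: (subspace_sum sI) => k _; apply: (gidealM gI).
Qed.

Definition idx (i : nat) : {set {set 'I_n} * 'I_N} :=
  [set x : {set 'I_n} * 'I_N | #|x.1| == i]%SET.

Definition bd_entry (x y : {set 'I_n} * 'I_N) : R :=
  \sum_(s | (s \notin y.1) && (s |: y.1 == x.1))
    sgn K s y.1 *: ((if x.2 == y.2 then 'X_s else 0) - (Mat s x.2 y.2)%:MP).

(** The Koszul complex of [opX] in the basis of pairs (T, l), standing for e_T (x) b_l. The sum in
    [bd_entry] has at most one term. *)
Definition expl_res : free_complex K n := @FreeComplex K n
  (fun i => #|idx i|) (fun i a => i + dg (enum_val a).2)%N
  (fun i => \matrix_(a, c) bd_entry (enum_val a) (enum_val c)).

Definition expl_aug : 'cV[R]_(rk expl_res 0) := \col_a b (enum_val a).2.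

Definition to_fun (i : nat) (w : 'rV[R]_#|idx i|) : cochains :=
  [ffun T => [ffun l => \sum_a (if enum_val a == (T, l) then w 0 a else 0)]].

Definition of_fun (i : nat) (f : cochains) : 'rV[R]_#|idx i| :=
  \row_a f (enum_val a).1 (enum_val a).2.

Lemma to_fun_val i (w : 'rV_#|idx i|) a : to_fun w (enum_val a).1 (enum_val a).2 = w 0 a.
Proof.
rewrite !ffunE -surjective_pairing (bigD1 a) //= eqxx big1 ?addr0 // => c ne.
by rewrite (inj_eq enum_val_inj) (negbTE ne).
Qed.

Lemma to_fun_supp i (w : 'rV_#|idx i|) : supp_card i (to_fun w).
Proof.
move=> T; apply: contraNeq => hT; apply/eqP/ffunP => l; rewrite !ffunE big1 // => a _.
case: eqP => // e; have := enum_valP a; rewrite e inE /= => h.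
by rewrite h in hT.
Qed.

Lemma to_funK i (w : 'rV_#|idx i|) : of_fun i (to_fun w) = w.
Proof. by apply/rowP => a; rewrite mxE to_fun_val. Qed.

Lemma of_funK i f : supp_card i f -> to_fun (of_fun i f) = f.
Proof.
move=> hf; apply/ffunP => T; apply/ffunP => l.
have [hT|hT] := eqVneq #|T| i; last first.
  by rewrite (supp_card_eq0 (@to_fun_supp i _) hT) (supp_card_eq0 hf hT).
have Tl : (T, l) \in idx i by rewrite inE hT.
have := to_fun_val (of_fun i f) (enum_rank_in Tl (T, l)).
by rewrite mxE enum_rankK_in.
Qed.

Lemma mul_expl_bd i (w : 'rV_#|idx i.+1|) :
  w *m bd expl_res i = of_fun i (koszul opX (to_fun w)).
Proof.
apply/rowP => c; rewrite !mxE; set y := enum_val c.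
pose F x := to_fun w x.1 x.2 * bd_entry x y.
transitivity (\sum_(a < #|idx i.+1|) F (enum_val a)).
  by apply: eq_bigr => a _; rewrite mxE /F to_fun_val.
rewrite -(big_enum_val F) /= big_mkcond /=.
transitivity (\sum_(x : {set 'I_n} * 'I_N) F x).
  apply: eq_bigr => x _; case: ifPn => // hx; rewrite /F.
  by rewrite (supp_card_eq0 (@to_fun_supp _ w)) ?ffunE ?mul0r //; move: hx; rewrite inE.
transitivity (\sum_(s | s \notin y.1) \sum_l to_fun w (s |: y.1) l *
    (sgn K s y.1 *: ((if l == y.2 then 'X_s else 0) - (Mat s l y.2)%:MP))).
  rewrite -(pair_bigA _ (fun T l => F (T, l))) /= /F /=.
  transitivity (\sum_T \sum_(s | (s \notin y.1) && (s |: y.1 == T)) \sum_l to_fun w T l *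
    (sgn K s y.1 *: ((if l == y.2 then 'X_s else 0) - (Mat s l y.2)%:MP))).
    apply: eq_bigr => T _; rewrite exchange_big /=; apply: eq_bigr => l _.
    by rewrite /bd_entry mulr_sumr.
  rewrite (exchange_big_dep (fun s => s \notin y.1)) /=; last by move=> T s _ /andP[].
  apply: eq_bigr => s sy; rewrite (big_pred1 (s |: y.1)) // => T /=.
  by rewrite sy eq_sym.
move: (to_fun w) => h; rewrite ffunE sum_ffunE; apply: eq_bigr => s _; rewrite !ffunE.
under eq_bigr do rewrite -scalerAr mulrBr.
rewrite -scaler_sumr sumrB; congr (_ *: (_ - _)).
  rewrite (bigD1 y.2) //= eqxx big1 ?addr0 1?mulrC // => l /negbTE ->.
  by rewrite mulr0.
by apply: eq_bigr => l _; rewrite mulrC mul_mpolyC.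
Qed.

Lemma expl_aug_ev (w : 'rV_#|idx 0|) : (w *m expl_aug) 0 0 = ev (to_fun w finset.set0).
Proof.
rewrite mxE /ev.
pose F x := to_fun w x.1 x.2 * b x.2.
transitivity (\sum_(a < #|idx 0|) F (enum_val a)).
  by apply: eq_bigr => a _; rewrite mxE /F to_fun_val.
rewrite -(big_enum_val F) /= big_mkcond /=.
transitivity (\sum_(x : {set 'I_n} * 'I_N) F x).
  apply: eq_bigr => x _; case: ifPn => // hx; rewrite /F.
  by rewrite (supp_card_eq0 (@to_fun_supp _ w)) ?ffunE ?mul0r //; move: hx; rewrite inE.
rewrite -(pair_bigA _ (fun T l => F (T, l))) /= /F /= (bigD1 finset.set0) //=.
rewrite [X in _ + X]big1 ?addr0 // => T T0; rewrite big1 // => l _.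
by rewrite (supp_card_eq0 (@to_fun_supp _ w)) ?ffunE ?mul0r // cards_eq0.
Qed.

Lemma ev_koszul f T : ev (koszul opX f T) \in I.
Proof.
rewrite ffunE (lin_sum ev_lin); apply: (subspace_sum sI) => s _.
by rewrite (linZ ev_lin); apply: (subspaceZ sI); exact: ev_opX.
Qed.

Lemma expl_resolves : resolves (F := expl_res) expl_aug I.
Proof.
have kl := koszul_lin (opX_lin Mat).
have kk := koszul_opX_sq hK Mat_comm.
split.
- move=> i a c; rewrite mxE /=; set x := enum_val a; set y := enum_val c => nz.
  (* An entry is linear when the basis index is kept and constant otherwise: [Mat] raises the
     degree, so its diagonal is zero. *)
  pose e : nat := x.2 == y.2.
  have he s : ((if x.2 == y.2 then 'X_s else 0) - (Mat s x.2 y.2)%:MP : R) \is e.-homog.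
    rewrite /e; case: eqP => [exy|_].
      rewrite (_ : Mat s x.2 y.2 = 0) ?subr0 ?dhomogX /= ?mdeg1 //.
      apply: contrapT => /eqP/dMat; rewrite exy; exact: n_Sn.
    by rewrite sub0r dhomogN -[_%:MP]mulr1 mul_mpolyC; apply: rpredZ; exact: dhomog1.
  exists e; last by apply: rpred_sum => s _; apply: rpredZ; exact: he.
  rewrite /e; case: (x.2 =P y.2) nz => [-> _|ne nz]; first by rewrite addn1 addSn.
  have [s hs] : exists s, Mat s x.2 y.2 != 0.
    apply: contrapT => h; move/eqP: nz; apply; apply: big1 => s _.
    case: (x.2 =P y.2) => // _; rewrite sub0r; case: (Mat s x.2 y.2 =P 0) => [->|/eqP h2].
      by rewrite mpolyC0 oppr0 scaler0.
    by case: h; exists s.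
  by rewrite (dMat hs) addn0 addnS addSn.
- by move=> a; rewrite mxE /= add0n; exact: hb.
- move=> p; have [c hc] := bs p.
  pose f : cochains := [ffun T => if T == finset.set0 then [ffun l => (c l)%:MP] else 0].
  have f0 : supp_card 0 f.
    by move=> T; rewrite ffunE; case: (T =P finset.set0) => [->|]; rewrite ?cards0 ?eqxx.
  exists (of_fun 0 f); rewrite expl_aug_ev of_funK // ffunE eqxx /ev.
  by move: hc; under eq_bigr do rewrite -mul_mpolyC; under [in X in _ -> X]eq_bigr do rewrite ffunE.
- move=> u; rewrite expl_aug_ev; split=> [hu|[v ->]]; last first.
    rewrite mul_expl_bd of_funK; first exact: ev_koszul.
    by apply: (koszul_supp (opX_lin Mat)); exact: to_fun_supp.
  have [g gi [c hc]] := koszul_augment hK Mat_comm (@to_fun_supp 0 u).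
  have c0 : forall l, c l = 0.
    apply: bi; have := subspaceB sI hu (ev_koszul g finset.set0).
    rewrite -(linB ev_lin) /ev.
    suff -> : \sum_l (to_fun u finset.set0 - koszul opX g finset.set0) l * b l =
      \sum_l c l *: b l by [].
    by apply: eq_bigr => l _; rewrite -mul_mpolyC -hc cochainB.
  exists (of_fun 1 g); rewrite mul_expl_bd of_funK // -[u]to_funK; congr (of_fun 0 _).
  apply/eqP; rewrite -subr_eq0; apply/eqP/ffunP => T; rewrite [RHS]ffunE.
  have [->|T0] := eqVneq T finset.set0.
    by apply/ffunP => l; rewrite hc c0 mpolyC0 ffunE.
  have hT : #|T| != 0%N by rewrite cards_eq0.
  by rewrite cochainB (supp_card_eq0 (@to_fun_supp _ u) hT)
    (supp_card_eq0 (koszul_supp (opX_lin Mat) gi) hT) subr0.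
- move=> i u; split=> [hu|[v ->]]; last first.
    rewrite !mul_expl_bd of_funK ?kk; first by apply/rowP => a; rewrite !mxE !ffunE.
    by apply: (koszul_supp (opX_lin Mat)); exact: to_fun_supp.
  have ku : koszul opX (to_fun u) = 0.
    rewrite -[LHS](@of_funK i); last by apply: (koszul_supp (opX_lin Mat)); exact: to_fun_supp.
    rewrite -mul_expl_bd hu; apply/ffunP => T; apply/ffunP => l; rewrite !ffunE big1 // => a _.
    by rewrite mxE if_same.
  have [g gi ug] := koszul_exact hK Mat_comm ku (@to_fun_supp _ u).
  by exists (of_fun i.+2 g); rewrite mul_expl_bd of_funK // -ug to_funK.
Qed.

Definition evc (f : cochains) : chains := [ffun T => ev (f T)].

Lemma evc_lin : lin (evc : cochains -> chains).
Proof. by move=> c u v; apply/ffunP => T; rewrite !ffunE ev_lin. Qed.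

Definition const_row (i : nat) (u : 'rV[K]_#|idx i|) : cochains :=
  to_fun (map_mx (@mpolyC n K) u).

(** Reads a vector over K as a Koszul chain of A, with b_l at T for the pair (T, l). It turns the
    reduced differential into minus the Koszul differential modulo I, since the constant term of x_s
    - Mat_s is - Mat_s. *)
Definition kappa (i : nat) (u : 'rV[K]_#|idx i|) : chains := evc (const_row u).

Lemma const_row_lin i c (u v : 'rV_#|idx i|) :
  const_row (c *: u + v) = c *: const_row u + const_row v.
Proof.
apply/ffunP => T; apply/ffunP => l; rewrite !ffunE scaler_sumr -big_split /=.
apply: eq_bigr => a _; rewrite !mxE; case: ifP => _; last by rewrite scaler0 addr0.
by rewrite mpolyCD mpolyCM mul_mpolyC.
Qed.

Lemma kappa_lin i : lin (@kappa i).
Proof. by move=> c u v; rewrite /kappa const_row_lin evc_lin. Qed.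

Lemma kappa_supp i (u : 'rV_#|idx i|) : supp_card i (kappa u).
Proof.
move=> T; apply: contraNeq => h; rewrite ffunE.
by rewrite (supp_card_eq0 (@to_fun_supp _ _) h) (lin0 ev_lin).
Qed.

Lemma koszul_evc f T : koszul mulR (evc f) T - evc (koszul (actM Mat) f) T \in I.
Proof.
have -> : koszul mulR (evc f) T - evc (koszul (actM Mat) f) T = ev (koszul opX f T).
  rewrite koszul_opX cochainB (linB ev_lin) [evc _ _]ffunE; congr (_ - _).
  rewrite !ffunE (lin_sum ev_lin); apply: eq_bigr => s _.
  by rewrite (linZ ev_lin) ev_mulX ffunE.
exact: ev_koszul.
Qed.

Lemma const_row_bdK i (u : 'rV_#|idx i.+1|) :
  const_row (u *m bdK expl_res i) = - koszul (actM Mat) (const_row u).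
Proof.
have e : u = map_mx (mcoeff 0%MM) (map_mx (@mpolyC n K) u).
  by apply/rowP => a; rewrite !mxE mcoeffC eqxx mulr1.
have -> : u *m bdK expl_res i = map_mx (mcoeff 0%MM) (of_fun i (koszul opX (const_row u))).
  by rewrite {1}e -map_mxM mul_expl_bd.
have cst T l : ((const_row u T l)@_0%MM)%:MP = const_row u T l.
  rewrite !ffunE raddf_sum raddf_sum; apply: eq_bigr => a _ /=.
  case: ifP => _; last by rewrite mcoeff0 mpolyC0.
  by rewrite mxE mcoeffC eqxx mulr1.
rewrite koszul_opX; apply/ffunP => T; apply/ffunP => l.
have [hT|hT] := eqVneq #|T| i; last first.
  rewrite (supp_card_eq0 (@to_fun_supp _ _) hT) cochainN.
  have h := koszul_supp (actM_lin Mat) (@to_fun_supp _ (map_mx (@mpolyC n K) u)).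
  by rewrite (supp_card_eq0 h hT) oppr0.
have Tl : (T, l) \in idx i by rewrite inE hT.
have := to_fun_val (map_mx (@mpolyC n K) (map_mx (mcoeff 0%MM)
  (of_fun i (koszul (mulX (N:=N)) (const_row u) - koszul (actM Mat) (const_row u)))))
  (enum_rank_in Tl (T, l)).
rewrite /= enum_rankK_in //= => ->; rewrite !mxE enum_rankK_in //= cochainB.
pose cc (p : R) : R := (p@_0%MM)%:MP.
have ccl : lin cc by move=> c p q; rewrite /cc linearP /= mpolyCD mpolyCM mul_mpolyC.
have vB (v w : vec) k : (v - w) k = v k - w k by rewrite !ffunE.
have vN (v : vec) k : (- v) k = - v k by rewrite !ffunE.
rewrite -/(cc _) vB (linB ccl) cochainN vN.
rewrite [X in X - _](_ : _ = 0) ?sub0r; last first.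
  rewrite ffunE sum_ffunE (lin_sum ccl) big1 // => s _.
  by rewrite ffunE (linZ ccl) ffunE /cc rmorphM /= mcoeffX mnm1_eq0 mul0r mpolyC0 scaler0.
congr (- _); rewrite ffunE sum_ffunE (lin_sum ccl); apply: eq_bigr => s _.
rewrite ffunE (linZ ccl) [in LHS]ffunE [in RHS]ffunE [in RHS]ffunE (lin_sum ccl).
congr (_ *: _); apply: eq_bigr => k _; rewrite (linZ ccl) /cc cst.
by rewrite /const_row [to_fun _ _]ffunE.
Qed.

Lemma kappa_bdK i (u : 'rV_#|idx i.+1|) T :
  kappa (u *m bdK expl_res i) T + koszul mulR (kappa u) T \in I.
Proof.
have -> : kappa (u *m bdK expl_res i) = - evc (koszul (actM Mat) (const_row u)).
  by rewrite /kappa const_row_bdK (linN evc_lin).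
by rewrite cochainN addrC; exact: koszul_evc.
Qed.

Lemma kappaE i (u : 'rV_#|idx i|) (c : {set 'I_n} -> 'I_N -> K) (T : {set 'I_n}) :
  (forall a, u 0 a = c (enum_val a).1 (enum_val a).2) -> #|T| = i ->
  kappa u T = \sum_l c T l *: b l.
Proof.
move=> hu hT; rewrite ffunE; apply: eq_bigr => l _.
have Tl : (T, l) \in idx i by rewrite inE hT.
have := to_fun_val (map_mx (@mpolyC n K) u) (enum_rank_in Tl (T, l)).
by rewrite /const_row enum_rankK_in //= => ->; rewrite mxE hu enum_rankK_in //= mul_mpolyC.
Qed.

Lemma kappa_eq0 i (u : 'rV_#|idx i|) : (forall T, kappa u T \in I) -> u = 0.
Proof.
move=> h; apply/rowP => a; rewrite mxE; set x := enum_val a.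
have Tx : #|x.1| = i by have := enum_valP a; rewrite inE => /eqP.
pose c (T : {set 'I_n}) l : K := (const_row u T l)@_0%MM.
have hu a' : u 0 a' = c (enum_val a').1 (enum_val a').2.
  by rewrite /c /const_row to_fun_val mxE mcoeffC eqxx mulr1.
have := h x.1; rewrite (kappaE hu Tx) => /bi/(_ x.2) <-; exact: hu.
Qed.

Lemma approx (g : chains) i : exists v : 'rV[K]_#|idx i|,
  forall T : {set 'I_n}, #|T| = i -> g T - kappa v T \in I.
Proof.
have /choice[c hc] : forall T : {set 'I_n}, exists c : 'I_N -> K, g T - \sum_l c l *: b l \in I.
  by move=> T; apply: bs.
exists (\row_a c (enum_val a).1 (enum_val a).2) => T hT.
by rewrite (kappaE (c := c)) // => a; rewrite mxE.
Qed.

(** [kappa] induces an isomorphism on homology: the [b] are independent modulo I ([kappa_eq0]), and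
    every form is modulo I a combination of those of its own degree. *)
Lemma expl_tor i j r :
  qdim (fun u : 'rV[K]_#|idx i| => u *m deg_part expl_res i (i + j) = u /\
           (u <= kerK expl_res i)%MS)
       (fun u => exists v, u = v *m bdK expl_res i) r <->
  qdim (kcycle (fun p => p \in I) i j) (kboundary (fun p => p \in I)) r.
Proof.
have kl := koszul_lin mulR_lin.
have degE (u : 'rV[K]_#|idx i|) : u *m deg_part expl_res i (i + j) = u <->
    forall a, u 0 a != 0 -> dg (enum_val a).2 = j.
  split=> [h a|h]; last apply/rowP => a; rewrite ?mul_mx_diag ?mxE /=.
    rewrite -h mul_mx_diag !mxE /= eqn_add2l; case: (dg _ =P j) => // _.
    by rewrite mulr0 eqxx.
  rewrite eqn_add2l; have [->|/h ->] := eqVneq (u 0 a) 0; first by rewrite mul0r.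
  by rewrite eqxx mulr1.
have subP : subspace (fun u : 'rV[K]_#|idx i| =>
    u *m deg_part expl_res i (i + j) = u /\ (u <= kerK expl_res i)%MS).
  split=> [|x u v [hu ku] [hv kv]]; first by rewrite mul0mx sub0mx.
  by rewrite mulmxDl -scalemxAl hu hv addmx_sub ?scalemx_sub.
have kerP (u : 'rV[K]_#|idx i|) : (u <= kerK expl_res i)%MS <->
    forall T, koszul mulR (kappa u) T \in I.
  case: (i) u => [|i'] u; split=> /=.
  - move=> _ T; rewrite (koszul_supp0 mulR_lin) ?ffunE; first exact: sI.1.
    exact: kappa_supp.
  - by move=> _; exact: submx1.
  - move=> /sub_kermxP h T; have := kappa_bdK u T; rewrite [X in kappa X]h (lin0 (@kappa_lin i')) ffunE add0r.
    by [].
  - move=> h; apply/sub_kermxP; apply: kappa_eq0 => T.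
    by have := subspaceB sI (kappa_bdK u T) (h T); rewrite addrK.
apply: (qdim_iso (@kappa_lin i) subP (kboundary_subspace sI)).
- move=> u [/degE hu /kerP ku]; split=> //; first exact: kappa_supp.
  move=> T; rewrite ffunE; apply: (subspace_sum (form_subspace K n j)) => l _.
  rewrite !ffunE mulr_suml; apply: (subspace_sum (form_subspace K n j)) => a _.
  case: eqP => [e|_]; last by rewrite mul0r; exact: (form_subspace K n j).1.
  rewrite mxE mul_mpolyC; have [->|/hu <-] := eqVneq (u 0 a) 0.
    by rewrite scale0r; exact: (form_subspace K n j).1.
  by apply: (subspaceZ (form_subspace _ _ _)); rewrite e; exact: hb.
- move=> u [/degE hu /kerP ku]; split=> [[v ->]|[g hg]].
    exists (- kappa v) => T; rewrite (linN kl) opprK.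
    by have := kappa_bdK v T; rewrite cochainD.
  (* The coefficients of [g] are arbitrary polynomials; in homological degree i + 1 they are
     replaced, modulo I, by a vector over K. *)
  have [v hv] := approx g i.+1; exists (- v).
  apply/eqP; rewrite mulNmx -subr_eq0 opprK; apply/eqP; apply: kappa_eq0 => T.
  rewrite (linD (@kappa_lin i)) cochainD.
  have [hT|hT] := eqVneq #|T| i; last first.
    by rewrite !(supp_card_eq0 (@kappa_supp _ _) hT) addr0; exact: sI.1.
  have h1 := hg T; rewrite cochainB in h1.
  have h2 := kappa_bdK v T.
  have h3 : koszul mulR g T - koszul mulR (kappa v) T \in I.
    rewrite -cochainB -(linB kl) ffunE; apply: (subspace_sum sI) => s sT.
    apply: (subspaceZ sI); apply: (gidealM gI); rewrite cochainB; apply: hv.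
    by rewrite cardsU1 sT hT.
  have := subspaceD sI h1 (subspaceD sI h3 h2).
  suff E (x y z w : R) : (x - y) + ((y - z) + (w + z)) = x + w by rewrite E.
  by rewrite [w + z]addrC [(y - z) + _]addrA subrK addrA subrK.
- move=> f [f1 f2 f3].
  have /choice[c hc] : forall T : {set 'I_n}, exists c : 'I_N -> K,
      (forall l, c l != 0 -> dg l = j) /\ f T - \sum_l c l *: b l \in I.
    by move=> T; have [c h1 h2] := bh (f2 T); exists c.
  pose u : 'rV[K]_#|idx i| := \row_a c (enum_val a).1 (enum_val a).2.
  have fu T : f T - kappa u T \in I.
    have [hT|hT] := eqVneq #|T| i; last first.
      by rewrite (supp_card_eq0 f1 hT) (supp_card_eq0 (@kappa_supp _ _) hT) subr0; exact: sI.1.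
    rewrite (kappaE (c := c)) //; first by have [] := hc T.
    by move=> a; rewrite mxE.
  exists u; last by exists 0 => T; rewrite (lin0 kl) subr0 cochainB.
  split; first by apply/degE => a; rewrite mxE; have [h _] := hc (enum_val a).1; exact: h.
  apply/kerP => T; have := f3 T; rewrite -[f](subrK (kappa u)) (linD kl) cochainD => h.
  rewrite -[X in X \in I](addKr (koszul mulR (f - kappa u) T)) addrC.
  apply: (subspaceB sI) => //; rewrite ffunE; apply: (subspace_sum sI) => s _.
  by apply: (subspaceZ sI); apply: (gidealM gI); rewrite cochainB; exact: fu.
Qed.

End ExplicitResolution.

Lemma explicit_resolution : exists (N : nat) (b : 'I_N -> R) (dg : 'I_N -> nat)
    (Mat : 'I_n -> 'M[K]_N), resolves (F := expl_res dg Mat) (expl_aug b dg Mat) I /\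
  forall i j r, qdim (fun u : 'rV[K]_#|idx N i| => u *m deg_part (expl_res dg Mat) i (i + j) = u /\
           (u <= kerK (expl_res dg Mat) i)%MS)
       (fun u => exists v, u = v *m bdK (expl_res dg Mat) i) r ->
  qdim (kcycle (fun p => p \in I) i j) (kboundary (fun p => p \in I)) r.
Proof.
have [N [b [dg [hb bi bs bh]]]] := artinian_basis hI.
have /choice[M0 hM0] : forall sl : 'I_n * 'I_N, exists c : 'I_N -> K,
    (forall k, c k != 0 -> dg k = (dg sl.2).+1) /\ 'X_(sl.1) * b sl.2 - \sum_k c k *: b k \in I.
  move=> [s l]; have [|c h1 h2] := bh (dg l).+1 ('X_s * b l); last by exists c.
  by rewrite -add1n; apply: dhomogM; [rewrite dhomogX /= mdeg1|exact: hb].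
pose Mat s : 'M[K]_N := \matrix_(l, k) M0 (s, l) k.
have hMat s l : 'X_s * b l - \sum_k Mat s l k *: b k \in I.
  have [_ h] := hM0 (s, l); under eq_bigr do rewrite mxE; exact: h.
have dMat s l k : Mat s l k != 0 -> dg k = (dg l).+1.
  by rewrite mxE; have [h _] := hM0 (s, l); exact: h.
exists N, b, dg, Mat; split; first exact: (expl_resolves hb bi bs hMat dMat).
by move=> i j r /(expl_tor hb bi bs bh hMat).
Qed.

Lemma resolution_exists : exists (F : free_complex K n) (aug : 'cV_(rk F 0)), resolves aug I.
Proof.
have [N [b [dg [Mat [h _]]]]] := explicit_resolution.
by exists (expl_res dg Mat), (expl_aug b dg Mat).
Qed.

Theorem betti_koszul i j :
  qdim (kcycle (fun p => p \in I) i j) (kboundary (fun p => p \in I)) (betti I i (i + j)).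
Proof.
have [N [b [dg [Mat [h]]]]] := explicit_resolution; apply.
by rewrite (bettiE hI.1 _ _ h); exact: (tor_dimP h).
Qed.

End BettiKoszul.

(** * Koszul homology modulo the last variables *)

Section Recursion.
Variables (K : fieldType) (n : nat).
Local Notation R := {mpoly K[n]}.
Local Notation chains := (chains K n).
Local Notation D := (koszul (@mulR K n)).
Hypothesis hK : [pchar K] =i pred0.

Let kl := koszul_lin (@mulR_lin K n).

(** These chains form the Koszul complex on the first m variables while the coefficients stay in
    R. *)
Definition supp_in (m : nat) (f : chains) : Prop :=
  forall T, f T != 0 -> forall s : 'I_n, s \in T -> (s < m)%N.

Definition kcycle_in m (W : R -> Prop) i j (f : chains) : Prop :=
  kcycle W i j f /\ supp_in m f.

Definition kboundary_in m (W : R -> Prop) (f : chains) : Prop :=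
  exists2 g, supp_in m g & forall T, W ((f - D g) T).

Lemma supp_in_eq0 m f (T : {set 'I_n}) s : supp_in m f -> s \in T -> (m <= s)%N -> f T = 0.
Proof. by move=> h sT; rewrite leqNgt; apply: contraNeq => /h; apply. Qed.

Lemma supp_in_lin m c f g : supp_in m f -> supp_in m g -> supp_in m (c *: f + g).
Proof.
move=> hf hg T h s sT; rewrite ltnNge; apply: contraNN h => le.
by rewrite cochain_lin (supp_in_eq0 hf sT le) (supp_in_eq0 hg sT le) scaler0 addr0.
Qed.

Lemma supp_in0 m : supp_in m 0.
Proof. by move=> T; rewrite ffunE eqxx. Qed.

Lemma supp_in_D m f : supp_in m f -> supp_in m (D f).
Proof.
move=> hf T h s sT; rewrite ltnNge; apply: contraNN h => le.
rewrite ffunE big1 // => r rT; rewrite (supp_in_eq0 hf _ le) ?inE ?sT ?orbT //.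
by rewrite (lin0 (mulR_lin _)) scaler0.
Qed.

Lemma supp_inW m f : supp_in m f -> supp_in m.+1 f.
Proof. by move=> h T fT s sT; exact: leqW (h T fT s sT). Qed.

Lemma kcycle_in_subspace m W i j : subspace W -> subspace (kcycle_in m W i j).
Proof.
move=> sW; apply: subspaceI; first exact: kcycle_subspace.
by split=> [|c u v]; [exact: supp_in0|exact: supp_in_lin].
Qed.

Lemma kboundary_in_subspace m W : subspace W -> subspace (kboundary_in m W).
Proof.
move=> sW; split=> [|c u v [g g1 g2] [h h1 h2]].
  by exists 0; [exact: supp_in0|move=> T; rewrite (lin0 kl) subr0 ffunE; exact: sW.1].
exists (c *: g + h); first exact: supp_in_lin.
move=> T; rewrite kl opprD addrACA -scalerBr cochain_lin; exact: sW.2.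
Qed.

Lemma DD f : D (D f) = 0.
Proof.
apply: (koszul_sq (@mulR_lin K n) hK) => s t u; rewrite /mulR mulrCA //.
Qed.

Definition proj_hom (i j : nat) (f : chains) : chains :=
  [ffun T : {set 'I_n} => if #|T| == i then pihomog mdeg j (f T) else 0].

(** D removes one element from the sets and raises the coefficient degree by one, so the component
    (i, j) of D g is D of the component (i + 1, j - 1); for j = 0 it vanishes. *)
Lemma proj_hom_D i j g m : supp_in m g ->
  exists2 g', supp_in m g' & proj_hom i j (D g) = D g'.
Proof.
move=> hg; exists (if j is j'.+1 then proj_hom i.+1 j' g else 0).
  case: j => [|j]; first exact: supp_in0.
  move=> T h s; apply: hg; apply: contraNneq h => h; rewrite ffunE h.
  by rewrite pihomog0 if_same.
have hX (s : 'I_n) : ('X_s : R) \is 1.-homog by rewrite dhomogX /= mdeg1.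
apply/ffunP => T; case: j => [|j]; rewrite ffunE.
  rewrite (lin0 kl) [RHS]ffunE; case: ifP => // _; rewrite ffunE raddf_sum big1 // => s _ /=.
  by rewrite linearZ /= (pihomogM _ _ (hX s)) scaler0.
rewrite [RHS]ffunE; case: ifPn => hT; last first.
  rewrite big1 // => s sT; rewrite ffunE cardsU1 sT add1n eqSS (negbTE hT).
  by rewrite (lin0 (mulR_lin _)) scaler0.
rewrite ffunE raddf_sum; apply: eq_bigr => s sT /=.
rewrite linearZ /= (pihomogM _ _ (hX s)) /= subSS subn0 ffunE.
by rewrite cardsU1 sT add1n eqSS hT.
Qed.

Variable x : 'I_n.
Local Notation m := (x : nat).

(* A chain in the first m + 1 variables is part0 f plus x_m wedge part1 f. *)
Definition part0 (f : chains) : chains := [ffun T : {set 'I_n} => if x \in T then 0 else f T].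
Definition part1 (f : chains) : chains :=
  [ffun T : {set 'I_n} => if x \in T then 0 else f (x |: T)].
Definition wedge (f : chains) : chains :=
  [ffun T : {set 'I_n} => if x \in T then f (T :\ x) else 0].
(** The sign of moving e_x past the smaller indices of T; it makes D anticommute with [twist]
    ([D_twist]). *)
Definition twist (f : chains) : chains := [ffun T : {set 'I_n} => sgn K x T *: f T].

Lemma part0_lin : lin part0.
Proof.
by move=> c u v; apply/ffunP => T; rewrite !ffunE; case: ifP; rewrite ?scaler0 ?addr0.
Qed.

Lemma part1_lin : lin part1.
Proof.
by move=> c u v; apply/ffunP => T; rewrite !ffunE; case: ifP; rewrite ?scaler0 ?addr0.
Qed.

Lemma wedge_lin : lin wedge.
Proof.
by move=> c u v; apply/ffunP => T; rewrite !ffunE; case: ifP; rewrite ?scaler0 ?addr0.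
Qed.

Lemma twist_lin : lin twist.
Proof.
by move=> c u v; apply/ffunP => T; rewrite !ffunE scalerDr !scalerA mulrC.
Qed.

Lemma supp_part0 f : supp_in m.+1 f -> supp_in m (part0 f).
Proof.
move=> hf T; rewrite ffunE; case: ifPn => [_|xT fT s sT]; first by rewrite eqxx.
have := hf T fT s sT; rewrite ltnS leq_eqVlt => /predU1P[/val_inj e|//].
by rewrite -e sT in xT.
Qed.

Lemma supp_part1 f : supp_in m.+1 f -> supp_in m (part1 f).
Proof.
move=> hf T; rewrite ffunE; case: ifPn => [_|xT fT s sT]; first by rewrite eqxx.
have := hf (x |: T) fT s; rewrite inE sT orbT ltnS leq_eqVlt => /(_ isT)/predU1P[/val_inj e|//].
by rewrite -e sT in xT.
Qed.

Lemma supp_in_x f (T : {set 'I_n}) : supp_in m f -> x \in T -> f T = 0.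
Proof. by move=> h xT; exact: (supp_in_eq0 h xT). Qed.

Lemma supp_wedge f : supp_in m f -> supp_in m.+1 (wedge f).
Proof.
move=> hf T; rewrite ffunE; case: ifPn => [_ fT s sT|]; last by rewrite eqxx.
have [->|sx] := eqVneq s x; first exact: ltnSn.
by apply: leqW; apply: (hf _ fT); rewrite !inE sx.
Qed.

Lemma supp_twist f : supp_in m f -> supp_in m (twist f).
Proof.
move=> hf T h; apply: hf; apply: contraNneq h; rewrite ffunE => ->.
by rewrite scaler0.
Qed.

Lemma D_part0 f (T : {set 'I_n}) : x \notin T ->
  D f T = D (part0 f) T + 'X_x * twist (part1 f) T.
Proof.
move=> xT; rewrite !ffunE (negbTE xT) (bigD1 x) //= addrC; congr (_ + _).
  rewrite [RHS](bigD1 x) //= ffunE setU11 (lin0 (mulR_lin _)) scaler0 add0r.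
  apply: eq_bigr => s /andP[sT sx].
  by rewrite ffunE !inE eq_sym (negbTE sx) (negbTE xT).
by rewrite /mulR scalerAr.
Qed.

Lemma D_part1 f (T : {set 'I_n}) : supp_in m.+1 f -> x \notin T ->
  D f (x |: T) = D (part1 f) T.
Proof.
move=> hf xT; rewrite !ffunE [RHS](bigD1 x) //= ffunE setU11 (lin0 (mulR_lin _)) scaler0 add0r.
apply: eq_big => [s|s]; first by rewrite !inE negb_or andbC.
rewrite !inE negb_or => /andP[sx sT].
rewrite ffunE !inE eq_sym (negbTE sx) (negbTE xT) /= finset.setUCA.
have [lt|le] := ltnP s m; last first.
  rewrite (supp_in_eq0 (s := s) hf) ?(lin0 (mulR_lin _)) ?scaler0 //.
    by rewrite !inE eqxx ?orbT.
  by rewrite ltn_neqAle le andbT eq_sym.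
by rewrite (sgnU K _ xT) (ltnNge x) (ltnW lt) expr0 mul1r.
Qed.

Lemma D_twist f : supp_in m f -> D (twist f) = - twist (D f).
Proof.
move=> hf; apply/ffunP => T; rewrite !ffunE scaler_sumr -sumrN.
apply: eq_bigr => s sT; rewrite ffunE.
have [lt|le] := ltnP s m; last first.
  by rewrite (supp_in_eq0 (s := s) hf) ?setU11 // scaler0 !(lin0 (mulR_lin _)) !scaler0 oppr0.
by rewrite (linZ (mulR_lin _)) !scalerA (sgnU K _ sT) lt expr1 mulN1r mulrN scaleNr mulrC.
Qed.

Lemma D_mulx (f : chains) T : D [ffun S => 'X_x * f S] T = 'X_x * D f T.
Proof.
rewrite !ffunE mulr_sumr; apply: eq_bigr => s _.
by rewrite ffunE /mulR mulrCA scalerAr.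
Qed.

Lemma twist_twist f : twist (twist f) = f.
Proof. by apply/ffunP => T; rewrite !ffunE scalerA (sgn_sq K) scale1r. Qed.

Lemma part0_wedge f : part0 (wedge f) = 0.
Proof. by apply/ffunP => T; rewrite !ffunE; case: (x \in T). Qed.

Lemma part0_id f : supp_in m f -> part0 f = f.
Proof. by move=> hf; apply/ffunP => T; rewrite ffunE; case: ifP => // /(supp_in_x hf). Qed.

Lemma part1_wedge f : supp_in m f -> part1 (wedge f) = f.
Proof.
move=> hf; apply/ffunP => T; rewrite !ffunE.
case: ifPn => xT; first by rewrite (supp_in_x hf xT).
by rewrite setU11 finset.setU1K.
Qed.

Lemma part1_id f : supp_in m f -> part1 f = 0.
Proof.
by move=> hf; apply/ffunP => T; rewrite !ffunE; case: ifP => // _; rewrite (supp_in_x hf) ?setU11.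
Qed.

Lemma chain_cases (P : {set 'I_n} -> Prop) :
  (forall T : {set 'I_n}, x \notin T -> P T) ->
  (forall T : {set 'I_n}, x \notin T -> P (x |: T)) -> forall T, P T.
Proof.
move=> h0 h1 T; case: (boolP (x \in T)) => xT; last exact: h0.
by rewrite -(finset.setD1K xT); apply: h1; rewrite !inE eqxx.
Qed.

(* The coefficients of the part of the homology coming from (0 : x_m). *)
Definition colon_chain (W : R -> Prop) i j (f : chains) : Prop :=
  (forall T, hform j (f T) /\ W ('X_x * f T)) /\
  (forall T : {set 'I_n}, T \notin [set S : {set 'I_n} | (S \subset [set s : 'I_n | (s < m)%N]) &&
                        (#|S|.+1 == i)]%SET -> f T = 0).

Lemma card_colon_supp i :
  #|[set S : {set 'I_n} | (S \subset [set s : 'I_n | (s < m)%N]) && (#|S|.+1 == i)]%SET|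
  = bin_pred m i.
Proof.
case: i => [|i].
  by apply/eqP; rewrite cards_eq0; apply/eqP/setP => S; rewrite !inE andbF.
have c : #|[set s : 'I_n | (s < m)%N]| = m.
  rewrite -sum1dep_card (big_ord_narrow (ltnW (ltn_ord x))) /=.
  by rewrite sum1_card card_ord.
rewrite /bin_pred -{2}c -cards_draws; apply: eq_card => S.
by rewrite !inE eqSS.
Qed.

Lemma qdim_colon_chain (W : R -> Prop) i j nu : subspace W ->
  qdim (fun q => hform j q /\ W ('X_x * q)) W nu ->
  qdim (colon_chain W i j) (fun f => forall T, W (f T)) (bin_pred m i * nu).
Proof.
move=> sW q; rewrite -card_colon_supp; apply: (qdim_cochain _ _ sW q).
apply: subspaceI; first exact: form_subspace.
by apply: (subspace_preim (f := fun p => 'X_x * p)) => // c u v; rewrite mulrDr scalerAr.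
Qed.

Lemma colon_chain_subspace (W : R -> Prop) i j : subspace W -> subspace (colon_chain W i j).
Proof.
move=> sW; split.
  split=> T; rewrite ffunE //; split; first exact: (form_subspace K n j).1.
  by rewrite mulr0; exact: sW.1.
move=> c u v [u1 u2] [v1 v2]; split=> [T|T hT]; last first.
  by rewrite cochain_lin u2 // v2 // scaler0 addr0.
have [[uf uW] [vf vW]] := (u1 T, v1 T); rewrite cochain_lin; split.
  exact: (form_subspace K n j).2.
by rewrite mulrDr -scalerAr; exact: sW.2.
Qed.

Lemma colon_chain_supp W i j f : colon_chain W i j f -> supp_in m f.
Proof.
move=> [_ h] T fT s sT; case: (boolP (T \in [set S : {set 'I_n} | (S \subset [set s : 'I_n | (s < m)%N]) &&
                        (#|S|.+1 == i)]%SET)) => [|/h e]; last by rewrite e eqxx in fT.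
by rewrite inE => /andP[/fintype.subsetP/(_ s sT)]; rewrite inE.
Qed.

Lemma kcycle_part0 (W : R -> Prop) i j f : gideal W ->
  kcycle_in m.+1 W i j f -> kcycle_in m (plus W 'X_x) i j (part0 f).
Proof.
move=> gW [[f1 f2 f3] fs]; have sW := gideal_subspace gW.
split; last exact: supp_part0.
split=> [T|T|T].
- by rewrite ffunE; case: ifP => _; [rewrite eqxx|exact: f1].
- by rewrite ffunE; case: ifP => _; [exact: (form_subspace K n j).1|exact: f2].
- case: (boolP (x \in T)) => xT.
    rewrite (supp_in_x (supp_in_D (supp_part0 fs)) xT).
    by apply: plus_sub; exact: sW.1.
  exists (- twist (part1 f) T); rewrite mulrN opprK -D_part0 //.
Qed.

(** If part0 f = D a + x_m c modulo W, then subtracting D (a + wedge (twist c)) from f leaves wedge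
    b0 with b0 = part1 f + twist (D c), and the cycle condition puts the coefficients of b0 into (W
    : x_m). *)
Lemma ker_part0 (W : R -> Prop) i j f : gideal W -> kcycle_in m.+1 W i j f ->
  kboundary_in m (plus W 'X_x) (part0 f) ->
  exists2 b, colon_chain W i j b & kboundary_in m.+1 W (f - wedge b).
Proof.
move=> gW [[f1 f2 f3] fs] [a as_ ha]; have sW := gideal_subspace gW.
have /choice[c0 hc0] : forall T, exists c, W ((part0 f - D a) T - 'X_x * c) by [].
pose A := [set s : 'I_n | (s < m)%N].
(* The cofactors were chosen set by set. On sets that leave the first m variables the left side
   vanishes, so there they can be taken to be 0. *)
pose c : chains := [ffun T : {set 'I_n} => if T \subset A then c0 T else 0].
have cs : supp_in m c.
  move=> T; rewrite ffunE; case: ifP => [/fintype.subsetP h _ s /h|]; first by rewrite inE.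
  by rewrite eqxx.
have ps := supp_part0 fs; have qs := supp_part1 fs.
have hc T : W ((part0 f - D a) T - 'X_x * c T).
  rewrite [c T]ffunE; case: ifPn => [_|/fintype.subsetPn[s sT sA]]; first exact: hc0.
  have le : (m <= s)%N by rewrite inE -leqNgt in sA.
  rewrite cochainB (supp_in_eq0 ps sT le) (supp_in_eq0 (supp_in_D as_) sT le).
  by rewrite mulr0 !subr0; exact: sW.1.
pose b0 := part1 f + twist (D c).
have bs : supp_in m b0.
  rewrite /b0 -[part1 f]scale1r; apply: supp_in_lin => //.
  exact: supp_twist (supp_in_D cs).
have hb0 (T : {set 'I_n}) : x \notin T -> W ('X_x * b0 T).
  move=> xT; suff : W ('X_x * twist b0 T).
    rewrite ffunE -scalerAr => /(subspaceZ sW (sgn K x T)).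
    by rewrite scalerA (sgn_sq K) scale1r.
  have : W (D f T - (D (part0 f) T - 'X_x * D c T)).
    apply: (subspaceB sW); first exact: f3.
    rewrite -D_mulx -cochainB -(linB kl) -[part0 f](subrK (D a)) addrAC (linD kl).
    rewrite DD addr0 ffunE; apply: (subspace_sum sW) => s _; apply: (subspaceZ sW).
    apply: (gidealM gW); rewrite cochainB [X in _ - X]ffunE.
    by have := hc (s |: T).
  rewrite D_part0 // opprB addrC addrA subrK /b0 (linD twist_lin) twist_twist cochainD mulrDr.
  by rewrite addrC.
(* Only the component with #|T| = i - 1 and degree j is kept; [proj_hom_D] cuts the boundary down to
   match. *)
pose b : chains := [ffun T : {set 'I_n} => if (#|T|.+1 == i) && (x \notin T) then pihomog mdeg j (b0 T) else 0].
exists b.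
  split=> T.
    split; first by rewrite ffunE; case: ifP => _; [exact: pihomogP|exact: (form_subspace K n j).1].
    rewrite ffunE; case: ifP => [/andP[_ xT]|_]; last by rewrite mulr0; exact: sW.1.
    have := gideal_pihomog gW j.+1 (hb0 T xT).
    by rewrite (pihomogM _ _ (e := 1)) ?subSS ?subn0 // dhomogX /= mdeg1.
  rewrite inE negb_and ffunE => /orP[/fintype.subsetPn[s sT sA]|/negbTE ->] //.
  have le : (m <= s)%N by rewrite inE -leqNgt in sA.
  by rewrite (supp_in_eq0 bs sT le) pihomog0 if_same.
pose g := a + wedge (twist c).
have gs : supp_in m.+1 g.
  rewrite /g -[a]scale1r; apply: supp_in_lin; first exact: supp_inW.
  exact: supp_wedge (supp_twist cs).
have hg T : W ((f - D g - wedge b0) T).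
  move: T; apply: chain_cases => T xT.
    rewrite !cochainB [wedge b0 T]ffunE (negbTE xT) subr0 D_part0 //.
    rewrite (linD part0_lin) part0_wedge addr0 (part0_id as_).
    rewrite (linD part1_lin) (part1_id as_) add0r part1_wedge ?twist_twist; last exact: supp_twist.
    by have := hc T; rewrite cochainB [part0 f T]ffunE (negbTE xT) opprD addrA.
  rewrite !cochainB [wedge b0 _]ffunE setU11 finset.setU1K // D_part1 //.
  rewrite (linD part1_lin) (part1_id as_) add0r part1_wedge; last exact: supp_twist.
  rewrite D_twist // /b0 cochainD cochainN [part1 f T]ffunE (negbTE xT) opprK.
  by rewrite subrr; exact: sW.1.
have [g' gs' hg'] := proj_hom_D i j gs.
exists g' => // T; have : W (proj_hom i j (f - D g - wedge b0) T).
  by rewrite ffunE; case: ifP => _; [exact: gideal_pihomog|exact: sW.1].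
suff -> : proj_hom i j (f - D g - wedge b0) = f - wedge b - D g' by [].
rewrite -hg'; apply/ffunP => S; rewrite !cochainB ![proj_hom _ _ _ _]ffunE !cochainB.
case: (boolP (#|S| == i)) => hS; last first.
  rewrite (supp_card_eq0 f1 hS) [wedge b S]ffunE; case: ifP => xS; last by rewrite !subr0.
  rewrite ffunE; case: ifP; last by rewrite !subr0.
  by move: (cardsD1 x S) hS; rewrite xS add1n => -> /negbTE ->.
rewrite !raddfB /= [pihomog _ _ (f S)]pihomog_dE; last exact: f2.
rewrite addrAC; congr (_ - _ - _); rewrite !ffunE; case: ifP => xS; last exact: pihomog0.
by rewrite !inE eqxx andbT; move: (cardsD1 x S); rewrite xS add1n => <-; rewrite hS.
Qed.

(** The contribution of (0 : x_m) is bounded by the dimension of all its chains, not of its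
    homology; this is where the binomial coefficient, the number of (i - 1)-subsets of m variables,
    comes from. *)
Theorem koszul_le (W : R -> Prop) i j r nu : gideal W ->
  qdim (kcycle_in m (plus W 'X_x) i j) (kboundary_in m (plus W 'X_x)) r ->
  qdim (fun q => hform j q /\ W ('X_x * q)) W nu ->
  exists2 r', (r' <= r + bin_pred m i * nu)%N &
    qdim (kcycle_in m.+1 W i j) (kboundary_in m.+1 W) r'.
Proof.
move=> gW qr qnu; have sW := gideal_subspace gW; have sW' := plus_subspace 'X_x sW.
apply: (qdim_extension_le part0_lin wedge_lin _ _ _ _ qr (qdim_colon_chain i sW qnu)).
- exact: kcycle_in_subspace.
- exact: kboundary_in_subspace.
- exact: kboundary_in_subspace.
- exact: colon_chain_subspace.
- by move=> f; exact: kcycle_part0.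
- move=> b _ hb; exists 0; first exact: supp_in0.
  move=> T; rewrite (lin0 kl) subr0 ffunE; case: ifP => _; [exact: hb|exact: sW.1].
- by move=> f; exact: ker_part0.
Qed.

End Recursion.

(** The dimension of (0 : x_m)_j in the quotient with Hilbert function [H m.+1], read off from
    [qdim_colon]. *)
Definition nu_of (H : nat -> nat -> nat) (m j : nat) : nat :=
  (H m.+1 j + H m j.+1 - H m.+1 j.+1)%N.

(* [H m] stands for the Hilbert function modulo all variables but the first m;
   the sum is the Eliahou-Kervaire formula written with these functions. *)
Definition EK_sum (n : nat) (H : nat -> nat -> nat) (i j : nat) : nat :=
  (((i == 0) && (j == 0)) + \sum_(0 <= m < n) bin_pred m i * nu_of H m j)%N.

(** * The upper bound from a tower of coordinate quotients *)

Section BettiBound.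
Variables (K : fieldType) (n : nat).
Local Notation R := {mpoly K[n]}.
Local Notation D := (koszul (@mulR K n)).
Hypothesis hK : [pchar K] =i pred0.
Let kl := koszul_lin (@mulR_lin K n).

Lemma HF_pos_eq0 (W : R -> Prop) j : gideal W -> (forall x : 'I_n, W 'X_x) ->
  HF W j.+1 = 0%N.
Proof.
move=> gW hx; have sW := gideal_subspace gW; apply: HF_eq0 => // p hp.
rewrite (mpoly_homogE hp); apply: (subspace_sum sW) => m _.
have [->|] := eqVneq p@_m 0; first by rewrite scale0r; exact: sW.1.
rewrite -mcoeff_msupp => /(dhomog_mf hp) hm; apply: (subspaceZ sW).
have [i hi] : exists i, (0 < (m : 'X_{1..n}) i)%N.
  apply/existsP; apply: contraTT isT => /existsPn h0; move: hm => /=.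
  by rewrite mdegE big1 // => i _; apply/eqP; rewrite -leqn0 leqNgt h0.
have -> : (m : 'X_{1..n}) = ((m - U_(i)) + U_(i))%MM.
  rewrite submK //; apply/mnm_lepP => k; rewrite mnm1E.
  by case: eqP => [<-|].
by rewrite mpolyXD; apply: gidealM.
Qed.

(** No variable is left in the complex and the quotient is K, so the homology is K placed in
    bidegree (0, 0). *)
Lemma koszul_base (W : R -> Prop) i j : gideal W -> ~ W 1 -> (forall x : 'I_n, W 'X_x) ->
  qdim (kcycle_in 0 W i j) (kboundary_in 0 W) ((i == 0) && (j == 0))%N.
Proof.
move=> gW W1 hx; have sW := gideal_subspace gW.
have only0 (f : chains K n) (T : {set 'I_n}) : supp_in 0 f -> T != finset.set0 -> f T = 0.
  by move=> hf /finset.set0Pn[s sT]; exact: (supp_in_eq0 hf sT).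
have D0 f : supp_in 0 f -> D f = 0.
  move=> hf; apply/ffunP => T; rewrite ffunE big1 ?ffunE // => s sT.
  rewrite only0 ?(lin0 (@mulR_lin _ _ _)) ?scaler0 //.
  by apply/finset.set0Pn; exists s; rewrite setU11.
case: i => [|i] /=; last first.
  exists (fun=> 0); split=> [[]//|c _ []//|f [[f1 _ _] f2]].
  exists (fun=> 0); rewrite big_ord0 subr0; exists 0 => [|T]; first exact: supp_in0.
  rewrite (lin0 kl) subr0; have [->|T0] := eqVneq T finset.set0.
    by rewrite (supp_card_eq0 f1) ?cards0 //; exact: sW.1.
  by rewrite only0 //; exact: sW.1.
pose f (p : R) : chains K n := [ffun T : {set 'I_n} => if T == finset.set0 then p else 0].
have fl : lin f.
  by move=> c u v; apply/ffunP => T; rewrite !ffunE; case: ifP; rewrite ?scaler0 ?addr0.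
have hH : HF W j = (j == 0)%N :> nat.
  by case: j => [|j]; [rewrite HF0|rewrite HF_pos_eq0].
have := HFP j sW; rewrite hH; apply: (proj1 (qdim_iso fl (form_subspace K n j) _ _ _ _ _)).
- exact: kboundary_in_subspace.
- move=> p hp; split; last first.
    move=> T; rewrite ffunE; case: (T =P finset.set0) => [-> _ s|]; last by rewrite eqxx.
    by rewrite inE.
  split=> [T|T|T].
  + by rewrite ffunE; case: (T =P finset.set0) => [->|]; rewrite ?cards0 ?eqxx.
  + by rewrite ffunE; case: eqP => // _; exact: (form_subspace K n j).1.
  + rewrite D0 ?ffunE; first exact: sW.1.
    move=> S; rewrite ffunE; case: (S =P finset.set0) => [-> _ s|]; last by rewrite eqxx.
    by rewrite inE.
- move=> p hp; split=> [Wp|[g gs /(_ finset.set0)]].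
    exists 0 => [|T]; first exact: supp_in0.
    by rewrite (lin0 kl) subr0 ffunE; case: eqP => // _; exact: sW.1.
  by rewrite D0 // subr0 ffunE eqxx.
- move=> g [[g1 g2 g3] g4]; exists (g finset.set0); first exact: g2.
  exists 0 => [|T]; first exact: supp_in0.
  rewrite (lin0 kl) subr0 cochainB ffunE; case: (T =P finset.set0) => [->|/eqP T0].
    by rewrite subrr; exact: sW.1.
  by rewrite only0 // subr0; exact: sW.1.
Qed.

Section Tower.
Variable W : nat -> R -> Prop.
Hypotheses (gW : forall m, gideal (W m)) (W1 : ~ W 0 1).
Hypothesis WS : forall x : 'I_n, W x = plus (W x.+1) 'X_x.

Lemma X_form1 (x : 'I_n) : ('X_x : R) \is 1.-homog.
Proof. by rewrite dhomogX /= mdeg1. Qed.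

Lemma W0_X (x : 'I_n) : W 0 'X_x.
Proof.
suff h k : (k <= x)%N -> W (x - k)%N 'X_x by have := h x (leqnn x); rewrite subnn.
elim: k => [_|k ih lt].
  by rewrite subn0 WS; exists 1; rewrite mulr1 subrr; exact: (gideal0 (gW x.+1)).
have lt2 : (x - k.+1 < n)%N by rewrite (leq_ltn_trans (leq_subr _ _)).
rewrite (WS (Ordinal lt2)) /=; apply: plus_sub; rewrite subnSK //.
exact: ih (ltnW lt).
Qed.

Lemma qdim_nu (x : 'I_n) j :
  qdim (fun q => hform j q /\ W x.+1 ('X_x * q)) (W x.+1) (nu_of (fun m => HF (W m)) x j).
Proof.
have [nu q e] := qdim_colon j (gW x.+1) (X_form1 x).
by rewrite /nu_of WS e addKn.
Qed.

Lemma tower_le i j m : (m <= n)%N ->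
  exists2 r, (r <= EK_sum m (fun m => HF (W m)) i j)%N &
    qdim (kcycle_in m (W m) i j) (kboundary_in m (W m)) r.
Proof.
elim: m => [_|m ih lt].
  exists ((i == 0) && (j == 0) : nat); first by rewrite /EK_sum big_geq // addn0.
  by apply: koszul_base => //; exact: W0_X.
have [r le qr] := ih (ltnW lt); pose x := Ordinal lt.
rewrite (WS x : W m = _) in qr.
have [r' le' qr'] := koszul_le hK (x := x) (gW m.+1) qr (qdim_nu x j).
exists r' => //; apply: leq_trans le' _.
by rewrite /EK_sum big_nat_recr //= addnA leq_add2r.
Qed.

Lemma tower_eq i j m : (m <= n)%N ->
  (forall (x : 'I_n) r, qdim (kcycle_in x (W x) i j) (kboundary_in x (W x)) r ->
     qdim (kcycle_in x.+1 (W x.+1) i j) (kboundary_in x.+1 (W x.+1))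
       (r + bin_pred x i * nu_of (fun m => HF (W m)) x j)) ->
  qdim (kcycle_in m (W m) i j) (kboundary_in m (W m)) (EK_sum m (fun m => HF (W m)) i j).
Proof.
move=> + step; elim: m => [_|m ih lt].
  rewrite /EK_sum big_geq // addn0.
  by apply: koszul_base => //; exact: W0_X.
have := step (Ordinal lt) _ (ih (ltnW lt)).
by rewrite /EK_sum big_nat_recr //= addnA.
Qed.

Variable I : {pred R}.
Hypotheses (hI : graded_artinian I) (WI : W n = fun p => p \in I).

Lemma betti_qdim i j r :
  qdim (kcycle_in n (W n) i j) (kboundary_in n (W n)) r -> betti I i (i + j) = r.
Proof.
have sI := gideal_subspace (homog_ideal_gideal hI.1).
have sn (f : chains K n) : supp_in n f by move=> T _ s _; exact: ltn_ord.
move=> qr; apply: (qdim_unique (kboundary_subspace sI) (betti_koszul hK hI i j)).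
move: qr; rewrite WI; apply: eq_qdim.
- by move=> f; split=> [[]|h] //; split.
- by move=> f _; split=> [[g _ h]|[g h]]; exists g.
- exact: kcycle_in_subspace.
Qed.

Theorem betti_le i j : (betti I i (i + j) <= EK_sum n (fun m => HF (W m)) i j)%N.
Proof. by have [r le /betti_qdim ->] := tower_le i j (leqnn n). Qed.

End Tower.
End BettiBound.

Section EKSum.

Lemma bin_pred_leS m i : (bin_pred m i <= bin_pred m.+1 i)%N.
Proof. by case: i => // i; apply: leq_bin2l. Qed.

(* After summation by parts all coefficients except those of H n are nonnegative. *)
Lemma EK_sum_mono n (H H' : nat -> nat -> nat) i j :
  (forall m, m < n -> H m.+1 j.+1 <= H m.+1 j + H m j.+1)%N ->
  (forall m d, m < n -> H m d <= H' m d)%N -> H n =1 H' n ->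
  (EK_sum n H i j <= EK_sum n H' i j)%N.
Proof.
case: n => [|n] h le e; first by rewrite /EK_sum !big_geq.
pose S H m := (\sum_(0 <= l < m) bin_pred l i * nu_of H l j)%N.
(* The boundary term [bin_pred m i * H m j.+1] of the summation by parts makes the partial sums
   comparable. *)
have key m : (m <= n)%N ->
    (S H m + bin_pred m i * H m j.+1 <= S H' m + bin_pred m i * H' m j.+1)%N.
  elim: m => [_|m ih lt].
    by rewrite /S !big_geq // leq_add2l leq_mul2l le ?orbT.
  have {}ih := ih (ltnW lt); rewrite /S !big_nat_recr //= -!/(S _ _).
  have l1 : (m < n.+1)%N by exact: leqW.
  have l2 : (m.+1 < n.+1)%N by [].
  have := h m l1; have := bin_pred_leS m i.
  have := le m.+1 j l2; have := le m.+1 j.+1 l2.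
  rewrite /nu_of; move: (bin_pred m i) (bin_pred m.+1 i) (H m.+1 j) (H' m.+1 j) ih.
  move: (H m.+1 j.+1) (H' m.+1 j.+1) (H m j.+1) (H' m j.+1) (S H m) (S H' m).
  by move=> *; nia.
rewrite /EK_sum leq_add2l !big_nat_recr //= -!/(S _ _).
have := key n (leqnn n); have := h n (ltnSn n).
rewrite /nu_of !e; move: (bin_pred n i) (H' n.+1 j) (H' n.+1 j.+1) (H n j.+1) (H' n j.+1).
by move: (S H n) (S H' n) => *; nia.
Qed.

End EKSum.

(** * Linear changes of coordinates *)

Section LinSubst.
Variables (K : fieldType) (n : nat).
Local Notation R := {mpoly K[n]}.
Implicit Types (g h : 'M[K]_n).

Lemma lin_subst_lf g (a : 'rV_n) : lin_subst g (lf a) = lf (a *m g^T).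
Proof.
rewrite /lin_subst {1}/lf raddf_sum /=; under eq_bigr do rewrite comp_mpolyZ comp_mpolyXU.
rewrite /lf; under eq_bigr => j _ do rewrite -tnth_nth tnth_mktuple scaler_sumr.
rewrite exchange_big; apply: eq_bigr => i _ /=; rewrite mxE scaler_suml.
by apply: eq_bigr => j _; rewrite mxE scalerA.
Qed.

Lemma lin_subst_monom g (m : 'X_{1..n}) :
  lin_subst g ('X_[m] : R) = \prod_(i < n) lf (row i g^T) ^+ m i.
Proof.
rewrite /lin_subst comp_mpolyX; apply: eq_bigr => i _; congr (_ ^+ _).
by rewrite tnth_mktuple; apply: eq_bigr => j _; rewrite !mxE.
Qed.

Lemma lin_substM g (p q : R) : lin_subst g (p * q) = lin_subst g p * lin_subst g q.
Proof. exact: rmorphM. Qed.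

Lemma lin_subst_lin g : lin (lin_subst g : R -> R).
Proof. by move=> c u v; rewrite /lin_subst comp_mpolyD comp_mpolyZ. Qed.

Lemma lin_substE g (p : R) : lin_subst g p = \sum_(m <- msupp p) p@_m *: lin_subst g 'X_[m].
Proof.
rewrite {1}(mpolyE p) (lin_sum (lin_subst_lin g)); apply: eq_bigr => m _.
by rewrite (linZ (lin_subst_lin g)).
Qed.

Lemma lin_subst_comp g h (p : R) : lin_subst g (lin_subst h p) = lin_subst (g *m h) p.
Proof.
rewrite [lin_subst h p]lin_substE [RHS]lin_substE (lin_sum (lin_subst_lin g)).
apply: eq_bigr => m _; rewrite (linZ (lin_subst_lin g)) !lin_subst_monom.
rewrite [in LHS]/lin_subst rmorph_prod /=; congr (_ *: _); apply: eq_bigr => i _.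
rewrite rmorphXn /= -/(lin_subst g _) lin_subst_lf; congr (lf _ ^+ _).
by rewrite trmx_mul row_mul.
Qed.

Lemma lin_subst1 (p : R) : lin_subst 1%:M p = p.
Proof.
rewrite lin_substE [RHS]mpolyE; apply: eq_bigr => m _; congr (_ *: _).
rewrite lin_subst_monom mpolyXE_id; apply: eq_bigr => i _; congr (_ ^+ _).
by rewrite trmx1 row1 lf_delta.
Qed.

Lemma lin_subst_form g d (p : R) : p \is d.-homog -> lin_subst g p \is d.-homog.
Proof.
move=> hp; rewrite lin_substE big_seq; apply: rpred_sum => m mp; apply: rpredZ.
rewrite lin_subst_monom -(dhomog_mf hp mp) /= mdegE.
elim/big_ind2: _ => [|d1 p1 d2 p2 h1 h2|i _]; first exact: dhomog1.
  exact: dhomogM.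
by have := dhomogMn (m i) (lf_form (row i g^T)); rewrite mul1n.
Qed.

Lemma lin_subst_pihomog g d (p : R) :
  pihomog mdeg d (lin_subst g p) = lin_subst g (pihomog mdeg d p).
Proof.
rewrite {1}(pihomog_partitionE (leqnn (mmeasure mdeg p))) [pihomog mdeg d p in RHS](_ : _ =
  \sum_(e < mmeasure mdeg p) pihomog mdeg d (pihomog mdeg e p)); last first.
  by rewrite {1}(pihomog_partitionE (leqnn (mmeasure mdeg p))) raddf_sum.
rewrite !(lin_sum (lin_subst_lin g)) raddf_sum; apply: eq_bigr => e _ /=.
have h := pihomogP mdeg e p; have h2 := lin_subst_form g h.
have [<-|ne] := eqVneq (e : nat) d; first by rewrite (pihomog_dE h2) (pihomog_dE h).
by rewrite (pihomog_ne0 ne h2) (pihomog_ne0 ne h) (lin0 (lin_subst_lin g)).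
Qed.

Lemma lin_subst_mcoeff0 g (p : R) : (lin_subst g p)@_0%MM = p@_0%MM.
Proof.
have E (q : R) : q@_0%MM = (pihomog mdeg 0 q)@_0%MM.
  by rewrite mcoeff_pihomog mdeg0 eqxx.
rewrite E lin_subst_pihomog [RHS]E.
have -> : pihomog mdeg 0 p = p@_0%MM *: 1.
  apply/mpolyP => m; rewrite mcoeff_pihomog mdeg_eq0 mcoeffZ mcoeff1.
  by case: eqP => [->|_]; rewrite ?mulr1 ?mulr0.
by rewrite (linZ (lin_subst_lin g)) [lin_subst g 1]rmorph1.
Qed.

Lemma lin_substK g : g \in unitmx -> cancel (lin_subst g : R -> R) (lin_subst (invmx g)).
Proof. by move=> ug p; rewrite lin_subst_comp mulVmx // lin_subst1. Qed.

Lemma lin_substVK g : g \in unitmx -> cancel (lin_subst (invmx g) : R -> R) (lin_subst g).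
Proof. by move=> ug p; rewrite lin_subst_comp mulmxV // lin_subst1. Qed.

Section Pull.
Variable g : 'M[K]_n.
Hypothesis ug : g \in unitmx.
Local Notation S := (lin_subst g).
Local Notation S' := (lin_subst (invmx g)).

(** The image of W under the substitution; applying the inverse to the argument avoids an
    existential. *)
Definition pull (W : R -> Prop) : R -> Prop := fun p => W (S' p).

Lemma pull_gideal W : gideal W -> gideal (pull W).
Proof.
move=> gW; have sW := gideal_subspace gW; have l := lin_subst_lin (invmx g).
split=> [|p q hp hq|p q hq|d p hp]; rewrite /pull.
- by rewrite (lin0 l); exact: gideal0.
- by rewrite (linD l); exact: (subspaceD sW).
- by rewrite lin_substM; exact: gidealM.
- by rewrite -lin_subst_pihomog; exact: gideal_pihomog.
Qed.

Lemma pull_plus W l : pull (plus W l) = plus (pull W) (S l).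
Proof.
have li := lin_subst_lin (invmx g).
apply/funext => p; apply/propext; split=> -[q hq].
  by exists (S q); rewrite /pull (linB li) lin_substM !lin_substK.
by exists (S' q); move: hq; rewrite /pull (linB li) lin_substM lin_substK.
Qed.

Lemma HF_pull W d : subspace W -> HF (pull W) d = HF W d.
Proof.
move=> sW; have li := lin_subst_lin (invmx g).
apply: HF_unique; first exact: (subspace_preim li).
apply: (proj2 (qdim_iso (P' := hform d) li (form_subspace K n d) sW _ _ _ _)); last exact: HFP.
- by move=> p hp; exact: lin_subst_form.
- by [].
- move=> p hp; exists (S p); first exact: lin_subst_form.
  by rewrite lin_substK // subrr; exact: sW.1.
Qed.

Variable I : {pred R}.
Hypothesis hI : graded_artinian I.

Definition pull_ideal : {pred R} := fun p => S' p \in I.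

Lemma pull_graded_artinian : graded_artinian pull_ideal.
Proof.
have li := lin_subst_lin (invmx g).
case: hI => [[[I0 I1 Il] Ih] [r [b hb]]]; split; first split; first split.
- by rewrite unfold_in (lin0 li).
- by rewrite unfold_in [lin_subst _ 1]rmorph1.
- move=> a p q hp hq; rewrite unfold_in (linD li) lin_substM.
  by apply: Il.
- by move=> p d hp; rewrite unfold_in -lin_subst_pihomog; apply: Ih.
- exists r, (fun l => S (b l)) => p; have [c hc] := hb (S' p); exists c.
  rewrite unfold_in (linB li) (lin_lincomb li); move: hc.
  by under [in X in _ -> X]eq_bigr do rewrite lin_substK //.
Qed.

Definition map_complex (F : free_complex K n) : free_complex K n :=
  @FreeComplex K n (rk F) (@shift _ _ F) (fun i => map_mx S (bd F i)).

Lemma map_resolves (F : free_complex K n) (aug : 'cV[R]_(rk F 0)) :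
  resolves aug I -> resolves (F := map_complex F) (map_mx S aug) pull_ideal.
Proof.
have l := lin_subst_lin g; have li := lin_subst_lin (invmx g).
have S0 p : (S p == 0) = (p == 0).
  by apply/eqP/eqP => [h|->]; [rewrite -[p](lin_substK ug) h (lin0 li)|rewrite (lin0 l)].
pose S1 (m' n' : nat) (M : 'M[R]_(m', n')) := map_mx S M.
pose S2 (m' n' : nat) (M : 'M[R]_(m', n')) := map_mx S' M.
have S12 m' n' : cancel (@S1 m' n') (@S2 m' n').
  by move=> M; apply/matrixP => a b; rewrite !mxE lin_substK.
have S21 m' n' : cancel (@S2 m' n') (@S1 m' n').
  by move=> M; apply/matrixP => a b; rewrite !mxE lin_substVK.
have S1M m' n' p' (A : 'M_(m', n')) (B : 'M_(n', p')) : S1 _ _ (A *m B) = S1 _ _ A *m S1 _ _ B.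
  apply/matrixP => a b; rewrite !mxE (lin_sum l); apply: eq_bigr => c _.
  by rewrite !mxE lin_substM.
have S2M m' n' p' (A : 'M_(m', n')) (B : 'M_(n', p')) : S2 _ _ (A *m B) = S2 _ _ A *m S2 _ _ B.
  apply/matrixP => a b; rewrite !mxE (lin_sum li); apply: eq_bigr => c _.
  by rewrite !mxE lin_substM.
case=> h1 h2 h3 h4 h5; split=> /=.
- move=> i a b; rewrite mxE S0 => /h1[e e1 e2]; exists e => //.
  exact: lin_subst_form.
- by move=> a; rewrite mxE; apply: lin_subst_form.
- move=> p; have [u hu] := h3 (S' p); exists (S1 _ _ u).
  rewrite unfold_in (linB li) -/(S1 _ _ aug) -S1M mxE lin_substK //.
- move=> u; rewrite unfold_in.
  have -> : S' ((u *m map_mx S aug) 0 0) = (S2 _ _ u *m aug) 0 0.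
    by rewrite -[in RHS](S12 _ _ aug) -S2M [RHS]mxE.
  rewrite h4; split=> [[v hv]|[v ->]]; last by exists (S2 _ _ v); rewrite S2M S12.
  by exists (S1 _ _ v); rewrite -[u]S21 hv S1M.
- move=> i u; split=> [h|[v ->]].
    have /h5[v hv] : S2 _ _ u *m bd F i = 0.
      by rewrite -[X in _ *m X](S12 _ _) -S2M -/(S1 _ _ _) [X in S2 _ _ X]h; apply/matrixP => a b; rewrite !mxE (lin0 li).
    by exists (S1 _ _ v); rewrite -[u]S21 hv S1M.
  rewrite -/(S1 _ _ (bd F i)) -/(S1 _ _ (bd F i.+1)) -(S21 _ _ v) -!S1M.
  have -> : S2 _ _ v *m bd F i.+1 *m bd F i = 0 by apply/h5; exists (S2 _ _ v).
  by apply/matrixP => a b; rewrite !mxE (lin0 l).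
Qed.

Lemma map_tor_dim F i d : tor_dim (map_complex F) i d = tor_dim F i d.
Proof.
have E j : bdK (map_complex F) j = bdK F j.
  by apply/matrixP => a b; rewrite !mxE lin_subst_mcoeff0.
have E2 : kerK (map_complex F) i = kerK F i by case: i => [|i] //=; rewrite E.
by rewrite /tor_dim E2 E.
Qed.

End Pull.
End LinSubst.

Section BettiForms.
Variables (K : fieldType) (n : nat).
Local Notation R := {mpoly K[n]}.
Hypothesis hK : [pchar K] =i pred0.

(** Substitution carries a resolution of I to one of the transformed ideal with the same shifts and
    the same constant terms. *)
Lemma betti_pull (g : 'M[K]_n) (I : {pred R}) i d : g \in unitmx -> graded_artinian I ->
  betti (pull_ideal g I) i d = betti I i d.
Proof.
move=> ug hI; have [F [aug hF]] := resolution_exists hK hI.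
rewrite (bettiE hI.1 _ _ hF) (bettiE (pull_graded_artinian ug hI).1 _ _ (map_resolves ug hF)).
exact: map_tor_dim.
Qed.

Lemma plus_not1 (W : R -> Prop) l : gideal W -> l \is 1.-homog -> ~ W 1 -> ~ plus W l 1.
Proof.
move=> gW hl h1 [q /(gideal_pihomog gW 0)].
rewrite raddfB /= (pihomogM _ _ hl) /= subr0 pihomog_dE //; exact: dhomog1.
Qed.

Theorem betti_le_forms (I : {pred R}) (A : 'M[K]_n) (V : nat -> R -> Prop) i j :
  graded_artinian I -> A \in unitmx -> V 0%N = (fun p => p \in I) ->
  (forall k : 'I_n, V k.+1 = plus (V k) (lf (row k A))) ->
  (betti I i (i + j) <= EK_sum n (fun m => HF (V (n - m)%N)) i j)%N.
Proof.
move=> hI uA V0 VS.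
have gV k : (k <= n)%N -> gideal (V k) /\ ~ V k 1.
  elim: k => [_|k ih lt].
    by rewrite V0; split; [exact: homog_ideal_gideal hI.1|case: hI => [[[]]]; move=> _ /negP].
  have [gk k1] := ih (ltnW lt); rewrite (VS (Ordinal lt)) /=.
  by split; [apply: (plus_gideal gk (lf_form _))|apply: (plus_not1 gk (lf_form _))].
pose rev : 'M[K]_n := perm_mx (perm (@rev_ord_inj n)).
(* This substitution sends the form in row k to x_(n-1-k), so adding the forms in order removes the
   variables from the last one down. *)
pose g := (invmx A *m rev)^T.
have ug : g \in unitmx by rewrite unitmx_tr unitmx_mul unitmx_inv uA unitmx_perm.
have gE (k : 'I_n) : lin_subst g (lf (row k A)) = 'X_(rev_ord k).
  rewrite lin_subst_lf trmxK mulmxA -row_mul mulmxV // row1 /rev -rowE.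
  rewrite -lf_delta; congr lf; apply/rowP => l; rewrite !mxE permE eqxx /=.
  by rewrite eq_sym.
rewrite -(betti_pull _ _ ug hI).
pose W m := pull g (V (n - m)%N).
have sV m : subspace (V (n - m)%N) := gideal_subspace (gV _ (leq_subr _ _)).1.
have gW m : gideal (W m) by apply: pull_gideal => //; have [] := gV (n - m)%N (leq_subr _ _).
have -> : EK_sum n (fun m => HF (V (n - m)%N)) i j = EK_sum n (fun m => HF (W m)) i j.
  rewrite /EK_sum; congr (_ + _)%N; apply: eq_bigr => m _; congr (_ * _)%N.
  by rewrite /nu_of !HF_pull.
apply: (betti_le hK gW).
- rewrite /W /pull subn0 [lin_subst _ 1]rmorph1; exact: (gV n (leqnn n)).2.
- move=> x; rewrite /W.
  have lt : (n - x.+1 < n)%N by have := ltn_ord x; lia.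
  have -> : (n - x)%N = (Ordinal lt).+1 by rewrite /= subnSK.
  rewrite VS pull_plus // gE; congr (plus _ 'X_ _).
  by apply: val_inj; rewrite /= subnSK // subKn // ltnW.
- exact: pull_graded_artinian.
- by rewrite /W subnn V0.
Qed.

End BettiForms.

(** * Monomial ideals *)

Section MonomialIdeals.
Variables (K : fieldType) (n : nat).
Local Notation R := {mpoly K[n]}.
Implicit Types (O : pred 'X_{1..n}) (p q : R).

(* The span of the monomials outside O; O is the set of standard monomials. *)
Definition monI O : R -> Prop := fun p => forall m, O m -> p@_m = 0.

Definition div_closed O : Prop := forall m m' : 'X_{1..n}, O (m + m')%MM -> O m.

Lemma mcoeff_mulX (x : 'I_n) q (m : 'X_{1..n}) :
  ('X_x * q)@_m = if m x == 0%N then 0 else q@_(m - U_(x)).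
Proof.
case: eqP => [m0|/eqP m0]; last first.
  by rewrite mulrC {1}(@mnm_subK n m x) ?lt0n // mcoeffMX.
apply: memN_msupp_eq0; rewrite mulrC (perm_mem (msuppMX _ _)).
apply/mapP => -[m' _ e]; move: m0; rewrite e mnmDE mnm1E eqxx.
by [].
Qed.

Lemma monI_subspace O : subspace (monI O).
Proof.
split=> [m _|c u v hu hv m Om]; first by rewrite mcoeff0.
by rewrite mcoeffD mcoeffZ hu // hv // mulr0 addr0.
Qed.

Lemma monI_gideal O : div_closed O -> gideal (monI O).
Proof.
move=> dO; have sO := monI_subspace O; split; first exact: sO.1.
- by move=> p q; apply: subspaceD.
- move=> p q hq m Om; rewrite mcoeffM big1 // => k /eqP e.
  by rewrite hq ?mulr0 //; apply: (dO _ k.1); rewrite addmC -e.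
- move=> d p hp m Om; rewrite mcoeff_pihomog hp // if_same.
  by [].
Qed.

Lemma monI_not1 O : O 0%MM -> ~ monI O 1.
Proof. by move=> O0 /(_ _ O0) /eqP; rewrite mcoeff1 eqxx oner_eq0. Qed.

Definition hcount O (d : nat) : nat :=
  #|[set m : 'X_{1..n < d.+1} | (mdeg m == d) && O m]%SET|.

Lemma HF_monI O d : HF (monI O) d = hcount O d.
Proof.
apply: HF_unique; first exact: monI_subspace.
pose A := [set m : 'X_{1..n < d.+1} | (mdeg m == d) && O m]%SET; pose J := {m | m \in A}.
rewrite -[hcount O d]/#|A| -(card_sig (mem A)).
apply: (qdim_fin (b := fun j : J => 'X_[val j])) => [[m mA]|c h [m mA]|p hp].
- by rewrite /hform dhomogX /=; move: mA; rewrite inE => /andP[].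
- have := h m; have := mA; rewrite inE => /andP[_ Om] /(_ Om).
  rewrite raddf_sum (bigD1 (exist _ m mA)) //= mcoeffZ mcoeffX eqxx mulr1 big1 ?addr0 //.
  move=> [m' m'A] ne; rewrite mcoeffZ mcoeffX /=; case: eqP => [e|_]; last by rewrite mulr0.
  by case/eqP: ne; apply: val_inj; apply: val_inj.
- exists (fun j : J => p@_(val j)) => m Om; rewrite mcoeffB.
  apply/eqP; rewrite subr_eq0; apply/eqP; rewrite raddf_sum /=.
  have [md|md] := eqVneq (mdeg m) d; last first.
    rewrite (dhomog_nemf_coeff hp) // big1 // => -[m' m'A] _; rewrite mcoeffZ mcoeffX /=.
    case: eqP => [e|_]; last by rewrite mulr0.
    by move: m'A; rewrite inE => /andP[/eqP]; rewrite e => e2; rewrite e2 eqxx in md.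
  have lt : (mdeg m < d.+1)%N by rewrite md.
  have mA : BMultinom lt \in A by rewrite inE /= md eqxx.
  rewrite (bigD1 (exist (fun m0 => m0 \in A) (BMultinom lt) mA : J)) //= mcoeffZ mcoeffX eqxx mulr1 big1 ?addr0 //.
  move=> [m' m'A] ne; rewrite mcoeffZ mcoeffX /=; case: eqP => [e|_]; last by rewrite mulr0.
  by case/eqP: ne; apply: val_inj; apply: val_inj.
Qed.

Definition mfilter O p : R := \sum_(m <- msupp p | O m) p@_m *: 'X_[m].

Lemma mcoeff_mfilter O p m : (mfilter O p)@_m = if O m then p@_m else 0.
Proof.
rewrite /mfilter raddf_sum /= big_mkcond /=.
case: (boolP (m \in msupp p)) => mp; last first.
  rewrite (memN_msupp_eq0 mp) if_same big_seq big1 // => m' mp'; case: ifP => // _.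
  rewrite mcoeffZ mcoeffX; case: eqP => [e|_]; last by rewrite mulr0.
  by rewrite -e mp' in mp.
rewrite (bigD1_seq m) ?msupp_uniq //= mcoeffZ mcoeffX eqxx mulr1 big1 ?addr0 //.
move=> m' ne; case: ifP => // _.
by rewrite mcoeffZ mcoeffX (negbTE ne) mulr0.
Qed.

Lemma mfilter_lin O : lin (mfilter O).
Proof.
move=> c u v; apply/mpolyP => m; rewrite mcoeffD mcoeffZ !mcoeff_mfilter mcoeffD mcoeffZ.
by case: ifP; rewrite ?mulr0 ?addr0.
Qed.

Lemma mfilter_form O d p : hform d p -> hform d (mfilter O p).
Proof.
move=> hp; apply/dhomogP => m; rewrite mcoeff_msupp mcoeff_mfilter.
by case: ifP => _; rewrite ?eqxx // -mcoeff_msupp => /(dhomog_mf hp).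
Qed.

Section OneVariable.
Variable x : 'I_n.
(** [mfilter nox] is the substitution x = 0, viewed inside R. *)
Definition nox : pred 'X_{1..n} := fun m => m x == 0%N.
Local Notation rho := (mfilter nox).

Lemma rho_mul s p : s != x -> rho ('X_s * p) = 'X_s * rho p.
Proof.
move=> sx; apply/mpolyP => m; rewrite mcoeff_mulX !mcoeff_mfilter mcoeff_mulX /nox.
rewrite mnmBE mnm1E (negbTE sx) subn0; case: (m s == 0%N) => //.
by rewrite if_same.
Qed.

Lemma rho_mulx p : rho ('X_x * p) = 0.
Proof.
apply/mpolyP => m; rewrite mcoeff_mfilter mcoeff_mulX mcoeff0 /nox.
by case: (m x == 0%N).
Qed.

Lemma rho_div p : exists q, p - rho p = 'X_x * q.
Proof.
exists (\sum_(m <- msupp p | ~~ nox m) p@_m *: 'X_[m - U_(x)]).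
have {1}-> : p = rho p + mfilter (predC nox) p.
  by apply/mpolyP => m; rewrite mcoeffD !mcoeff_mfilter /=; case: nox; rewrite ?addr0 ?add0r.
rewrite addrC addKr mulr_sumr; apply: eq_bigr => m; rewrite /nox /= -lt0n => m0.
by rewrite -scalerAr -mpolyXD -mnm_subK.
Qed.

Lemma plus_monI O : plus (monI O) 'X_x = monI (fun m => O m && (m x == 0%N)).
Proof.
apply/funext => p; apply/propext; split=> [[q hq] m /andP[Om mx]|hp].
  by have := hq m Om; rewrite mcoeffB mcoeff_mulX mx subr0.
have [q hq] := rho_div p; exists q => m Om.
rewrite -hq subKr mcoeff_mfilter /nox; case: ifP => // mx.
by apply: hp; rewrite Om.
Qed.

End OneVariable.

(** The standard monomials of the quotient by all variables but the first m. *)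
Definition trunc O (m : nat) : pred 'X_{1..n} :=
  fun mm => O mm && [forall i : 'I_n, (m <= i)%N ==> (mm i == 0%N)].

Lemma truncP O m mm : reflect (O mm /\ forall i : 'I_n, (m <= i)%N -> mm i = 0%N) (trunc O m mm).
Proof.
apply: (iffP andP) => -[Om h]; split=> //.
  by move=> i le; apply/eqP; move/forallP/(_ i): h; rewrite le.
by apply/forallP => i; apply/implyP => /h ->.
Qed.

Lemma trunc_down O m : div_closed O -> div_closed (trunc O m).
Proof.
move=> dO m1 m2 /truncP[/dO O1 h]; apply/truncP; split=> // i /h.
by rewrite mnmDE => /eqP; rewrite addn_eq0 => /andP[/eqP].
Qed.

Lemma truncS O (x : 'I_n) : trunc O x = fun m => trunc O x.+1 m && (m x == 0%N).
Proof.
apply/funext => m; apply/truncP/andP => [[Om h]|[/truncP[Om h] /eqP mx]].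
  by split; [apply/truncP; split=> // i /ltnW/h|rewrite h].
split=> // i; rewrite leq_eqVlt => /predU1P[/val_inj <-|/h] //.
Qed.

Lemma trunc_full O : trunc O n = O.
Proof.
apply/funext => m; apply/truncP/idP => [[]|Om] //; split=> // i.
by rewrite leqNgt ltn_ord.
Qed.

(* Strong stability, stated for the complement. *)
Definition stable O : Prop := forall (s x : 'I_n) (m : 'X_{1..n}), (s < x)%N ->
  O (m + U_(s))%MM -> O (m + U_(x))%MM.

End MonomialIdeals.

(** * Equality for stable monomial ideals *)

Section EliahouKervaire.
Variables (K : fieldType) (n : nat).
Local Notation R := {mpoly K[n]}.
Local Notation D := (koszul (@mulR K n)).
Hypothesis hK : [pchar K] =i pred0.
Let kl := koszul_lin (@mulR_lin K n).

Section Step.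
Variables (O : pred 'X_{1..n}) (x : 'I_n).
Hypothesis dO : div_closed O.
Hypothesis stO : forall (s : 'I_n) (m : 'X_{1..n}), (s < x)%N ->
  O (m + U_(s))%MM -> O (m + U_(x))%MM.
Local Notation W := (@monI K n O).
Local Notation rho := (@mfilter K n (nox x)).

Let sW : subspace W. Proof. exact: monI_subspace. Qed.
Let gW : gideal W. Proof. exact: monI_gideal. Qed.

(** The variables before x kill (0 : x). Stability enters the Koszul computation through this
    alone. *)
Lemma monI_colon_stable q (s : 'I_n) : (s < x)%N -> W ('X_x * q) -> W ('X_s * q).
Proof.
move=> sx hq m Om; rewrite mcoeff_mulX; case: eqP => // /eqP; rewrite -lt0n => m0.
have := hq (U_(x) + (m - U_(s)))%MM; rewrite mcoeff_mulX mnmDE mnm1E eqxx /= addmC addmK.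
by apply; apply: (stO sx); rewrite addmC -mnm_subK.
Qed.

Lemma monI_rho p : W p -> W (rho p).
Proof. by move=> hp m Om; rewrite mcoeff_mfilter hp // if_same. Qed.

Lemma monI_rho_plus p : plus W 'X_x p -> W (rho p).
Proof.
by move=> [q /monI_rho]; rewrite (linB (mfilter_lin _)) rho_mulx subr0.
Qed.

Definition rhoc (f : chains K n) : chains K n := [ffun T : {set 'I_n} => rho (f T)].

Lemma supp_rhoc m f : supp_in m f -> supp_in m (rhoc f).
Proof.
move=> hf T h; apply: hf; apply: contraNneq h; rewrite ffunE => ->.
by rewrite (lin0 (mfilter_lin _)).
Qed.

Lemma D_rhoc f T : supp_in x f -> D (rhoc f) T = rho (D f T).
Proof.
move=> hf; rewrite !ffunE (lin_sum (mfilter_lin _)); apply: eq_bigr => s sT.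
rewrite (linZ (mfilter_lin _)) ffunE; congr (_ *: _).
have [->|sx] := eqVneq s x; last by rewrite /mulR rho_mul.
by rewrite (supp_in_x hf) ?setU11 // (lin0 (mfilter_lin _)) !(lin0 (@mulR_lin _ _ _)) (lin0 (mfilter_lin _)).
Qed.

(** The sequence behind [koszul_le] becomes short exact, and the differential on (0 : x) is zero, so
    all its chains count. *)
Lemma koszul_stable i j r nu :
  qdim (kcycle_in x (plus W 'X_x) i j) (kboundary_in x (plus W 'X_x)) r ->
  qdim (fun q => hform j q /\ W ('X_x * q)) W nu ->
  qdim (kcycle_in x.+1 W i j) (kboundary_in x.+1 W) (r + bin_pred x i * nu).
Proof.
move=> qr qnu; have sW' := plus_subspace 'X_x sW.
apply: (qdim_extension (part0_lin x) (wedge_lin x) _ _ _ _ qr (qdim_colon_chain i sW qnu)).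
- exact: kcycle_in_subspace.
- exact: kboundary_in_subspace.
- exact: kboundary_in_subspace.
- exact: colon_chain_subspace.
- by move=> f; exact: kcycle_part0.
- move=> b _ hb; exists 0; first exact: supp_in0.
  move=> T; rewrite (lin0 kl) subr0 ffunE; case: ifP => _; [exact: hb|exact: sW.1].
- by move=> f; exact: (ker_part0 hK gW).
- move=> f hf [g gs hg]; exists (part0 x g); first exact: supp_part0.
  move=> T; case: (boolP (x \in T)) => xT.
    rewrite cochainB ffunE xT (supp_in_x (supp_in_D (supp_part0 gs)) xT) subr0.
    by apply: plus_sub; exact: sW.1.
  exists (twist x (part1 x g) T); rewrite cochainB [part0 x f T]ffunE (negbTE xT).
  by have := hg T; rewrite cochainB (D_part0 _ xT) opprD addrA.
(* Surjectivity: a cycle modulo x lifts with x set to 0, because [rho] maps its differential from W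
   + (x) into W. *)
- move=> f [[f1 f2 f3] fs]; exists (rhoc f).
    split; last exact: supp_inW (supp_rhoc fs).
    split=> [T h|T|T].
    + by apply: f1; apply: contraNneq h; rewrite ffunE => ->; rewrite (lin0 (mfilter_lin _)).
    + by rewrite ffunE; exact: mfilter_form.
    + by rewrite D_rhoc //; exact: monI_rho_plus.
  exists 0 => [|T]; first exact: supp_in0.
  rewrite (lin0 kl) subr0 (part0_id (supp_rhoc fs)) cochainB ffunE.
  have [q ->] := rho_div x (f T); apply: plus_mul; exact: sW.1.
(* [wedge b] is a cycle: its term at x lies in W by the colon condition, and the earlier variables
   send b into W by stability. *)
- move=> b hb; have bs := colon_chain_supp hb; have [b1 b2] := hb; split; last first.
    exists 0 => [|T]; first exact: supp_in0.
    by rewrite (lin0 kl) subr0 part0_wedge ffunE; exact: sW'.1.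
  split; last exact: supp_wedge.
  split=> [T|T|T].
  + rewrite ffunE; case: ifP => [xT h|]; last by rewrite eqxx.
    apply: contraNeq h => hT; apply/eqP/b2; rewrite inE negb_and.
    by move: (cardsD1 x T) hT; rewrite xT add1n => ->  ->; rewrite orbT.
  + by rewrite ffunE; case: ifP => _; [have [] := b1 (T :\ x)%SET|exact: (form_subspace K n j).1].
  + move: T; apply: (chain_cases (x := x)) => T xT.
      rewrite (D_part0 _ xT) part0_wedge (lin0 kl) ffunE add0r part1_wedge // ffunE -scalerAr.
      by apply: (subspaceZ sW); have [] := b1 T.
    rewrite (D_part1 (supp_wedge bs) xT) part1_wedge // ffunE.
    apply: (subspace_sum sW) => s sT; apply: (subspaceZ sW).
    have [lt|le] := ltnP s x; last first.
      by rewrite (supp_in_eq0 bs (setU11 s T) le) (lin0 (@mulR_lin _ _ _)); exact: sW.1.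
    by apply: monI_colon_stable => //; have [] := b1 (s |: T).
(* Injectivity: if [wedge b] is D g modulo W, then b is D v modulo W for v = part1 g. Subtracting
   from D g its value at x = 0 shows that x kills e = D c + twist v; by stability D e lies in W, and
   D D c = 0 leaves D v in W. *)
- move=> b hb [g gs hg]; have bs := colon_chain_supp hb.
  pose u := part0 x g; pose v := part1 x g.
  have us : supp_in x u by exact: supp_part0.
  have vs : supp_in x v by exact: supp_part1.
  have /choice[c0 hc0] : forall T : {set 'I_n}, exists c, u T - rho (u T) = 'X_x * c.
    by move=> T; exact: rho_div.
  pose c : chains K n := [ffun T : {set 'I_n} => if u T == 0 then 0 else c0 T].
  have hc T : u T - rho (u T) = 'X_x * c T.
    rewrite [c T]ffunE; case: (u T =P 0) => [->|_]; last exact: hc0.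
    by rewrite (lin0 (mfilter_lin _)) mulr0 subrr.
  have cs : supp_in x c.
    by move=> T; rewrite ffunE; case: (u T =P 0) => [_|/eqP h _]; [rewrite eqxx|exact: us].
  pose e := D c + twist x v.
  have es : supp_in x e.
    rewrite /e -[D c]scale1r; apply: supp_in_lin; first exact: supp_in_D.
    exact: supp_twist.
  have he (T : {set 'I_n}) : x \notin T -> W ('X_x * e T).
    move=> xT; have h : W (D g T).
      have := hg T; rewrite cochainB ffunE (negbTE xT) sub0r => /(subspaceN sW).
      by rewrite opprK.
    have := subspaceB sW h (monI_rho h); rewrite (D_part0 _ xT) -/u -/v.
    rewrite (linD (mfilter_lin _)) rho_mulx addr0 addrAC -(D_rhoc _ us) -cochainB -(linB kl).
    suff -> : u - rhoc u = [ffun S => 'X_x * c S] by rewrite D_mulx -mulrDr -cochainD.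
    by apply/ffunP => S; rewrite cochainB [RHS]ffunE -hc [rhoc u S]ffunE.
  have hDe (T : {set 'I_n}) : W (D e T).
    rewrite ffunE; apply: (subspace_sum sW) => s sT; apply: (subspaceZ sW).
    have [lt|le] := ltnP s x; last first.
      by rewrite (supp_in_eq0 es (setU11 s T) le) (lin0 (@mulR_lin _ _ _)); exact: sW.1.
    case: (boolP (x \in (s |: T))) => xT.
      by rewrite (supp_in_x es xT) (lin0 (@mulR_lin _ _ _)); exact: sW.1.
    by apply: monI_colon_stable => //; exact: he.
  have hDv (T : {set 'I_n}) : W (D v T).
    have := hDe T; rewrite /e (linD kl) (DD hK) add0r (D_twist vs) cochainN ffunE.
    move=> /(subspaceN sW); rewrite opprK => /(subspaceZ sW (sgn K x T)).
    by rewrite scalerA (sgn_sq K) scale1r.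
  move=> T; case: (boolP (x \in T)) => xT.
    by rewrite (supp_in_x bs xT); exact: sW.1.
  have := hg (x |: T); rewrite cochainB ffunE setU11 finset.setU1K // (D_part1 gs xT) -/v.
  by move=> h; rewrite -(subrK (D v T) (b T)); apply: (subspaceD sW).
Qed.

End Step.

Theorem eliahou_kervaire (I : {pred R}) (O : pred 'X_{1..n}) i j :
  graded_artinian I -> monI O = (fun p => p \in I) -> div_closed O -> stable O -> O 0%MM ->
  betti I i (i + j) = EK_sum n (fun m => hcount (trunc O m)) i j.
Proof.
move=> hI IO dO stO O0; pose W m := @monI K n (trunc O m).
have gW m : gideal (W m) by apply: monI_gideal; exact: trunc_down.
have WS (x : 'I_n) : W x = plus (W x.+1) 'X_x by rewrite /W truncS plus_monI.
have -> : EK_sum n (fun m => hcount (trunc O m)) i j = EK_sum n (fun m => HF (W m)) i j.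
  rewrite /EK_sum; congr (_ + _)%N; apply: eq_bigr => m _; congr (_ * _)%N.
  by rewrite /nu_of !HF_monI.
have WI : W n = fun p => p \in I by rewrite /W trunc_full.
apply: (betti_qdim hK hI WI); apply: (tower_eq gW _ WS (leqnn n)).
  by apply: monI_not1; apply/truncP; split=> // k _; rewrite mnm0E.
move=> x r; rewrite WS => qr; apply: koszul_stable => //.
- exact: trunc_down.
- move=> s m sx /truncP[Om h]; apply/truncP; split; first exact: (stO s x).
  move=> k lt; have := h k lt; rewrite !mnmDE !mnm1E.
  have -> : (x == k) = false by apply/eqP => e; rewrite e ltnn in lt.
  by case: (s == k); rewrite ?addn1 // addn0.
- by have := qdim_nu gW WS x j.
Qed.

End EliahouKervaire.

(** * Lex segments *)

Section LexSegments.
Variable n : nat.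
Local Notation mono := 'X_{1..n}.
Implicit Types (O : pred mono) (m : mono).

(** Indexed by a natural number so that [lexlist] recurses without bounds; for s >= n it is the
    monomial 1. *)
Definition varm (s : nat) : mono := [multinom ((i : nat) == s : nat) | i < n].

(* The monomials of degree d in the N variables from s on, in increasing order. *)
Fixpoint lexlist (d : nat) : nat -> nat -> seq mono :=
  match d with
  | 0 => fun _ _ => [:: 0%MM]
  | d'.+1 => fix aux s N :=
      match N with
      | 0 => [::]
      | N'.+1 => aux s.+1 N' ++ [seq (varm s + m)%MM | m <- lexlist d' s N'.+1]
      end
  end.

Lemma lexlistS d s N : lexlist d.+1 s N.+1 =
  lexlist d.+1 s.+1 N ++ [seq (varm s + m)%MM | m <- lexlist d s N.+1].
Proof. by []. Qed.

Lemma varmE s (i : 'I_n) : varm s i = (i == s :> nat).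
Proof. by rewrite mnmE. Qed.

Lemma varm_ord (i : 'I_n) : varm i = U_(i)%MM.
Proof. by apply/mnmP => j; rewrite varmE mnm1E -val_eqE eq_sym. Qed.

Definition supp_range (s N : nat) m : Prop :=
  forall i : 'I_n, m i != 0%N -> (s <= i < s + N)%N.

Lemma mem_lexlist d s N m : (s + N <= n)%N ->
  m \in lexlist d s N <-> mdeg m = d /\ supp_range s N m.
Proof.
elim: d s N m => [|d ihd] s N m.
  move=> _; rewrite inE; split=> [/eqP ->|[/eqP]].
    by split; [exact: mdeg0|move=> i; rewrite mnm0E].
  by rewrite mdeg_eq0.
elim: N s => [|N ihN] s le.
  split=> // -[hm hs]; have [i hi] := mdegS_exists hm.
  by have := hs i; rewrite -lt0n hi addn0 => /(_ isT); lia.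
have lt : (s < n)%N by lia.
pose x := Ordinal lt; have xE : varm s = U_(x)%MM by rewrite -varm_ord.
rewrite lexlistS mem_cat; split.
  case/orP => [/ihN|/mapP[m' /(ihd _ _ _ le)[hm hs] ->]].
    rewrite addSnnS => /(_ le)[hm hs]; split=> // i /hs; lia.
  split=> [|i]; first by rewrite xE mdegD mdeg1 hm add1n.
  rewrite mnmDE varmE; case: ((i : nat) =P s) => [-> _|_]; first by lia.
  by move=> /hs; lia.
move=> [hm hs]; have [m0|m0] := posnP (m x).
  apply/orP; left; apply/ihN; first by lia.
  split=> // i mi; have := hs i mi; suff : (i != s :> nat) by lia.
  by apply: contraNneq mi => e; rewrite (_ : i = x) ?m0 //; exact: val_inj.
apply/orP; right; apply/mapP; exists (m - U_(x))%MM; last by rewrite xE -mnm_subK.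
apply/ihd => //; have := mnm_subK m0 => mE; split.
  by move: hm; rewrite {1}mE mdegD mdeg1 add1n => -[].
by move=> i; rewrite mnmBE => h; apply: hs; apply: contraNneq h => ->.
Qed.

Lemma pairwise_lexlist d s N : (s + N <= n)%N ->
  pairwise (fun m m' => (m < m')%O) (lexlist d s N).
Proof.
elim: d s N => [|d ihd] s N //; elim: N s => [|N ihN] s le //.
rewrite lexlistS pairwise_cat ihN; last by lia.
rewrite pairwise_map; apply/andP; split; last first.
  have := ihd s N.+1 le; congr (is_true _).
  by apply: eq_pairwise => a b /=; rewrite ltmc_add2r.
apply/allrelP => a b; rewrite mem_lexlist; last by lia.
move=> [ha hsa] /mapP[b']; rewrite mem_lexlist // => -[hb hsb] ->.
have lt : (s < n)%N by lia.
have low (c : mono) s' N' (i : 'I_n) : supp_range s' N' c -> (i < s')%N -> c i = 0%N.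
  by move=> h lt'; apply/eqP; apply: contraTT isT => /h; lia.
apply/ltmcP.
  by rewrite ha -[s]/(Ordinal lt : nat) varm_ord mdegD mdeg1 hb.
exists (Ordinal lt) => [i /= hi|].
  rewrite mnmDE varmE (low _ _ _ _ hsa) ?(low _ _ _ _ hsb) //; last by lia.
  by case: eqP => // e; rewrite e ltnn in hi.
by rewrite (low _ _ _ _ hsa) //= mnmDE varmE /= eqxx.
Qed.

Lemma uniq_lexlist d s N : (s + N <= n)%N -> uniq (lexlist d s N).
Proof.
move=> le; apply: pairwise_uniq (pairwise_lexlist d le).
by move=> m; rewrite ltxx.
Qed.

(** The link between monomials and the numerical function [gr]: x is the last of the N + 1
    variables. *)
Lemma lexlist_word d s N (x : 'I_n) : (x = s + N :> nat)%N ->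
  [seq m x == 0%N | m : mono <- lexlist d s N.+1] = lex_word d N.+1.
Proof.
elim: d s N => [|d ihd] s N; first by rewrite /= mnm0E.
elim: N s => [|N ihN] s xs.
  rewrite addn0 in xs; rewrite lexlistS /= -map_comp.
  have : size (lexlist d s 1) = 1%N.
    by rewrite -(size_map (fun m : mono => m x == 0%N)) (ihd s 0%N) ?addn0 // size_lex_word nmon1.
  case: (lexlist d s 1) => [|m [|//]] //= _.
  by rewrite mnmDE varmE xs eqxx.
rewrite lexlistS map_cat ihN ?addSnnS // lex_wordSS; congr (_ ++ _).
rewrite -(ihd s N.+1 xs) -map_comp; apply: eq_map => m /=.
by rewrite mnmDE varmE; case: eqP => //; lia.
Qed.

Lemma size_lexlist d N : (N <= n)%N -> size (lexlist d 0 N) = nmon d N.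
Proof.
case: N => [|N] le; first by case: d => [|d] //=; rewrite nmonS0.
have lt : (N < n)%N by [].
rewrite -size_lex_word -(@lexlist_word d 0 N (Ordinal lt)) ?size_map //.
Qed.

Lemma filter_initial (T : Type) (r : rel T) (P : pred T) s : pairwise r s ->
  (forall a b, r a b -> P b -> P a) -> filter P s = take (count P s) s.
Proof.
move=> + h; elim: s => //= a s ih /andP[ra rs]; case: ifPn => Pa; first by rewrite add1n /= ih.
rewrite add0n ih //; have -> : count P s = 0%N; last by rewrite take0.
apply/eqP; rewrite -leqn0 leqNgt -has_count; apply/negP => hP.
elim: s ra hP {ih rs} => //= b s ih /andP[rab ra] /orP[Pb|/ih]; last exact.
by move/negP: Pa; apply; apply: h rab Pb.
Qed.

Lemma hcountE O d N : (N <= n)%N -> hcount (trunc O N) d = count O (lexlist d 0 N).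
Proof.
move=> le; rewrite /hcount -size_filter.
rewrite cardE -(size_map val); apply: perm_size; apply: uniq_perm.
- by rewrite map_inj_uniq ?enum_uniq //; exact: val_inj.
- by rewrite filter_uniq // uniq_lexlist.
move=> m; rewrite mem_filter; apply/mapP/andP.
  move=> [m']; rewrite mem_enum inE => /andP[/eqP md /truncP[Om h]] ->; split=> //.
  apply/mem_lexlist => //; split=> // i; apply: contraNT => hi; apply/eqP/h.
  by lia.
move=> [Om /mem_lexlist [//|md h]].
have lt : (mdeg m < d.+1)%N by rewrite md.
exists (BMultinom lt) => //; rewrite mem_enum inE /= md eqxx.
apply/truncP; split=> // i hi; apply/eqP; apply: contraTT isT => /h; lia.
Qed.

(** Closed downwards, as O is the complement of a lex segment. *)
Definition lex_closed O N : Prop := forall m m', mdeg m = mdeg m' -> supp_range 0 N m ->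
  (m < m')%O -> O m' -> O m.

Lemma pairwise_mem (T : eqType) (r : rel T) s : pairwise r s ->
  pairwise (fun a b => [&& a \in s, b \in s & r a b]) s.
Proof.
suff aux t : {subset t <= s} -> pairwise r t ->
    pairwise (fun a b => [&& a \in s, b \in s & r a b]) t by exact: aux.
elim: t => //= a t ih H /andP[ra rt]; rewrite ih // => [|b bt]; last first.
  by apply: H; rewrite inE bt orbT.
rewrite andbT; apply/allP => b bt; rewrite !H ?inE ?eqxx ?bt ?orbT //=.
by move/allP: ra; apply.
Qed.

Lemma filter_lexlist O d N : (N <= n)%N -> lex_closed O N ->
  filter O (lexlist d 0 N) = take (count O (lexlist d 0 N)) (lexlist d 0 N).
Proof.
move=> le hO; apply: (filter_initial (pairwise_mem (pairwise_lexlist d (s := 0) le))).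
move=> a b /and3P[/mem_lexlist h1 /mem_lexlist h2 lt].
have [ha sa] := h1 le; have [hb _] := h2 le.
by apply: hO lt; rewrite ?ha ?hb.
Qed.

Lemma hcount_trunc_count O d (x : 'I_n) :
  hcount (trunc O x) d = count (fun m => (m x == 0%N) && O m) (lexlist d 0 x.+1).
Proof.
have le : (x.+1 <= n)%N := ltn_ord x.
rewrite truncS -(@hcountE (fun m => (m x == 0%N) && O m)) //; congr (hcount _ d).
by apply/funext => m; rewrite /trunc andbC andbA.
Qed.

(** Lex segments attain Green's bound with the last variable: their standard monomials form an
    initial segment, and [gr] counts its members without x. *)
Lemma hcount_trunc_lex O d (x : 'I_n) : lex_closed O x.+1 ->
  hcount (trunc O x) d = gr d (hcount (trunc O x.+1) d).
Proof.
move=> hO; have le : (x.+1 <= n)%N := ltn_ord x.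
rewrite (hcountE O d le) hcount_trunc_count.
rewrite (@grE _ x.+1); last by rewrite -size_lexlist // count_size.
by rewrite -(@lexlist_word d 0 x x) // -map_take -filter_lexlist // count_map count_filter.
Qed.

Lemma hcount_trunc_iter O N d p : (p <= N <= n)%N -> lex_closed O N ->
  hcount (trunc O (N - p)) d = iter p (gr d) (hcount (trunc O N) d).
Proof.
move=> + hO; elim: p => [|p ih] /andP[pN Nn]; first by rewrite subn0.
have lt : (N - p.+1 < n)%N by lia.
rewrite iterS -ih; last by rewrite (ltnW pN).
have -> : (N - p)%N = (Ordinal lt).+1 by rewrite /=; lia.
rewrite -(@hcount_trunc_lex O d (Ordinal lt)) // => m m' e hs; apply: hO => //.
by move=> i /hs /=; lia.
Qed.

Lemma div_closed_var O : (forall i m, O (U_(i) + m)%MM -> O m) -> div_closed O.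
Proof.
move=> h m m'; have [k] := ubnP (mdeg m'); elim: k m m' => // k ih m m' lt Om.
have [m0|m0] := posnP (mdeg m').
  by move: Om; move/eqP: m0; rewrite mdeg_eq0 => /eqP ->; rewrite addm0.
have [i hi] : exists i, (0 < m' i)%N by apply: (@mdegS_exists _ _ (mdeg m').-1); rewrite prednK.
have mE := mnm_subK hi; apply: (ih m (m' - U_(i))%MM).
  by move: lt; rewrite {1}mE mdegD mdeg1 add1n ltnS.
by apply: (h i); rewrite addmA [(U_(i) + m)%MM]addmC -addmA -mE.
Qed.

Definition lexO (h : nat -> nat) (N : nat) : pred mono :=
  fun m => m \in take (h (mdeg m)) (lexlist (mdeg m) 0 N).

Lemma take_pairwise_initial (T : eqType) (r : rel T) s c a b : pairwise r s -> irreflexive r ->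
  transitive r -> a \in s -> r a b -> b \in take c s -> a \in take c s.
Proof.
move=> pr ir tr; elim: s c pr => // x s ih [|c] //= /andP[rx rs].
rewrite !inE => /predU1P[->|ma] rab; first by rewrite eqxx.
move=> /predU1P[e|mb]; last by rewrite (ih c) ?orbT.
by have := tr _ _ _ (allP rx _ ma) rab; rewrite e ir.
Qed.

Section LexO.
Variables (h : nat -> nat) (N : nat).
Hypothesis leN : (N <= n)%N.

Lemma lexO_supp m : lexO h N m -> supp_range 0 N m.
Proof. by move=> /mem_take /mem_lexlist H; have [] := H leN. Qed.

Lemma lexO_closed : lex_closed (lexO h N) N.
Proof.
move=> m m' e hs lt; rewrite /lexO -e.
apply: (take_pairwise_initial (pairwise_lexlist (mdeg m) (s := 0) leN) _ _ _ lt).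
- by move=> a; rewrite ltxx.
- by move=> b a c; exact: lt_trans.
- by apply/mem_lexlist.
Qed.

Lemma lexO_hcount d : (h d <= nmon d N)%N -> hcount (trunc (lexO h N) N) d = h d.
Proof.
move=> hd; rewrite hcountE //.
have u := uniq_lexlist d (s := 0) leN.
transitivity (count (mem (take (h d) (lexlist d 0 N))) (lexlist d 0 N)).
  by apply: eq_in_count => m /mem_lexlist H; have [md _] := H leN; rewrite /lexO md.
rewrite -size_filter -[RHS](size_takel (s := lexlist d 0 N)) ?size_lexlist //.
apply: perm_size; apply: uniq_perm; rewrite ?filter_uniq ?take_uniq // => m.
by rewrite mem_filter andb_idr //; exact: mem_take.
Qed.

Lemma trunc_lexO : trunc (lexO h N) N = lexO h N.
Proof.
apply/funext => m; apply/truncP/idP => [[]|Om] //; split=> // i le.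
by apply/eqP; apply: contraTT isT => /(lexO_supp Om); lia.
Qed.

Hypothesis hN : forall d, (h d <= nmon d N)%N.
Hypothesis macN : forall d, (lo d.+1 (h d.+1) <= h d)%N.

(** Replacing x_i by the last variable x gives a smaller or equal monomial, so only division by x
    matters. The m' of degree d with x m' standard form an initial segment of length at most
    [lo d.+1 (h d.+1) <= h d]. *)
Lemma lexO_down_var m (i : 'I_n) : lexO h N (U_(i) + m)%MM -> lexO h N m.
Proof.
move=> Om; have hs := lexO_supp Om; have hsm : supp_range 0 N m.
  by move=> k mk; apply: hs; rewrite mnmDE addn_eq0 negb_and mk orbT.
have iN : (i < N)%N by have := hs i; rewrite mnmDE mnm1E eqxx; apply.
have N0 : (0 < N)%N by lia.
have lt : (N.-1 < n)%N by lia.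
pose x := Ordinal lt.
have Ox : lexO h N (U_(x) + m)%MM.
  have [->|ix] := eqVneq x i; first by [].
  apply: lexO_closed Om; first by rewrite !mdegD !mdeg1.
    move=> k; rewrite mnmDE mnm1E; case: (x =P k) => [<- _|_]; first by rewrite /=; lia.
    by rewrite add0n; exact: hsm.
  rewrite ltmc_add2l; apply/ltmcP; first by rewrite !mdeg1.
  have ltix : (i < x)%N.
    by rewrite ltn_neqAle eq_sym -(inj_eq val_inj) in ix *; rewrite ix /=; lia.
  exists i; last by rewrite !mnm1E eqxx (negbTE ix).
  move=> k ki; rewrite !mnm1E; have -> : (i == k) = false by apply/eqP => e; rewrite e ltnn in ki.
  by apply/eqP; rewrite eqb0; apply/eqP => e; rewrite -e in ki; lia.
set d := mdeg m.
pose Q := fun m' : mono => lexO h N (U_(x) + m')%MM.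
have cQ : lex_closed Q N.
  move=> m1 m2 e h1 lt12; rewrite /Q; apply: lexO_closed.
  - by rewrite !mdegD e.
  - move=> k; rewrite mnmDE mnm1E; case: (x =P k) => [<- _|_]; first by rewrite /=; lia.
    by rewrite add0n; exact: h1.
  - by rewrite ltmc_add2r.
have dE (m1 : mono) : mdeg (U_(x) + m1) = (mdeg m1).+1 by rewrite mdegD mdeg1 add1n.
have mL : m \in lexlist d 0 N by apply/mem_lexlist.
have : m \in filter Q (lexlist d 0 N) by rewrite mem_filter mL andbT.
rewrite filter_lexlist // => mt; rewrite /lexO -/d.
suff le : (count Q (lexlist d 0 N) <= h d)%N.
  by have := mem_take (n0 := count Q (lexlist d 0 N)) (s := take (h d) (lexlist d 0 N));
    rewrite take_takel // => /(_ _ mt).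
apply: leq_trans (macN d); rewrite /lo.
have e1 := lexO_hcount (hN d.+1).
have xN : x.+1 = N by exact: prednK.
have cx : lex_closed (lexO h N) x.+1 by rewrite xN; exact: lexO_closed.
have := hcount_trunc_lex d.+1 cx; rewrite hcount_trunc_count xN e1 => <-.
rewrite hcountE // in e1; set O := lexO h N in e1 *; set L := lexlist d.+1 0 N in e1 *.
have -> : (h d.+1 - count (fun m1 : mono => (m1 x == 0%N) && O m1) L)%N =
    count (fun m1 : mono => (m1 x != 0%N) && O m1) L.
  rewrite -e1 -size_filter -(count_predC (fun m1 : mono => m1 x == 0%N)) !count_filter addKn.
  by apply: eq_count.
rewrite -!size_filter -(size_map (fun m1 => (U_(x) + m1)%MM)); apply: uniq_leq_size.
  rewrite map_inj_uniq ?filter_uniq ?uniq_lexlist // => m1 m2.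
  by rewrite addmC [in RHS]addmC; exact: addIm.
move=> m1 /mapP[m2]; rewrite !mem_filter => /andP[Q2 /mem_lexlist H] ->.
have [md2 hs2] := H leN.
rewrite (Q2 : is_true (O (U_(x) + m2)%MM)) andbT mnmDE mnm1E eqxx /=.
apply/mem_lexlist => //; split; first by rewrite dE md2.
exact: lexO_supp Q2.
Qed.

Lemma lexO_down : div_closed (lexO h N).
Proof. by apply: div_closed_var => i m; exact: lexO_down_var. Qed.

Lemma lexO_stable (s x : 'I_n) m : (s < x < N)%N ->
  lexO h N (m + U_(s))%MM -> lexO h N (m + U_(x))%MM.
Proof.
move=> /andP[sx xN] Om; apply: lexO_closed (Om); first by rewrite !mdegD !mdeg1.
  have hs := lexO_supp Om; move=> k; rewrite mnmDE mnm1E; case: (x =P k) => [<- _|_].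
    by rewrite add0n.
  by rewrite addn0 => mk; apply: hs; rewrite mnmDE addn_eq0 negb_and mk.
rewrite ltmc_add2r; apply/ltmcP; first by rewrite !mdeg1.
have ne : (x == s) = false by apply/eqP => e; rewrite e ltnn in sx.
exists s; last by rewrite !mnm1E eqxx ne.
move=> k ks; rewrite !mnm1E.
have -> : (s == k) = false by apply/eqP => e; rewrite e ltnn in ks.
by have -> : (x == k) = false by apply/eqP => e; rewrite -e in ks; lia.
Qed.

Lemma lexO0 : h 0%N = 1%N -> lexO h N 0%MM.
Proof. by move=> h0; rewrite /lexO mdeg0 h0 /= inE. Qed.

End LexO.

End LexSegments.

(** * Betti numbers of lex ideals *)

Lemma eq_EK_sum n (H H' : nat -> nat -> nat) i j :
  (forall m, (m <= n)%N -> H m =1 H' m) -> EK_sum n H i j = EK_sum n H' i j.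
Proof.
move=> e; rewrite /EK_sum; congr (_ + _)%N; apply: eq_big_nat => m /andP[_ lt].
by rewrite /nu_of !e // ltnW.
Qed.

Section MonomialPred.
Variables (K : fieldType) (n : nat).
Local Notation R := {mpoly K[n]}.
Implicit Types (O : pred 'X_{1..n}).

Lemma homog_artinian (I : {pred R}) D : homog_ideal I ->
  (forall d, (D <= d)%N -> hilb I d = 0%N) -> artinian_quot I.
Proof.
move=> hI h0; have gI := homog_ideal_gideal hI; have sI := gideal_subspace gI.
pose T : finType := 'X_{1..n < D}.
exists #|T|, (fun l => 'X_[val (enum_val l : T)]) => p.
exists (fun l => p@_(val (enum_val l : T))).
rewrite -(big_enum_val (fun m : T => p@_(val m) *: 'X_[val m])) /=.
set q := \sum_(m in _) _.
have qE m : q@_m = if (mdeg m < D)%N then p@_m else 0.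
  rewrite raddf_sum /=; case: ltnP => lt.
    rewrite (bigD1 (BMultinom lt)) //= mcoeffZ mcoeffX eqxx mulr1 big1 ?addr0 //.
    move=> m' ne; rewrite mcoeffZ mcoeffX; case: eqP => [e|_]; last by rewrite mulr0.
    by case/eqP: ne; apply: val_inj.
  rewrite big1 // => m' _; rewrite mcoeffZ mcoeffX; case: eqP => [e|_]; last by rewrite mulr0.
  by have := bmdeg m'; rewrite e ltnNge lt.
rewrite (pihomog_partitionE (leqnn (mmeasure mdeg (p - q)))).
apply: (subspace_sum sI) => d _; case: (ltnP d D) => le; last first.
  by apply: (HF_eq0P sI (h0 d le)); exact: pihomogP.
rewrite (_ : pihomog _ _ _ = 0); first exact: sI.1.
apply/mpolyP => m; rewrite mcoeff_pihomog mcoeffB qE mcoeff0.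
by case: eqP => // ->; rewrite le subrr.
Qed.

Lemma artinian_hilb0 (I : {pred R}) : graded_artinian I ->
  exists D, forall d, (D <= d)%N -> hilb I d = 0%N.
Proof.
move=> hI; have [N [b [dg [_ _ _ bh]]]] := artinian_basis hI.
exists (\max_l dg l).+1 => d le.
rewrite hilbE; apply: HF_eq0 => [|p hp].
  exact: gideal_subspace (homog_ideal_gideal hI.1).
have [c c0] := bh d p hp; rewrite big1 ?subr0 // => l _.
have [->|/c0 e] := eqVneq (c l) 0; first by rewrite scale0r.
by move: le; rewrite -e ltnNge (leq_bigmax l).
Qed.

Definition monI_pred O : {pred R} := fun p => `[< monI O p >].

Lemma monI_predE O : (fun p => p \in monI_pred O) = monI O :> (R -> Prop).
Proof. by apply/funext => p; apply/propext; split=> /asboolP. Qed.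

Lemma monI_homog_ideal O : div_closed O -> O 0%MM -> homog_ideal (monI_pred O).
Proof.
move=> dO O0; have gO := monI_gideal K dO; have sO := gideal_subspace gO.
split; first split.
- by apply/asboolP; exact: sO.1.
- by apply/asboolP; exact: monI_not1.
- move=> a p q /asboolP hp /asboolP hq; apply/asboolP.
  by apply: (subspaceD sO) => //; exact: (gidealM gO).
- by move=> p d /asboolP hp; apply/asboolP; exact: (gideal_pihomog gO).
Qed.

Lemma hilb_monI O : hilb (monI_pred O) =1 hcount O.
Proof. by move=> d; rewrite hilbE monI_predE HF_monI. Qed.

Lemma monI_X O m : monI O ('X_[m] : R) <-> ~~ O m.
Proof.
split=> [h|nO m' Om']; last by rewrite mcoeffX; case: eqP => // e; rewrite e Om' in nO.
by apply/negP => /h /eqP; rewrite mcoeffX eqxx oner_eq0.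
Qed.

Lemma monI_monomial O : div_closed O -> O 0%MM -> monomial_ideal (monI_pred O).
Proof.
move=> dO O0; split; first by case: (monI_homog_ideal dO O0).
exists [set m : 'X_{1..n} | ~~ O m]%classic => p; apply/asboolP/asboolP => [hp|[r [c [f [hf ->]]]]]; last first.
  have gO := monI_gideal K dO; apply: (subspace_sum (gideal_subspace gO)) => l _.
  by apply: (gidealM gO); have [m /= nO <-] := hf l; apply/monI_X.
exists (size (msupp p)), (fun l => (p@_(tnth (in_tuple (msupp p)) l))%:MP),
  (fun l => 'X_[tnth (in_tuple (msupp p)) l]); split.
  move=> l; set m := tnth _ _; exists m => //=; apply/negP => Om.
  have : m \in msupp p by exact: mem_tnth.
  by rewrite mcoeff_msupp hp ?eqxx.
rewrite {1}(mpolyE p) (big_tnth _ _ (msupp p)); apply: eq_bigr => l _.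
by rewrite mul_mpolyC.
Qed.

Section LexSegmentIdeal.
Variable J : {pred R}.
Hypothesis hJ : lex_segment J.

Definition std : pred 'X_{1..n} := fun m => 'X_[m] \notin J.

(** A monomial ideal contains a polynomial exactly when it contains all its monomials, so J is
    determined by [std]. *)
Lemma std_monI : J =i monI_pred std.
Proof.
have [[[J0 J1 JM] [M hM]] _] := hJ.
have JD p q : p \in J -> q \in J -> p + q \in J.
  by move=> hp hq; rewrite -[p]mul1r; exact: JM.
have Jm p q : q \in J -> p * q \in J.
  by move=> hq; rewrite -[_ * _]addr0; exact: JM.
move=> p; apply/idP/asboolP => [|hp].
  rewrite hM => /asboolP[r [c [f [hf ->]]]] m sm; rewrite raddf_sum big1 // => l _ /=.
  have [m' Mm' <-] := hf l; apply: memN_msupp_eq0; apply/negP.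
  rewrite (perm_mem (msuppMX _ _)) => /mapP[m1 _ e].
  case/negP: sm; rewrite e addmC mpolyXD; apply: Jm; rewrite hM; apply/asboolP.
  exists 1%N, (fun=> 1), (fun=> 'X_[m']); split; first by move=> _; exists m'.
  by rewrite big_ord1 mul1r.
rewrite (mpolyE p); apply: (big_ind (fun q : R => q \in J)) => // m _.
have [->|nz] := eqVneq p@_m 0; first by rewrite scale0r.
rewrite -mul_mpolyC; apply: Jm; apply: contraNT nz => h.
by apply/eqP/hp.
Qed.

Lemma std_down : div_closed std.
Proof.
have [[[J0 J1 JM] _] _] := hJ; move=> m m'; apply: contraNN => h.
by rewrite mpolyXD mulrC -[_ * _]addr0; exact: JM.
Qed.

Lemma std0 : std 0%MM.
Proof. by have [[[J0 J1 JM] _] _] := hJ; rewrite /std mpolyX0. Qed.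

Lemma std_lex_closed N : lex_closed std N.
Proof.
move=> m m' e _ lt; apply: contraNN => h; have [_ H] := hJ.
by apply: H h => //; exact: ltW.
Qed.

Lemma std_stable : stable std.
Proof.
move=> s x m sx; apply: (std_lex_closed (N := n)); first by rewrite !mdegD !mdeg1.
  by move=> k _; rewrite /= add0n.
rewrite ltmc_add2r; apply/ltmcP; first by rewrite !mdeg1.
have ne : (x == s) = false by apply/eqP => e; rewrite e ltnn in sx.
exists s; last by rewrite !mnm1E eqxx ne.
move=> k ks; rewrite !mnm1E.
have -> : (s == k) = false by apply/eqP => e; rewrite e ltnn in ks.
by have -> : (x == k) = false by apply/eqP => e; rewrite -e in ks; lia.
Qed.

End LexSegmentIdeal.

(** Macaulay's conditions for the Hilbert function of a quotient in n variables, in the form that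
    [lexO] consumes. *)
Definition macaulay_seq (h : nat -> nat) : Prop :=
  [/\ h 0%N = 1%N, forall d, (h d <= nmon d n)%N & forall d, (lo d.+1 (h d.+1) <= h d)%N].

Lemma lex_ideal_exists h : macaulay_seq h ->
  exists J : {pred R}, lex_segment J /\ hilb J =1 h.
Proof.
move=> [h0 hn hm]; have dO := lexO_down (leqnn n) hn hm.
have O0 := lexO0 n n h0.
exists (monI_pred (lexO h n)); split.
  split; first exact: monI_monomial.
  move=> m m' e; rewrite le_eqVlt => /predU1P[-> //|lt] /asboolP/monI_X nO.
  apply/asboolP/monI_X; apply: contraNN nO; apply: (lexO_closed (leqnn n)) => //.
  by move=> k _; rewrite /= add0n.
by move=> d; rewrite hilb_monI -[X in hcount X]trunc_full lexO_hcount.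
Qed.

Hypothesis hK : [pchar K] =i pred0.

(** A lex ideal is stable, and every variable removed from the end applies [gr] once. *)
Lemma betti_lexE h D i j : macaulay_seq h -> (forall d, (D <= d)%N -> h d = 0%N) ->
  betti_lex K n h i (i + j) = EK_sum n (fun m d => iter (n - m) (gr d) (h d)) i j.
Proof.
move=> mh h0; rewrite /betti_lex.
have [] : lex_segment (lex_ideal K n h) /\ hilb (lex_ideal K n h) =1 h.
  exact: (getPex (lex_ideal_exists mh)).
move: (lex_ideal K n h) => J hJ hh.
have J0 : homog_ideal J.
  split=> [|p d]; first by have [[hJ0 _] _] := hJ.
  by rewrite !(std_monI hJ); exact: (monI_homog_ideal (std_down hJ) (std0 hJ)).2.
have aJ : graded_artinian J.
  by split=> //; apply: (homog_artinian (D := D)) => // d /h0; rewrite hh.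
have e : monI (std J) = (fun p => p \in J) :> (R -> Prop).
  by rewrite -monI_predE; apply/funext => p; rewrite (std_monI hJ).
rewrite (eliahou_kervaire hK i j aJ e (std_down hJ) (std_stable hJ) (std0 hJ)).
apply: eq_EK_sum => m le d.
rewrite -{1}(subKn le) hcount_trunc_iter ?leq_subr ?leqnn //; last exact: std_lex_closed.
congr (iter _ _ _); rewrite trunc_full -hh -hilb_monI.
by rewrite !hilbE monI_predE e.
Qed.

End MonomialPred.

(** * Algebras with the k-WLP *)

Section DropSum.

(** For h = [H m.+1], nu becomes h_j + max(h_(j+1) - h_j, 0) - h_(j+1), which is max(h_j - h_(j+1),
    0). *)
Lemma nu_drop (H : nat -> nat -> nat) m j :
  H m =1 delta (H m.+1) -> nu_of H m j = drop_seq (H m.+1) j.+1.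
Proof. by move=> e; rewrite /nu_of e /delta /drop_seq; lia. Qed.

Lemma EK_sum_drop (H : nat -> nat -> nat) (h : nat -> nat) n k i j : (k <= n)%N ->
  (forall p, (p <= k)%N -> H (n - p)%N =1 iter p delta h) ->
  EK_sum n H i j = (EK_sum (n - k) H i j + drop_sum n k h i j)%N.
Proof.
move=> kn hH; rewrite /EK_sum (big_cat_nat (n := n - k)) ?leq_subr //= addnA.
suff -> : (\sum_(n - k <= m < n) bin_pred m i * nu_of H m j)%N = drop_sum n k h i j by [].
rewrite /drop_sum; elim: k kn hH => [|k ih] kn hH; first by rewrite subn0 !big_geq.
rewrite big_nat_recr //= big_ltn; last by lia.
have e : (n - k.+1).+1 = (n - k)%N by lia.
rewrite e ih 1?ltnW //; last by move=> p pk; apply: hH; exact: leqW.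
rewrite addnC nu_drop e; last by move=> d; rewrite hH // /= /delta; case: d => [|d]; rewrite !hH.
by rewrite /drop_seq !(hH k (leqnSn k)).
Qed.

End DropSum.

Section Flags.
Variables (K : fieldType) (n : nat).
Local Notation R := {mpoly K[n]}.
Hypothesis hK : [pchar K] =i pred0.

Lemma ideal_genP (S : set R) (W : R -> Prop) : W 0 -> (forall p q, W p -> W q -> W (p + q)) ->
  (forall p q, W q -> W (p * q)) -> (forall p, S p -> W p) ->
  forall p, p \in ideal_gen S -> W p.
Proof.
move=> W0 WD WM SW p /asboolP[r [c [f [hf ->]]]].
by apply: (big_ind W) => // l _; apply/WM/SW.
Qed.

Lemma ideal_gen_sub (S : set R) p : S p -> p \in ideal_gen S.
Proof.
move=> Sp; apply/asboolP; exists 1%N, (fun=> 1), (fun=> p); split=> //.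
by rewrite big_ord1 mul1r.
Qed.

Lemma ideal_gen0 (S : set R) : 0 \in ideal_gen S.
Proof.
apply/asboolP; exists 0%N, (fun=> 0), (fun=> 0); split=> [[]//|].
by rewrite big_ord0.
Qed.

Lemma ideal_genD (S : set R) p q : p \in ideal_gen S -> q \in ideal_gen S ->
  p + q \in ideal_gen S.
Proof.
move=> /asboolP[r [c [f [hf ->]]]] /asboolP[r' [c' [f' [hf' ->]]]]; apply/asboolP.
exists (r + r')%N, (fun l => match fintype.split l with inl x => c x | inr x => c' x end),
  (fun l => match fintype.split l with inl x => f x | inr x => f' x end); split.
  by move=> l; case: fintype.split.
rewrite big_split_ord; congr (_ + _); apply: eq_bigr => x _.
  by rewrite (unsplitK (inl x)).
by rewrite (unsplitK (inr x)).
Qed.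

Lemma ideal_genM (S : set R) p q : q \in ideal_gen S -> p * q \in ideal_gen S.
Proof.
move=> /asboolP[r [c [f [hf ->]]]]; apply/asboolP; exists r, (fun l => p * c l), f; split=> //.
by rewrite mulr_sumr; apply: eq_bigr => l _; rewrite mulrA.
Qed.

Lemma adjoin_nil (I : {pred R}) : homog_ideal I ->
  (fun p => p \in adjoin I [::]) = (fun p => p \in I) :> (R -> Prop).
Proof.
move=> hI; have gI := homog_ideal_gideal hI; case: (gI) => I0 ID IM _.
apply/funext => p; apply/propext; split; last by move=> Ip; apply: ideal_gen_sub; left.
by apply: (ideal_genP (W := fun p => p \in I)) => // q [|].
Qed.

Lemma adjoin_rcons (I : {pred R}) (s : seq R) (l : R) :
  (fun p => p \in adjoin I (rcons s l)) = plus (fun p => p \in adjoin I s) l :> (R -> Prop).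
Proof.
apply/funext => p; apply/propext; split=> [|[q hq]].
  apply: ideal_genP => [|p1 p2 [q1 h1] [q2 h2]|p1 p2 [q hq]|p1].
  - by exists 0; rewrite mulr0 subr0; exact: ideal_gen0.
  - by exists (q1 + q2); rewrite mulrDr opprD addrACA; exact: ideal_genD.
  - by exists (p1 * q); rewrite mulrCA -mulrBr; exact: ideal_genM.
  - case=> [h|].
      by exists 0; rewrite mulr0 subr0; apply: ideal_gen_sub; left.
    rewrite mem_rcons inE => /predU1P[->|h].
      by exists 1; rewrite mulr1 subrr; exact: ideal_gen0.
    by exists 0; rewrite mulr0 subr0; apply: ideal_gen_sub; right.
rewrite -(subrK (l * q) p) mulrC; apply: ideal_genD; last first.
  apply/ideal_genM/ideal_gen_sub; right; rewrite mem_rcons inE eqxx //.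
rewrite mulrC; move: hq; apply: (ideal_genP (W := fun p => p \in adjoin I (rcons s l))) => [|p1 p2|p1 p2|p1].
- exact: ideal_gen0.
- exact: ideal_genD.
- exact: ideal_genM.
- case=> h; apply: ideal_gen_sub; first by left.
  by right; rewrite mem_rcons inE h orbT.
Qed.

Section Flag.
Variable I : {pred R}.
Hypothesis hI : graded_artinian I.

(** The forms are given by coefficient rows, so that their independence is a rank condition. *)
Fixpoint flag (a : nat -> 'rV[K]_n) (q : nat) : R -> Prop :=
  match q with
  | 0 => fun p => p \in I
  | q'.+1 => plus (flag a q') (lf (a q'))
  end.

Definition flag_mx (a : nat -> 'rV[K]_n) (q : nat) : 'M[K]_(q, n) := \matrix_(i < q) a i.

Lemma flag_gideal a q : gideal (flag a q) /\ ~ flag a q 1.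
Proof.
elim: q => [|q [g1 g2]].
  by split; [exact: homog_ideal_gideal hI.1|case: hI => [[[]]]; move=> _ /negP].
by split; [apply: (plus_gideal g1 (lf_form _))|apply: (plus_not1 g1 (lf_form _))].
Qed.

Lemma flag_ext a a' q : (forall i, (i < q)%N -> a i = a' i) -> flag a q = flag a' q.
Proof.
elim: q => //= q ih h; rewrite ih ?h // => i lt; apply: h; exact: leqW.
Qed.

Lemma flag_mx_ext a a' q : (forall i, (i < q)%N -> a i = a' i) -> flag_mx a q = flag_mx a' q.
Proof. by move=> h; apply/row_matrixP => i; rewrite !rowK h. Qed.

Lemma flag_mxS a q : (flag_mx a q.+1 :=: flag_mx a q + a q)%MS.
Proof.
apply/eqmxP/andP; split.
  apply/row_subP => i; rewrite rowK; have := ltn_ord i; rewrite ltnS leq_eqVlt.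
  move=> /predU1P[->|lt]; first exact: addsmxSr.
  apply: submx_trans (addsmxSl _ _); apply: (eq_row_sub (Ordinal lt)); by rewrite rowK.
rewrite addsmx_sub; apply/andP; split.
  apply/row_subP => i; rewrite rowK.
  by apply: (eq_row_sub (widen_ord (leqnSn q) i)); rewrite rowK.
by apply: (eq_row_sub ord_max); rewrite rowK.
Qed.

Lemma flag_mx_free a q : row_free (flag_mx a q) -> ~~ (a q <= flag_mx a q)%MS ->
  row_free (flag_mx a q.+1).
Proof.
rewrite /row_free => /eqP r h; rewrite eqn_leq rank_leq_row /= -{1}r flag_mxS.
apply: rank_ltmx; rewrite /ltmx addsmxSl /=; apply: contraNN h => h.
exact: submx_trans (addsmxSr _ _) h.
Qed.

Lemma flag_lf a q (b : 'rV_n) : (b <= flag_mx a q)%MS -> flag a q (lf b).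
Proof.
elim: q b => [|q ih] b.
  move=> /submxP[w ->]; rewrite (_ : _ *m _ = 0); last by apply/rowP => j; rewrite !mxE big_ord0.
  rewrite (lin0 (@lf_is_linear K n)).
  exact: gideal0 (homog_ideal_gideal hI.1).
rewrite flag_mxS => /sub_addsmxP[[u v] /= ->].
have s := gideal_subspace (flag_gideal a q.+1).1.
rewrite (linD (@lf_is_linear K n)); apply: (subspaceD s).
  by apply: plus_sub; apply: ih; exact: submxMl.
rewrite (_ : v *m a q = v 0 0 *: a q).
  rewrite (linZ (@lf_is_linear K n)); apply: (subspaceZ s) => /=.
  by exists 1; rewrite mulr1 subrr; exact: gideal0 (flag_gideal a q).1.
by apply/rowP => j; rewrite !mxE big_ord1.
Qed.

Lemma flag_HF_le a q d : (HF (flag a q) d <= hilb I d)%N.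
Proof.
elim: q => [|q ih] //=; apply: leq_trans ih.
apply: HF_plus_le; [exact: (flag_gideal a q).1|exact: lf_form].
Qed.

Lemma flag_HF1 a q : row_free (flag_mx a q) -> (HF (flag a q) 1 <= n - q)%N.
Proof.
move=> /eqP r; have s := gideal_subspace (flag_gideal a q).1.
have := qdim_rows (submx1 (flag_mx a q)); rewrite mxrank1 r => Q.
have [|||r' le /(HF_unique s) ->//] := qdim_surj (P' := hform 1) (@lf_is_linear K n) _ s _ _ Q.
- by split=> [|x u v hu hv]; [exact: sub0mx|rewrite addmx_sub ?scalemx_sub].
- by move=> b _ hb; exact: flag_lf.
- move=> p hp; exists (\row_i p@_U_(i)); first exact: submx1.
  by rewrite -lf_coeff // subrr; exact: s.1.
Qed.

Definition wlp_upto (a : nat -> 'rV[K]_n) (q : nat) : Prop :=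
  row_free (flag_mx a q) /\ forall r, (r < q)%N -> HF (flag a r.+1) =1 delta (HF (flag a r)).

Definition upd (a : nat -> 'rV[K]_n) q b : nat -> 'rV[K]_n := fun i => if i == q then b else a i.

Lemma upd_lt a q b i : (i < q)%N -> upd a q b i = a i.
Proof. by move=> lt; rewrite /upd ltn_eqF. Qed.

Lemma wlp_upto_upd a q b : wlp_upto a q -> ~~ (b <= flag_mx a q)%MS ->
  HF (plus (flag a q) (lf b)) =1 delta (HF (flag a q)) -> wlp_upto (upd a q b) q.+1.
Proof.
move=> [fr h] hb hd; have e i : (i < q)%N -> upd a q b i = a i by exact: upd_lt.
have em := flag_mx_ext e; have u : upd a q b q = b by rewrite /upd eqxx.
split; first by apply: flag_mx_free; rewrite ?em ?u.
move=> r; rewrite ltnS leq_eqVlt => /predU1P[->|lt].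
  by move=> d /=; rewrite u (flag_ext e) hd.
have e' i : (i < r.+1)%N -> upd a q b i = a i by move=> le; apply: e; exact: leq_trans lt.
rewrite (flag_ext e') (@flag_ext _ a r) => [|i /ltnW]; [exact: h|exact: e'].
Qed.

Lemma row_outside q (M : 'M[K]_(q, n)) : (\rank M < n)%N -> exists b : 'rV_n, ~~ (b <= M)%MS.
Proof.
move=> rM; have : ~~ (1%:M <= M)%MS by rewrite sub1mx -col_leq_rank -ltnNge.
by move/row_subPn => [i hi]; exists (row i 1%:M).
Qed.

Lemma HF_trivial (W : R -> Prop) : gideal W -> ~ W 1 -> (forall p, hform 1 p -> W p) ->
  HF W =1 (fun d => (d == 0)%N : nat).
Proof.
move=> gW W1 h [|d]; first by rewrite HF0.
apply: HF_pos_eq0 => // x; apply: h; exact: X_form1.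
Qed.

(* The forms given by the k-WLP may be linearly dependent, but then a quotient has
   become K and any independent form continues the flag. *)
Lemma wlp_flag k : (k <= n)%N -> kWLP k I -> exists a, wlp_upto a k.
Proof.
move=> kn [g [gf gw]].
suff H q : (q <= k)%N -> exists a, wlp_upto a q /\
    (flag a q = (fun p => p \in adjoin I (take q g)) \/ forall p, hform 1 p -> flag a q p).
  by have [a [ha _]] := H k (leqnn k); exists a.
elim: q => [_|q ih lt].
  exists (fun=> 0); split; first by split=> //; rewrite /row_free mxrank.unlock.
  by left; rewrite take0 adjoin_nil //; exact: hI.1.
have [a [wa ha]] := ih (ltnW lt); have [gq q1] := flag_gideal a q.
have rk : (\rank (flag_mx a q) < n)%N by apply: leq_ltn_trans (rank_leq_row _) _; lia.
have sq := gideal_subspace gq.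
have triv : (forall p, hform 1 p -> flag a q p) -> exists a, wlp_upto a q.+1 /\
    (flag a q.+1 = (fun p => p \in adjoin I (take q.+1 g)) \/ forall p, hform 1 p -> flag a q.+1 p).
  move=> all1; have [b hb] := row_outside rk; exists (upd a q b).
  have e i : (i < q)%N -> upd a q b i = a i by exact: upd_lt.
  have u : upd a q b q = b by rewrite /upd eqxx.
  split; last by right=> p hp /=; rewrite u (flag_ext e); apply: plus_sub; exact: all1.
  apply: wlp_upto_upd => // d.
  rewrite (HF_trivial (plus_gideal gq (lf_form b)) (plus_not1 gq (lf_form b) q1)); last first.
    by move=> p hp; apply: plus_sub; exact: all1.
  by rewrite /delta (HF_trivial gq q1 all1); case: d.
case: ha => [ha|]; last exact: triv.
pose x := Ordinal lt; pose b : 'rV[K]_n := \row_i (tnth g x)@_U_(i).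
have lE : lf b = tnth g x by rewrite -lf_coeff.
have wx i : full (flag a q) (lf b) i.
  by rewrite lE; have := gw x i; rewrite /full_rank /full ha addn1.
(* If the form depends on the previous ones, multiplication by it is zero on the quotient. It is not
   injective in degree 0, where 1 survives, so full rank makes degree 1 vanish. *)
have [bM|bM] := boolP (b <= flag_mx a q)%MS.
  apply: triv => p hp; have hb := flag_lf bM.
  case: (wx 0%N) => [inj|/(_ p hp) [r _ h]].
    case: q1; apply: inj; first exact: dhomog1.
    by rewrite mulr1.
  by rewrite -(subrK (lf b * r) p) mulrC; apply: (subspaceD sq); [rewrite mulrC|apply: gidealM].
exists (upd a q b); split; first by apply: wlp_upto_upd => //; apply: HF_plus_full => //; exact: lf_form.
left; have e i : (i < q)%N -> upd a q b i = a i by exact: upd_lt.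
rewrite /= /upd eqxx (flag_ext e) ha lE -adjoin_rcons (take_nth 0) ?size_tuple //.
by rewrite (tnth_nth 0).
Qed.

(** Green forms continue the flag, each chosen outside the span of the previous ones; for q = n all
    forms together are a coordinate system. *)
Lemma generic_flag a k : wlp_upto a k -> forall q, (k <= q <= n)%N ->
  exists a', [/\ forall i, (i < k)%N -> a' i = a i, row_free (flag_mx a' q) &
    forall r d, (k <= r < q)%N -> (HF (flag a' r.+1) d <= gr d (HF (flag a' r) d))%N].
Proof.
move=> [fr _]; have [D hD] := artinian_hilb0 hI.
elim=> [|q ih] /andP[kq qn].
  by exists a; split=> //; [move: kq; rewrite leqn0 => /eqP <-|move=> r d; lia].
move: kq; rewrite leq_eqVlt => /predU1P[e|kq].
  by exists a; split=> //; [rewrite -e|move=> r d; lia].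
have [|a' [e1 f1 h1]] := ih; first by lia.
have gq := (flag_gideal a' q).1.
have [||b hb hd] := generic_form hK (D := D) (M := flag_mx a' q) gq.
- by apply: leq_ltn_trans (rank_leq_row _) _.
- by move=> d le; apply/eqP; rewrite -leqn0 -(hD d le) flag_HF_le.
have e i : (i < q)%N -> upd a' q b i = a' i by exact: upd_lt.
have u : upd a' q b q = b by rewrite /upd eqxx.
exists (upd a' q b); split.
- by move=> i lt; rewrite e ?e1 //; apply: leq_trans lt _.
- by apply: flag_mx_free; rewrite ?(flag_mx_ext e) ?u.
- move=> r d /andP[kr]; rewrite ltnS leq_eqVlt => /predU1P[->|lt].
    rewrite /= u (flag_ext e); case: d => [|d]; last exact: hd.
    rewrite HF_plus0 ?lf_form // HF0 //; exact: (flag_gideal a' q).2.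
  have e' i : (i < r.+1)%N -> upd a' q b i = a' i by move=> le; apply: e; exact: leq_trans lt.
  rewrite (flag_ext e') (@flag_ext _ a' r) => [|i /ltnW]; [|exact: e'].
  by apply: h1; rewrite kr.
Qed.

(** One monomial beyond [nmon d.+2 N] already raises [lo] to [nmon d.+1 N + 1]. In degree 1 [lo] is
    constant on positive numbers, so such a bound starts in degree 2. *)
Lemma lo_bound d N c : (lo d.+2 c <= nmon d.+1 N)%N -> (c <= nmon d.+2 N)%N.
Proof.
case: N => [|N] h; rewrite leqNgt; apply/negP => lt.
  by have := lo_gt0 d.+1 (leq_ltn_trans (leq0n _) lt); rewrite nmonS0 in h; lia.
have := lo_mono d.+2 lt; rewrite -[(nmon _ _).+1]addn1 loS; last exact: leq_trans (leq_nmon _ _).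
by rewrite [lo _ 1]/lo grS1; lia.
Qed.

Lemma flag_macaulay a q : row_free (flag_mx a q) -> macaulay_seq (n - q) (HF (flag a q)).
Proof.
move=> fr; have [gq q1] := flag_gideal a q.
have mac d := macaulay hK d gq; split=> //; first exact: HF0.
elim=> [|[|d] ih]; first by rewrite HF0 // nmon0.
  (* Degree 1 comes from the independence of the forms; the higher degrees follow from it by
     [lo_bound]. *)
  by rewrite nmon_deg1; exact: flag_HF1.
by apply: lo_bound; apply: leq_trans ih.
Qed.

Lemma wlp_iter a k q : wlp_upto a k -> (q <= k)%N -> HF (flag a q) =1 iter q delta (hilb I).
Proof.
move=> [_ h]; elim: q => [|q ih] le d //; rewrite h //= /delta.
by case: d => [|d]; rewrite !ih // ltnW.
Qed.

Lemma wlp_hilb k : (k <= n)%N -> kWLP k I ->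
  macaulay_seq (n - k) (iter k delta (hilb I)) /\
  forall p d, (p <= k)%N -> iter p delta (hilb I) d = 0%N -> iter p delta (hilb I) d.+1 = 0%N.
Proof.
move=> kn hw; have [a ha] := wlp_flag kn hw; split.
  have [m0 m1 m2] := flag_macaulay ha.1.
  by split=> [|d|d]; rewrite -!(wlp_iter ha (leqnn k)).
move=> p d pk; rewrite -!(wlp_iter ha pk) => e; apply/eqP; rewrite -leqn0 leqNgt; apply/negP.
by move=> /(lo_gt0 d); rewrite ltnNge -e macaulay //; exact: (flag_gideal a p).1.
Qed.

Theorem betti_le_wlp k i j : (0 < k <= n)%N -> kWLP k I ->
  (betti I i (i + j) <= EK_sum (n - k) (fun m d => iter (n - k - m) (gr d) (iter k delta (hilb I) d)) i j
     + drop_sum n k (hilb I) i j)%N.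
Proof.
move=> /andP[k0 kn] hw; have [a ha] := wlp_flag kn hw.
have hk := wlp_iter ha (leqnn k).
have [|a' [e fr hg]] := generic_flag ha (q := n); first by rewrite kn leqnn.
pose A : 'M[K]_n := flag_mx a' n.
have uA : A \in unitmx by rewrite -row_free_unit.
have eq q : (q <= k)%N -> flag a' q = flag a q.
  by move=> le; apply: flag_ext => r lt; apply: e; exact: leq_trans lt le.
apply: leq_trans (betti_le_forms hK i j hI uA (V := flag a') _ _) _ => //.
  by move=> r; rewrite rowK.
rewrite (EK_sum_drop (k := k) (h := hilb I)) //; last first.
  by move=> p le d; rewrite subKn ?(leq_trans le) // eq // (wlp_iter ha).
rewrite leq_add2r; apply: EK_sum_mono.
- move=> m lt; have lt' : (m < n)%N by lia.
  have := qdim_colon j (flag_gideal a' (n - m.+1)).1 (lf_form (a' (n - m.+1)%N)).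
  have -> : (n - m)%N = (n - m.+1).+1 by lia.
  by move=> [nu _ /= ->]; exact: leq_addr.
(* Each quotient past the k-th applies Green's bound once, starting from the k-th difference of the
   Hilbert function, which the WLP fixes. *)
- move=> m d lt; have [r er] : exists r, (n - k - m = r)%N by exists (n - k - m)%N.
  rewrite er; elim: r m lt er => [|r ih] m lt er; first by lia.
  have -> : (n - m)%N = (n - m.+1).+1 by lia.
  apply: leq_trans (hg _ d _) _; first by lia.
  rewrite iterS; apply: gr_mono; have [lt2|le2] := ltnP m.+1 (n - k).
    by apply: ih => //; lia.
  have -> : r = 0%N by lia.
  by rewrite /= -hk -eq // (_ : n - m.+1 = k)%N //; lia.
- by move=> d; rewrite subnn /= subKn // eq // hk.
Qed.

End Flag.
End Flags.

(** * Adding one variable to a set of standard monomials *)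

Section Count.
Variable n : nat.
Local Notation mono := 'X_{1..n}.
Implicit Types (O : pred mono) (m u : mono).

Lemma hcount_seq O d (L : seq mono) : uniq L ->
  (forall m, m \in L <-> mdeg m = d /\ O m) -> hcount O d = size L.
Proof.
move=> uL hL; rewrite /hcount cardE -(size_map val); apply: perm_size; apply: uniq_perm => //.
  by rewrite map_inj_uniq ?enum_uniq //; exact: val_inj.
move=> m; apply/mapP/idP => [[m' + ->]|/hL [md Om]].
  by rewrite mem_enum inE => /andP[/eqP md Om]; apply/hL.
have lt : (mdeg m < d.+1)%N by rewrite md.
by exists (BMultinom lt) => //; rewrite mem_enum inE /= md eqxx.
Qed.

Lemma hcount_gt0 O m : O m -> (0 < hcount O (mdeg m))%N.
Proof.
move=> Om; rewrite card_gt0; apply/set0Pn.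
by exists (BMultinom (ltnSn (mdeg m))); rewrite inE /= eqxx.
Qed.

Section Step.
Variables (O : pred mono) (x : 'I_n) (g : nat -> nat) (a : nat).
Hypothesis dO : div_closed O.
Hypothesis sO : forall m (i : 'I_n), O m -> (x <= i)%N -> m i = 0%N.
Hypothesis stO : forall (s y : 'I_n) m, (s < y < x)%N -> O (m + U_(s))%MM -> O (m + U_(y))%MM.
Hypothesis hO : hcount O =1 delta g.
Hypothesis g_pos : forall d, (d <= a)%N -> (0 < delta g d)%N.
Hypothesis g_zero : forall d, (a < d)%N -> delta g d = 0%N.

(** The order compares degrees first, so the list runs through O degree by degree and, for d <= a,
    [g d] cuts it exactly after degree d ([take_std]). *)
Definition std_list : seq mono :=
  sort <=%O [seq m <- [seq bmnm m | m : 'X_{1..n < a.+1}] | O m].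
Local Notation S := std_list.

Lemma O_deg m : O m -> (mdeg m <= a)%N.
Proof.
by move=> /hcount_gt0; rewrite hO; apply: contraTT; rewrite -ltnNge => /g_zero ->.
Qed.

Lemma mem_std m : (m \in S) = O m.
Proof.
rewrite mem_sort mem_filter andb_idr // => Om; apply/mapP.
have lt : (mdeg m < a.+1)%N by rewrite ltnS O_deg.
by exists (BMultinom lt); rewrite ?mem_enum //.
Qed.

Lemma uniq_std : uniq S.
Proof. by rewrite sort_uniq filter_uniq // map_inj_uniq ?enum_uniq //; exact: val_inj. Qed.

Lemma pairwise_std : pairwise (fun m m' => (m < m')%O) S.
Proof.
rewrite -[pairwise _ _]/(pairwise <%O S) -lt_sorted_pairwise.
by rewrite sort_lt_sorted -(sort_uniq <=%O) uniq_std.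
Qed.

(** Up to its peak at a the function g increases, so it is the sum of its differences, and these
    count O in each degree. *)
Lemma g_count d : (d <= a)%N -> g d = count (fun m => mdeg m <= d)%N S.
Proof.
have hS e : count (fun m => mdeg m == e) S = delta g e.
  rewrite -hO -size_filter; symmetry; apply: hcount_seq; first by rewrite filter_uniq ?uniq_std.
  by move=> m; rewrite mem_filter mem_std; split=> [/andP[/eqP]|[/eqP -> ->]].
elim: d => [_|d ih lt]; first by have := hS 0%N; rewrite /delta subn0 => <-; apply: eq_count => m; rewrite leqn0.
have e : g d.+1 = (g d + delta g d.+1)%N by have := g_pos lt; rewrite /delta; lia.
rewrite e -hS.
rewrite (ih (ltnW lt)).
rewrite -[in RHS]size_filter.
rewrite -(count_predC (fun m : mono => mdeg m <= d)%N).
rewrite !count_filter.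
congr (_ + _)%N; apply: eq_count => m /=; lia.
Qed.

Lemma take_std d : (d <= a)%N -> take (g d) S = [seq m <- S | mdeg m <= d]%N.
Proof.
move=> le; rewrite g_count // -(filter_initial (r := fun m m' => (m < m')%O)) ?pairwise_std //.
by move=> m m' /ltW /lemc_mdeg h; exact: leq_trans.
Qed.

Lemma g_anti d d' : (a <= d <= d')%N -> (g d' <= g d)%N.
Proof.
move=> /andP[ad /subnKC <-]; elim: (d' - d)%N => [|e ih]; first by rewrite addn0.
have := g_zero (d := (d + e).+1); rewrite addnS => h; apply: leq_trans ih.
by rewrite -subn_eq0; apply/eqP; apply: h; lia.
Qed.

Lemma size_std : size S = g a.
Proof.
rewrite g_count //; apply/esym/eqP; rewrite -all_count; apply/allP => m.
by rewrite mem_std => /O_deg.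
Qed.

Lemma g_le d : (g d <= size S)%N.
Proof.
have [le|lt] := leqP d a; first by rewrite g_count ?count_size.
by rewrite size_std; apply: g_anti; rewrite leqnn ltnW.
Qed.

Lemma take_deg d u : u \in take (g d) S -> (mdeg u <= d)%N.
Proof.
have [le|lt] := leqP d a; first by rewrite take_std // mem_filter => /andP[].
by move/mem_take; rewrite mem_std => /O_deg; lia.
Qed.

(** The initial segments grow up to d = a, consisting of the elements of degree at most d, and
    shrink afterwards. Hence passing to a smaller u in O is harmless, and so is lowering d while it
    stays at least deg u. *)
Lemma take_lower d d' u u' : O u -> (mdeg u <= d <= d')%N -> (u <= u')%O ->
  u' \in take (g d') S -> u \in take (g d) S.
Proof.
move=> Ou /andP[ud dd'] uu' hu'; have [le|lt] := leqP d a.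
  by rewrite take_std // mem_filter ud mem_std.
have : u \in take (g d') S.
  move: uu'; rewrite le_eqVlt => /predU1P[-> //|lt'].
  apply: (take_pairwise_initial pairwise_std _ _ _ lt' hu'); last by rewrite mem_std.
    by move=> b; rewrite ltxx.
  by move=> b c e; exact: lt_trans.
have le : (g d' <= g d)%N by apply: g_anti; rewrite (ltnW lt).
by rewrite -(take_takel S le) => /mem_take.
Qed.

Definition strip m : mono := [multinom (if i == x then 0%N else m i) | i < n].

Lemma stripE m i : strip m i = if i == x then 0%N else m i.
Proof. by rewrite mnmE. Qed.

Lemma strip_part m : m = (strip m + U_(x) *+ m x)%MM.
Proof.
apply/mnmP => i; rewrite mnmDE mulmnE mnm1E stripE eq_sym.
by case: eqP => [->|_]; rewrite ?mul1n ?addn0.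
Qed.

Lemma mdeg_strip m : mdeg m = (mdeg (strip m) + m x)%N.
Proof. by rewrite {1}(strip_part m) mdegD mdegMn mdeg1 mul1n. Qed.

Lemma strip_deg m : (mdeg (strip m) <= mdeg m)%N.
Proof. by rewrite [leqRHS]mdeg_strip leq_addr. Qed.

Lemma stripDx m : strip (U_(x) + m) = strip m.
Proof. by apply/mnmP => i; rewrite !stripE mnmDE mnm1E eq_sym; case: eqP. Qed.

Lemma stripD m i : i != x -> strip (U_(i) + m) = (U_(i) + strip m)%MM.
Proof.
move=> ix; apply/mnmP => y; rewrite mnmDE !stripE mnmDE mnm1E.
by case: eqP => // ->; rewrite (negbTE ix).
Qed.

Lemma strip_id m : m x = 0%N -> strip m = m.
Proof. by move=> mx; apply/mnmP => i; rewrite stripE; case: eqP => // ->. Qed.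

(* The monomials u x^e with u in O whose rank in O is less than g_(deg u + e). *)
Definition step : pred mono := fun m => strip m \in take (g (mdeg m)) S.

Lemma step_O m : step m -> O (strip m).
Proof. by move/mem_take; rewrite mem_std. Qed.

Lemma step_supp m (i : 'I_n) : step m -> (x.+1 <= i)%N -> m i = 0%N.
Proof.
move=> /step_O Om lt; have := sO Om (ltnW lt); rewrite stripE.
by case: (i =P x) => // e; rewrite e ltnn in lt.
Qed.

(** Division by x lowers only the total degree, division by another variable also makes u smaller;
    both are instances of [take_lower]. *)
Lemma step_div_closed : div_closed step.
Proof.
apply: div_closed_var => i m; rewrite /step => h.
have [e|ix] := eqVneq i x.
  rewrite e stripDx in h; apply: (take_lower _ _ _ h) => //.
    by have := mem_take h; rewrite mem_std.
  by rewrite mdegD leq_addl andbT strip_deg.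
rewrite stripD // in h; apply: (take_lower _ _ _ h).
- by have := mem_take h; rewrite mem_std addmC => /dO.
- by rewrite mdegD leq_addl andbT strip_deg.
- exact: lemc_addl.
Qed.

Lemma step_stable (s y : 'I_n) m : (s < y < x.+1)%N -> step (m + U_(s))%MM -> step (m + U_(y))%MM.
Proof.
move=> /andP[sy yx]; rewrite /step !mdegD !mdeg1 ![(m + _)%MM]addmC => h.
have sx : s != x by apply/eqP => e; rewrite e in sy; lia.
rewrite stripD // in h; have Oh : O (U_(s) + strip m)%MM by have := mem_take h; rewrite mem_std.
have dm : (mdeg (strip m) <= mdeg m)%N by rewrite strip_deg.
have [e|ne] := eqVneq y x.
  rewrite e stripDx; apply: (take_lower _ _ _ h); [by rewrite addmC in Oh; exact: dO Oh| |exact: lemc_addl].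
  by rewrite leqnn andbT; lia.
rewrite stripD //; apply: (take_lower _ _ _ h).
- rewrite addmC; apply: (@stO s); last by rewrite addmC.
  by rewrite sy ltn_neqAle -ltnS yx andbT -(inj_eq val_inj) in ne *.
- by rewrite mdegD mdeg1 leqnn andbT; lia.
- rewrite lemc_add2l; apply/ltW/ltmcP; first by rewrite !mdeg1.
  have ys : (y == s) = false by apply/eqP => e; rewrite e ltnn in sy.
  exists s; last by rewrite !mnm1E eqxx ys.
  move=> k ks; rewrite !mnm1E.
  have -> : (s == k) = false by apply/eqP => e; rewrite e ltnn in ks.
  by have -> : (y == k) = false by apply/eqP => e; rewrite -e in ks; lia.
Qed.

Lemma step_low m : O m -> step m.
Proof.
move=> Om; have mx : m x = 0%N by exact: sO Om (leqnn _).
by rewrite /step strip_id // take_std ?O_deg // mem_filter leqnn mem_std.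
Qed.

Lemma trunc_step : trunc step x = O.
Proof.
apply/funext => m; apply/truncP/idP => [[/step_O + h]|Om]; first by rewrite strip_id ?h.
by split=> [|i le]; [exact: step_low|exact: sO Om le].
Qed.

(** Each of the first [g d] elements u has degree at most d and contributes exactly u x^(d - deg
    u). *)
Lemma step_hcount d : hcount step d = g d.
Proof.
rewrite (@hcount_seq _ _ [seq (u + U_(x) *+ (d - mdeg u))%MM | u <- take (g d) S]).
- by rewrite size_map size_takel ?g_le.
- have ux u : u \in take (g d) S -> u x = 0%N.
    by move/mem_take; rewrite mem_std => Ou; exact: sO Ou (leqnn _).
  rewrite map_inj_in_uniq ?take_uniq ?uniq_std // => u u' hu hu' /mnmP e.
  apply/mnmP => i; have := e i; rewrite !mnmDE !mulmnE !mnm1E.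
  by case: (x =P i) => [<-|_]; rewrite ?ux // !addn0.
move=> m; split=> [/mapP[u hu ->]|[md hm]].
  have Ou : O u by have := mem_take hu; rewrite mem_std.
  have ux : u x = 0%N by exact: sO Ou (leqnn _).
  have md : mdeg (u + U_(x) *+ (d - mdeg u)) = d.
    by rewrite mdegD mdegMn mdeg1 mul1n subnKC ?take_deg.
  split=> //; rewrite /step md (_ : strip _ = u) //.
  apply/mnmP => i; rewrite stripE mnmDE mulmnE mnm1E eq_sym.
  by case: eqP => [<-|_]; rewrite ?ux ?addn0.
apply/mapP; exists (strip m); first by rewrite -md.
by rewrite -md (mdeg_strip m) addKn -strip_part.
Qed.

End Step.
End Count.

(** * Borel-fixed ideals with the k-SLP *)

Section Borel.
Variables (K : fieldType) (n : nat) (O : pred 'X_{1..n}).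
Local Notation R := {mpoly K[n]}.
Hypothesis dO : div_closed O.
Hypothesis stO : stable O.

(** Expand one variable at a time: by triangularity x_j becomes a combination of the x_i with i <=
    j, and by stability a nonstandard monomial stays nonstandard when x_j is replaced by such an
    x_i. *)
Lemma monI_lin_subst (g : 'M[K]_n) (p : R) : is_trig_mx g^T -> monI O p -> monI O (lin_subst g p).
Proof.
move=> /is_trig_mxP gt hp; have sW := monI_subspace K O.
(* The factor ['X_[m0]] collects the variables that have already been replaced. *)
have H m m0 : ~~ O (m + m0)%MM -> monI O (lin_subst g ('X_[m] : R) * 'X_[m0]).
  have [k] := ubnP (mdeg m); elim: k m m0 => // k ih m m0 lt nO.
  have [/eqP|] := posnP (mdeg m).
    rewrite mdeg_eq0 => /eqP m00; move: nO; rewrite m00 add0m => nO.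
    by rewrite mpolyX0 /lin_subst rmorph1 mul1r; apply/monI_X.
  move=> mpos; have [j hj] : exists j, (0 < m j)%N by apply: (@mdegS_exists _ _ (mdeg m).-1); rewrite prednK.
  have mE := mnm_subK hj; rewrite {1}mE mpolyXD lin_substM -mulrA.
  have -> : lin_subst g ('X_j : R) = \sum_(i < n) g i j *: 'X_i.
    by rewrite /lin_subst comp_mpolyXU -tnth_nth tnth_mktuple.
  rewrite mulr_suml; apply: (subspace_sum sW) => i _.
  have [ij|ji] := leqP i j; last first.
    by have := gt j i ji; rewrite mxE => ->; rewrite scale0r mul0r; exact: sW.1.
  rewrite -scalerAl; apply: (subspaceZ sW).
  rewrite mulrCA -mpolyXD; apply: ih; first by move: lt; rewrite {1}mE mdegD mdeg1 add1n ltnS.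
  move: ij; rewrite leq_eqVlt => /predU1P[/val_inj ->|ij].
    by rewrite addmA [(_ + U_(j))%MM]addmC -mE.
  apply: contraNN nO => h; rewrite {1}mE -addmA addmC; apply: (stO ij).
  by rewrite -addmA [(m0 + _)%MM]addmC.
rewrite lin_substE; apply: (subspace_sum sW) => m _.
have [Om|nO] := boolP (O m); first by rewrite hp // scale0r; exact: sW.1.
by apply: (subspaceZ sW); rewrite -[lin_subst _ _]mulr1 -mpolyX0; apply: H; rewrite addm0.
Qed.

(** Strong induction on the row: in the entry (i, j) of the product of A and its inverse, with i <
    j, only the term with the diagonal entry of A survives. *)
Lemma trig_inv (A : 'M[K]_n) : A \in unitmx -> is_trig_mx A -> is_trig_mx (invmx A).
Proof.
move=> uA tA; have nz i : A i i != 0.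
  move: uA; rewrite unitmxE det_trig // unitfE => /prodf_neq0; exact.
move: tA => /is_trig_mxP tA; apply/is_trig_mxP => i j.
have [k] := ubnP i; elim: k i => // k ih i lt ij.
have /matrixP/(_ i j) := mulmxV uA; rewrite !mxE (bigD1 i) //= big1 => [|l li].
  rewrite addr0 (_ : i == j = false); last by apply/eqP => e; rewrite e ltnn in ij.
  by move/eqP; rewrite mulf_eq0 (negbTE (nz i)) => /eqP.
have [il|li'] := ltnP i l; first by rewrite tA ?mul0r.
have li2 : (l < i)%N by rewrite ltn_neqAle (inj_eq val_inj) li.
by rewrite ih ?mulr0 //; [exact: leq_trans li2 lt|exact: ltn_trans ij].
Qed.

Lemma monI_borel_fixed : borel_fixed (@monI_pred K n O).
Proof.
move=> g ug tg; apply/seteqP; split=> [_ /= [p /asboolP hp <-]|p /= /asboolP hp].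
  by apply/asboolP; exact: monI_lin_subst.
exists (lin_subst (invmx g) p); last exact: lin_substVK.
by apply/asboolP; apply: monI_lin_subst => //; rewrite trmx_inv; apply: trig_inv; rewrite ?unitmx_tr.
Qed.

End Borel.

Section SLPStep.
Variables (K : fieldType) (n : nat) (O : pred 'X_{1..n}) (x : 'I_n) (s i : nat).
Local Notation R := {mpoly K[n]}.

Definition full_power (W : R -> Prop) (l : R) (s i : nat) : Prop :=
  (forall p, hform i p -> W (l ^+ s * p) -> W p) \/
  (forall q, hform (i + s) q -> exists2 p, hform i p & W (q - l ^+ s * p)).

Lemma monI_power_inj : (forall m, mdeg m = i -> O m -> O (U_(x) *+ s + m)%MM) ->
  full_power (monI O) 'X_x s i.
Proof.
move=> h; left=> p hp hW m Om.
have [md|md] := eqVneq (mdeg m) i; last exact: (dhomog_nemf_coeff hp).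
by have := hW _ (h m md Om); rewrite mpolyXn mulrC mcoeffMX.
Qed.

Lemma monI_power_surj : (forall m, mdeg m = (i + s)%N -> O m -> (s <= m x)%N) ->
  full_power (monI O) 'X_x s i.
Proof.
move=> h; right=> q hq.
have dq m : m \in msupp q -> mdeg m = (i + s)%N by move/(dhomog_mf hq).
have mE m : m \in msupp q -> O m -> m = (U_(x) *+ s + (m - U_(x) *+ s))%MM.
  move=> /dq /h H /H le; rewrite addmC submK //; apply/mnm_lepP => y.
  by rewrite mulmnE mnm1E; case: eqP => [<-|_]; rewrite ?mul1n.
exists (\sum_(m <- msupp q | O m) q@_m *: 'X_[m - U_(x) *+ s]).
  rewrite big_seq_cond; apply: (subspace_sum (form_subspace K n i)) => m /andP[mq Om].
  apply: (subspaceZ (form_subspace K n i)); rewrite /hform dhomogX /=.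
  by have := dq m mq; rewrite {1}(mE m mq Om) mdegD mdegMn mdeg1 mul1n addnC => /eqP; rewrite eqn_add2r.
move=> m Om; rewrite mcoeffB (_ : _ * _ = mfilter O q) ?mcoeff_mfilter ?Om ?subrr //.
rewrite /mfilter mulr_sumr big_seq_cond [RHS]big_seq_cond; apply: eq_bigr => m' /andP[mq Om'].
by rewrite -scalerAr mpolyXn -mpolyXD -mE.
Qed.

End SLPStep.

Lemma support_bound (G : nat -> nat) D : G 0%N = 1%N -> (forall d, G d = 0%N -> G d.+1 = 0%N) ->
  G D = 0%N -> exists a, (forall d, (d <= a)%N -> (0 < G d)%N) /\ forall d, (a < d)%N -> G d = 0%N.
Proof.
move=> G0 Gs GD; have ex : exists d, G d == 0%N by exists D; rewrite GD.
case: (ex_minnP ex) => -[|a] /eqP Ga hmin; first by rewrite G0 in Ga.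
exists a; split=> [d le|d].
  by rewrite lt0n; apply/negP => /hmin; rewrite ltnNge le.
elim: d => // d ih; rewrite ltnS leq_eqVlt => /predU1P[<- //|/ih]; exact: Gs.
Qed.

Lemma iter_delta0 h p : iter p delta h 0%N = h 0%N.
Proof. by elim: p => //= p ih; rewrite /delta subn0. Qed.

Lemma iter_delta_le h p d : (iter p delta h d <= h d)%N.
Proof. by elim: p => //= p ih; apply: leq_trans (leq_subr _ _) ih. Qed.

Lemma trunc_trunc n (O : pred 'X_{1..n}) M x : (M <= x)%N -> trunc (trunc O x) M = trunc O M.
Proof.
move=> le; apply/funext => m; apply/truncP/truncP => [[/truncP[]]|[Om hm]] //.
by split=> //; apply/truncP; split=> // i le'; apply: hm; exact: leq_trans le'.
Qed.

(** * The ideal that attains the bound *)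

Section Tower.
Variables (K : fieldType) (n k D : nat) (h : nat -> nat).
Local Notation R := {mpoly K[n]}.
Local Notation N := (n - k)%N.
Hypothesis kn : (k <= n)%N.
Hypothesis mh : macaulay_seq N (iter k delta h).
Hypothesis hs : forall p d, (p <= k)%N -> iter p delta h d = 0%N -> iter p delta h d.+1 = 0%N.
Hypothesis h_0 : forall d, (D <= d)%N -> h d = 0%N.

(** p counts the variables added so far. Truncating back to N + q variables recovers the set of
    stage q, so Hilbert functions and full ranks of earlier stages persist. *)
Lemma tower_exists p : (p <= k)%N -> exists O : pred 'X_{1..n},
  [/\ [/\ div_closed O, O 0%MM,
    forall m (i : 'I_n), O m -> (N + p <= i)%N -> m i = 0%N &
    forall (s y : 'I_n) m, (s < y < N + p)%N -> O (m + U_(s))%MM -> O (m + U_(y))%MM],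
    trunc O N = lexO (iter k delta h) N,
    forall q, (q <= p)%N -> hcount (trunc O (N + q)) =1 iter (k - q) delta h &
    forall (x : 'I_n) s i, (N <= x < N + p)%N ->
      full_power (@monI K n (trunc O x.+1)) 'X_x s i].
Proof.
have [m0 m1 m2] := mh; have leN := leq_subr k n.
elim: p => [_|p ih lt].
  exists (lexO (iter k delta h) N); have tr := @trunc_lexO n (iter k delta h) N leN.
  split=> //.
  - split; [exact: lexO_down|exact: lexO0| |].
      move=> m i Om le; apply/eqP; apply: contraTT isT => mi.
      by have := lexO_supp leN Om mi; lia.
    by move=> s y m sy; apply: lexO_stable => //; lia.
  - by move=> q; rewrite leqn0 => /eqP -> d; rewrite addn0 subn0 tr -{1}tr lexO_hcount.
  - by move=> x s i; lia.
have [O [[dO O0 sO stO] tO hO fO]] := ih (ltnW lt).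
have ltx : (N + p < n)%N by lia.
(* Stage p has Hilbert function [delta g], and stage p + 1 must have [g]. *)
pose x := Ordinal ltx; pose g := iter (k - p.+1) delta h.
have ek : (k - p = (k - p.+1).+1)%N by lia.
have dg : delta g =1 iter (k - p) delta h by move=> d; rewrite ek.
have tOx : trunc O (N + p) = O.
  by apply/funext => m; apply/truncP/idP => [[]|Om] //; split=> // i /(sO _ _ Om).
have hOg : hcount O =1 delta g by move=> d; rewrite dg -hO // tOx.
have [|||a [apos a0]] := @support_bound (delta g) D.
- by rewrite dg iter_delta0 -(iter_delta0 h k).
- by move=> d; rewrite !dg; apply: hs; lia.
- by rewrite dg; apply/eqP; rewrite -leqn0 -(h_0 (leqnn D)) iter_delta_le.
have sO' : forall m (i : 'I_n), O m -> (x <= i)%N -> m i = 0%N := sO.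
exists (step O x g a).
have trx : trunc (step O x g a) x = O by exact: trunc_step sO' hOg apos a0.
have tx M : (M <= x)%N -> trunc (step O x g a) M = trunc O M.
  by move=> le; rewrite -[in RHS]trx trunc_trunc.
have sS := step_supp sO' hOg a0.
have tS : trunc (step O x g a) (N + p).+1 = step O x g a.
  by apply/funext => m; apply/truncP/idP => [[]|Om] //; split=> // i; exact: sS.
have hS : hcount (step O x g a) =1 g by move=> d; exact: step_hcount sO' hOg apos a0 d.
split.
- split.
  + exact: step_div_closed dO hOg apos a0.
  + exact: step_low sO' hOg apos a0 _ O0.
  + by move=> m i Om; rewrite addnS; exact: sS Om.
  + move=> s y m sy; apply: (step_stable dO (x := x) stO hOg apos a0).
    by rewrite /= -addnS.
- by rewrite tx ?tO ?leq_addr.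
- move=> q; rewrite leq_eqVlt => /predU1P[->|lq] d; first by rewrite addnS tS hS.
  by rewrite tx ?hO //= leq_add2l.
move=> y s i /andP[Ny]; rewrite addnS ltnS leq_eqVlt => /predU1P[ey|lty]; last first.
  by rewrite tx //; apply: fO; rewrite Ny.
have -> : y = x by exact: val_inj.
(* If g_i <= g_(i+s), the initial segment for degree i lies in that for degree i + s and x^s is
   injective. Otherwise the part u of a standard monomial of degree i + s is among the first g_i
   elements, so deg u <= i and x^s divides it. *)
rewrite tS; have [le|le] := leqP (g i) (g (i + s)%N).
  apply: monI_power_inj => m md; rewrite /step.
  have -> : strip x (U_(x) *+ s + m)%MM = strip x m.
    apply/mnmP => u; rewrite !stripE mnmDE mulmnE mnm1E eq_sym.
    by case: eqP.
  rewrite mdegD mdegMn mdeg1 mul1n md addnC; set L := std_list _ _.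
  by rewrite -{1}(take_takel L le) => /mem_take.
apply: monI_power_surj => m md; rewrite /step md; set L := std_list _ _.
rewrite -(take_takel L (ltnW le)) => /mem_take/(take_deg hOg apos a0) dm.
by have := mdeg_strip x m; rewrite md; lia.
Qed.

Hypothesis hK : [pchar K] =i pred0.

Theorem borel_ideal_exists : exists I : {pred R},
  [/\ graded_artinian I, borel_fixed I, kSLP k I, hilb I =1 h &
    forall i j, betti I i (i + j) =
      (EK_sum N (fun m d => iter (N - m) (gr d) (iter k delta h d)) i j + drop_sum n k h i j)%N].
Proof.
have [O [[dO O0 _ stO] tO hO fO]] := tower_exists (leqnn k).
have nk : (N + k = n)%N by rewrite subnK.
have st : stable O by move=> s y m sy; apply: stO; rewrite sy nk /=.
have hI : homog_ideal (@monI_pred K n O) by exact: monI_homog_ideal.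
have hh : hilb (@monI_pred K n O) =1 h.
  by move=> d; have := hO k (leqnn k) d; rewrite nk trunc_full subnn hilb_monI.
have aI : graded_artinian (@monI_pred K n O).
  by split=> //; apply: (homog_artinian (D := D)) => // d /h_0; rewrite hh.
exists (@monI_pred K n O); split=> //.
- exact: monI_borel_fixed.
(* The forms are the variables from the last one backwards, which undo the stages of the tower in
   reverse order. *)
- pose g : k.-tuple R := [tuple 'X_(rev_ord (widen_ord kn i)) | i < k].
  exists g; split=> [i|i]; first by rewrite tnth_mktuple; exact: X_form1.
  have ad q : (q <= k)%N -> (fun p => p \in adjoin (@monI_pred K n O) (take q g)) =
      monI (trunc O (n - q)) :> (R -> Prop).
    elim: q => [_|q ih lt]; first by rewrite take0 adjoin_nil // monI_predE subn0 trunc_full.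
    have lg : (q < size g)%N by rewrite size_tuple.
    rewrite (take_nth 0 lg) adjoin_rcons (ih (ltnW lt)).
    have -> : nth 0 g q = 'X_(rev_ord (widen_ord kn (Ordinal lt))).
      by rewrite -[q in LHS]/(val (Ordinal lt)) -tnth_nth tnth_mktuple.
    rewrite plus_monI; congr monI; set x := rev_ord _.
    have -> : (n - q.+1)%N = x by [].
    by rewrite truncS; have -> : (x.+1 = n - q)%N by rewrite /=; lia.
  move=> d s _; have e := ad i (ltnW (ltn_ord i)).
  have := fO (rev_ord (widen_ord kn i)) s d.
  have -> : ((rev_ord (widen_ord kn i)).+1 = n - i)%N by have := ltn_ord i; rewrite /=; lia.
  rewrite -e tnth_mktuple; apply.
  by have := ltn_ord i; rewrite /=; lia.
move=> i j.
rewrite (eliahou_kervaire hK i j aI (O := O)) ?monI_predE //.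
rewrite (EK_sum_drop (k := k) (h := h)) //; last first.
  move=> p le d; have -> : (n - p = N + (k - p))%N by lia.
  by rewrite hO ?leq_subr // subKn.
congr (_ + _)%N; apply: eq_EK_sum => m le d.
have [_ m1 _] := mh; have leN := leq_subr k n.
rewrite -(trunc_trunc O le) tO -{1}(subKn le) hcount_trunc_iter ?leq_subr //; last exact: lexO_closed.
by rewrite lexO_hcount.
Qed.

End Tower.

Theorem theorem54 (K : fieldType) (hK : [pchar K] =i pred0)
    (n k : nat) (hk : (1 <= k <= n)%N) :
  (forall I : {pred {mpoly K[n]}}, graded_artinian I -> kWLP k I ->
     ((k < n)%N -> forall i j : nat,
        (betti I i (i + j)
         <= betti_lex K (n - k) (iter k delta (hilb I)) i (i + j)
            + drop_sum n k (hilb I) i j)%N) /\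
     (k = n -> forall i j : nat, (1 <= i)%N ->
        (betti I i (i + j) <= drop_sum n k (hilb I) i j)%N))
  /\
  (forall h : nat -> nat, O_sequence K h ->
     (exists J : {pred {mpoly K[n]}},
        [/\ graded_artinian J, kWLP k J & hilb J =1 h]) ->
     exists I : {pred {mpoly K[n]}},
       [/\ graded_artinian I, borel_fixed I, kSLP k I, hilb I =1 h
         & ((k < n)%N -> forall i j : nat,
              betti I i (i + j)
              = (betti_lex K (n - k) (iter k delta h) i (i + j)
                 + drop_sum n k h i j)%N) /\
           (k = n -> forall i j : nat, (1 <= i)%N ->
              betti I i (i + j) = drop_sum n k h i j)]).

Proof.
have kn : (k <= n)%N by case/andP: hk.
have iter0 (h : nat -> nat) D : (forall d, (D <= d)%N -> h d = 0%N) ->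
    forall d, (D <= d)%N -> iter k delta h d = 0%N.
  by move=> h0 d le; apply/eqP; rewrite -leqn0 -(h0 d le) iter_delta_le.
(* For k = n the lex part has no variables; only the term in bidegree (0, 0) remains, which i >= 1
   excludes. *)
have EK0 h i j : (1 <= i)%N -> EK_sum 0 h i j = 0%N.
  by rewrite /EK_sum big_geq // addn0; case: i.
split=> [I hI wI|h _ [J [hJ wJ eJ]]].
  have [mac _] := wlp_hilb hK hI kn wI; have [D hD] := artinian_hilb0 hI.
  split=> [_ i j|e i j i0].
    by rewrite (betti_lexE hK _ _ mac (iter0 _ D hD)) betti_le_wlp.
  have := betti_le_wlp hK hI i j hk wI.
  by rewrite (_ : n - k = 0)%N ?EK0 // e subnn.
have [D hD] := artinian_hilb0 hJ.
have eh : hilb J = h by apply/funext.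
have [mac sup] := wlp_hilb hK hJ kn wJ; rewrite eh in mac sup hD.
have [I [aI bI sI hI eqI]] := borel_ideal_exists (D := D) kn mac sup hD hK.
exists I; split=> //; split=> [_ i j|e i j i0].
  by rewrite eqI (betti_lexE hK _ _ mac (iter0 _ D hD)).
by rewrite eqI (_ : n - k = 0)%N ?EK0 // e subnn.
Qed.
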